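(* Let $(\sigma_{k,N})_{1\le k\le N,\,N\ge1}$ be a deterministic real triangular array, $D_N:=\operatorname{diag}(\sigma_{1,N},\dots,\sigma_{N,N})$, and let $S_N$ be the truncated shift on $\mathbb C^N$: $S_Ne_k=e_{k+1}$ for $1\le k<N$, $S_Ne_N=0$. Let $(b_k)_{k\ge1}$ be i.i.d. real random variables and $B_N:=\operatorname{diag}(b_1,\dots,b_{N-1},0)$. Suppose that $\sup_{N\ge1}\|D_N\|_{\mathrm{op}}<\infty$, $\|b_1\|_\infty<\infty$, and that $(D_N,S_N)$ converges in normalized joint $^*$-moments. Then the empirical spectral distribution of $$J_N:=S_ND_NB_N+B_ND_NS_N^*$$ converges weakly almost surely to a deterministic compactly supported probability measure $\mu_{\rho,b}$, and the expected empirical spectral distribution converges weakly to the same measure. More explicitly, for every nonzero finitely supported family $\ell=(\ell_i)_{i\in\mathbb Z}$ of nonnegative integers the limit $$L_\ell:=\lim_{N\to\infty}\frac1N\sum_{\substack{1\le p\le N\\ 1\le p+i\le N,\ i\in\operatorname{supp}\ell}}\ \prod_{i\in\mathbb Z}\sigma_{p+i,N}^{\ell_i}$$ exists (the sum is over those $p\in\{1,\dots,N\}$ such that $1\le p+i\le N$ for all $i\in\operatorname{supp}\ell$), and, with $L_0:=1$, for every integer $q\ge0$, $$\int x^q\,d\mu_{\rho,b}(x)=\sum_{\gamma\in\mathcal C_q}L_{\ell(\gamma)}\prod_{i\in\mathbb Z}\mathbb E\left[b_1^{\ell_i(\gamma)}\right].$$ If moreover there is a probability measure $\mu_T$ on $\mathbb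 R$ such that $\frac1{N-1}\sum_{k=1}^{N-1}\delta_{(\sigma_{k,N},\sigma_{k+1,N})}\Rightarrow\mathcal L(T,T)$ with $T\sim\mu_T$, then $L_{\ell(\gamma)}=\mathbb E T^q$ for every $\gamma\in\mathcal C_q$, and $\mu_{\rho,b}=\mathcal L(TX)$, where $X\sim\mu_b$ and $T,X$ are independent.
   Context: The empirical spectral distribution (ESD) of an $N\times N$ Hermitian matrix is its normalized eigenvalue counting measure; the expected ESD is its expectation. $\operatorname{tr}_N=\frac1N\operatorname{Tr}$. ''$(D_N,S_N)$ converges in normalized joint $^*$-moments'' means that $\operatorname{tr}_NP(D_N,S_N,S_N^* )$ converges as $N\to\infty$ for every noncommutative polynomial $P$ in three indeterminates. The subscript $\rho$ in $\mu_{\rho,b}$ is only notation for the (stationary) limiting law of the finite windows of the profile $\sigma$, which is determined by these limits. $\mathcal C_q$ is the set of paths $\gamma=(j_0,\dots,j_q)\in\mathbb Z^{q+1}$ with $j_0=j_q=0$ and $|j_s-j_{s-1}|=1$ for $1\le s\le q$; for $i\in\mathbb Z$, $\ell_i(\gamma):=\#\{1\le s\le q:\{j_{s-1},j_s\}=\{i,i+1\}\}$ and $\ell(\gamma)=(\ell_i(\gamma))_{i\in\mathbb Z}$. The law $\mu_b$ is the limit law of the simple tridiagonal model: the deterministic probability measure on $\mathbb R$ that is the almost sure weak limit of the ESDs of the $N\times N$ real symmetric zero-diagonal tridiagonal matrices whose entries in positions $(k,k+1)$ and $(k+1,k)$ are $b_k$, $1\le k\le N-1$. *)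

(* Defs.v *)
From HB Require Import structures.
From mathcomp Require Import all_boot all_order all_algebra.
From mathcomp Require Import complex.
From mathcomp Require Import all_classical all_reals all_analysis.
(* The notations of [monalg] and of [all_analysis] clash, hence the selective
   import. *)
From mathcomp Require monalg.
Import (canonicals) monalg.

Set Implicit Arguments.
Unset Strict Implicit.
Unset Printing Implicit Defensive.

Import Order.TTheory GRing.Theory Num.Theory.
Import numFieldNormedType.Exports.

Local Open Scope classical_set_scope.
Local Open Scope ring_scope.
Local Open Scope complex_scope.
Local Open Scope sesquilinear_scope.

(** * Matrices over the complex numbers *)

Definition l2norm (R : realType) (n : nat) (v : 'cV[R[i]]_n) : R :=
  Num.sqrt (\sum_k Normc.normc (v k 0) ^+ 2).

Definition opnorm (R : realType) (n : nat) (A : 'M[R[i]]_n) : \bar R :=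
  ereal_sup [set (l2norm (A *m v))%:E | v in [set v : 'cV_n | l2norm v <= 1]].

Definition ntr (R : realType) (n : nat) (A : 'M[R[i]]_n) : R[i] :=
  n%:R^-1 * \tr A.

(** Noncommutative polynomials: the algebra of the free monoid on the
    indeterminates. *)
Definition ncpoly (R : realType) (k : nat) : Type :=
  monalg.malg (monalg.fmonom 'I_k) R[i].

Definition nceval (R : realType) (k n : nat) (X : 'I_k -> 'M[R[i]]_n)
    (p : ncpoly R k) : 'M[R[i]]_n :=
  \sum_(m <- finmap.enum_fset (monalg.msupp p))
    monalg.mcoeff m p *: \prod_(j <- monalg.fmonom_val m) X j.

(** Only [sigma N k] with [1 <= k <= N], and [b k] with [1 <= k], are used
    below; rows and columns of matrices are numbered from 0. *)
Definition profile_mx (R : realType) (sigma : nat -> nat -> R) (N : nat) :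
    'M[R[i]]_N :=
  diag_mx (\row_k (sigma N k.+1)%:C).

Definition shift_mx (R : realType) (N : nat) : 'M[R[i]]_N :=
  \matrix_(i, j) (i == j.+1 :> nat)%:R.

Definition weight_mx (R : realType) (b : nat -> R) (N : nat) : 'M[R[i]]_N :=
  diag_mx (\row_k (if (k.+1 < N)%N then b k.+1 else 0)%:C).

Definition jacobi_mx (R : realType) (sigma : nat -> nat -> R) (b : nat -> R)
    (N : nat) : 'M[R[i]]_N :=
  shift_mx R N *m profile_mx sigma N *m weight_mx b N
  + weight_mx b N *m profile_mx sigma N *m (shift_mx R N)^t*.

Definition tridiag_mx (R : realType) (b : nat -> R) (N : nat) : 'M[R[i]]_N :=
  \matrix_(i, j) (if j == i.+1 :> nat then b i.+1
                  else if i == j.+1 :> nat then b j.+1 else 0)%:C.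

Definition star_moments_cvg (R : realType) (sigma : nat -> nat -> R) : Prop :=
  forall p : ncpoly R 3,
    cvgn (fun N : nat =>
      ntr (nceval (tnth [tuple profile_mx sigma N; shift_mx R N;
                         (shift_mx R N)^t*]) p) : R[i]^o).

(** * Empirical measures and weak convergence *)

Definition empirical_measure (R : realType) (d : measure_display)
    (T : measurableType d) (s : seq T) : set T -> \bar R :=
  fun A => (((size s)%:R^-1)%:E * \sum_(x <- s) \d_x A)%E.

Lemma empirical_measureE (R : realType) (d : measure_display)
    (T : measurableType d) (s : seq T) :
  empirical_measure R s =
  mscale ((size s)%:R^-1)%:nng (msum (fun k => \d_(nth point s k)) (size s)).
Proof.
apply/funext => A; rewrite /empirical_measure /mscale /msum /=.
by rewrite (big_nth point) big_mkord.
Qed.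

Fact empirical_measure0 (R : realType) (d : measure_display)
    (T : measurableType d) (s : seq T) : empirical_measure R s set0 = 0%E.
Proof. by rewrite empirical_measureE measure0. Qed.

Fact empirical_measure_ge0 (R : realType) (d : measure_display)
    (T : measurableType d) (s : seq T) (A : set T) :
  (0 <= empirical_measure R s A)%E.
Proof. by rewrite empirical_measureE measure_ge0. Qed.

Fact empirical_measure_sigma_additive (R : realType) (d : measure_display)
    (T : measurableType d) (s : seq T) :
  semi_sigma_additive (empirical_measure R s).
Proof.
by rewrite empirical_measureE; exact: measure_semi_sigma_additive.
Qed.

HB.instance Definition _ (R : realType) (d : measure_display)
    (T : measurableType d) (s : seq T) :=
  isMeasure.Build _ _ _ (empirical_measure R s) (@empirical_measure0 R d T s)
    (@empirical_measure_ge0 R d T s)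
    (@empirical_measure_sigma_additive R d T s).

(** [spectral_diag A] lists the eigenvalues of a normal matrix [A] with
    multiplicity; they are real when [A] is Hermitian. *)
Definition eigenvalues (R : realType) (n : nat) (A : 'M[R[i]]_n) : seq R :=
  [seq complex.Re (spectral_diag A 0 k) | k <- enum 'I_n].

Definition esd (R : realType) (n : nat) (A : 'M[R[i]]_n) :
    {measure set R -> \bar R} :=
  empirical_measure R (eigenvalues A).

Definition expected_esd (R : realType) (d : measure_display)
    (Om : measurableType d) (P : probability Om R) (n : nat)
    (A : Om -> 'M[R[i]]_n) : set R -> \bar R :=
  fun E => (\int[P]_w esd (A w) E)%E.

Definition weak_cvg (R : realType) (mu_ : nat -> set R -> \bar R)
    (mu : set R -> \bar R) : Prop :=
  forall f : R -> R, continuous f -> (exists M, forall x, `|f x| <= M) ->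
    (\int[mu_ n]_x (f x)%:E @[n --> \oo] --> \int[mu]_x (f x)%:E)%E.

Definition weak_cvg2 (R : realType) (mu_ : nat -> set (R * R) -> \bar R)
    (mu : set (R * R) -> \bar R) : Prop :=
  forall f : R * R -> R, continuous f -> (exists M, forall x, `|f x| <= M) ->
    (\int[mu_ n]_x (f x)%:E @[n --> \oo] --> \int[mu]_x (f x)%:E)%E.

Definition compactly_supported (R : realType) (mu : set R -> \bar R) : Prop :=
  exists2 K : set R, compact K & mu (~` K) = 0%E.

(** * Random variables indexed by the positive integers *)

Definition independent_RVs (R : realType) (d : measure_display)
    (Om : measurableType d) (P : probability Om R) (b : nat -> {RV P >-> R}) :
    Prop :=
  forall (I : seq nat) (A : nat -> set R), uniq I -> all (leq 1) I ->
    (forall k, measurable (A k)) ->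
    P (\bigcap_(k in [set` I]) (b k @^-1` A k)) =
    (\prod_(k <- I) P (b k @^-1` A k))%E.

Definition identically_distributed (R : realType) (d : measure_display)
    (Om : measurableType d) (P : probability Om R) (b : nat -> {RV P >-> R}) :
    Prop :=
  forall k, (1 <= k)%N -> forall A : set R, measurable A ->
    distribution P (b k) A = distribution P (b 1%N) A.

(** * Closed paths and window averages *)

Definition closed_path (q : nat) : set (q.+1.-tuple int) :=
  [set g : q.+1.-tuple int | [/\ nth 0 g 0 = 0, nth 0 g q = 0 &
    forall s, (1 <= s <= q)%N -> `|nth 0 g s - nth 0 g s.-1| = 1]].
Arguments closed_path q : clear implicits.

Definition crossings (q : nat) (g : q.+1.-tuple int) : int -> nat :=
  fun i => count (fun s =>
    ((nth 0 g s.-1 == i) && (nth 0 g s == i + 1)) ||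
    ((nth 0 g s.-1 == i + 1) && (nth 0 g s == i))) (iota 1 q).

Definition window_avg (R : realType) (sigma : nat -> nat -> R)
    (l : int -> nat) (N : nat) : R :=
  N%:R^-1 *
  \sum_(1 <= p < N.+1 | `[< forall i, l i <> 0%N -> 1 <= p%:Z + i <= N%:Z >])
    \big[*%R/1]_(i \in [set: int]) sigma N (absz (p%:Z + i)) ^+ l i.

Definition window_limit (R : realType) (sigma : nat -> nat -> R)
    (l : int -> nat) : R :=
  if `[< forall i, l i = 0%N >] then 1 else limn (window_avg sigma l).

(* Main.v *)
(** Expanding the trace over closed paths, [tr_N J_N^q] is the average over [p]
    of local polynomials in the weights [b_k], [|k - p| <= q]. Their means
    converge to the path sum because the weights are i.i.d. and the window
    averages of the profile are traces of words in [D_N], [S_N] and the adjoint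
    of [S_N]; their fluctuations have fourth moments of order [N^-2], since four
    local terms decorrelate unless they are close in pairs, so they are summable
    and vanish almost surely. All spectra lie in a fixed compact interval, where
    polynomials are dense, so the limits of the moments define a positive
    functional on continuous functions, i.e. a probability measure, and
    convergence of moments is weak convergence. If consecutive profile entries
    become equal, each window average only sees the total degree, and the
    moments factor as those of [T X]. *)

(* The weights are bounded only almost surely. They are replaced by their truncations at an
   essential bound, which are still i.i.d. and almost surely equal to them, so that every random
   variable met is bounded everywhere. The variable of integration is truncated likewise, and
   moments become integrals of bounded functions.

   Second moments of the fluctuations would only be of order 1/N, which is not summable; hence the
   fourth.

   The spectral bound is read off the traces: an even power of one eigenvalue is at most N times an
   average of path sums. The limit measure is built from one good sample point, which is enough
   since the limits of the moments are deterministic.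

   For the expected distribution, measurability of individual eigenvalues is not at hand. Only their
   power sums are visibly measurable, as polynomials in the weights; the rest follows by pointwise
   limits and a Dynkin argument.

   The profile has an entry at N but the matrix has no bond there, so traces and window averages
   differ by an edge term of order 1/N. *)
Require Import Defs.
From HB Require Import structures.
From mathcomp Require Import all_boot all_order all_algebra.
From mathcomp Require Import complex ring lra zify.
From mathcomp Require Import all_classical all_reals all_analysis.
From mathcomp Require Import measurable_realfun ess_sup_inf.
From mathcomp Require monalg.
Import (canonicals) monalg.
Set Implicit Arguments.
Unset Strict Implicit.
Unset Printing Implicit Defensive.
Import Order.TTheory GRing.Theory Num.Theory.
Import numFieldNormedType.Exports.
Local Open Scope classical_set_scope.
Local Open Scope ring_scope.

(** * Bounded measurable functions *)

Section bounded_measurable.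
Context (R : realType) (d : measure_display) (T : measurableType d).
Implicit Types X Y : T -> R.

(** The bound is pointwise rather than essential: the class is then an algebra, and its members are
    integrable against every probability at once. *)
Definition bounded_mfun X := measurable_fun setT X /\ exists M, forall x, `|X x| <= M.

Lemma bounded_mfun_cst (c : R) : bounded_mfun (fun=> c).
Proof. by split => //; exists `|c|. Qed.

Lemma bounded_mfunD X Y : bounded_mfun X -> bounded_mfun Y ->
  bounded_mfun (fun x => X x + Y x).
Proof.
move=> [mX [M hM]] [mY [L hL]]; split; first exact: measurable_funD.
by exists (M + L) => x; rewrite (le_trans (ler_normD _ _))// lerD.
Qed.

Lemma bounded_mfunM X Y : bounded_mfun X -> bounded_mfun Y ->
  bounded_mfun (fun x => X x * Y x).
Proof.
move=> [mX [M hM]] [mY [L hL]]; split; first exact: measurable_funM.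
by exists (M * L) => x; rewrite normrM ler_pM.
Qed.

Lemma bounded_mfunZ (c : R) X : bounded_mfun X -> bounded_mfun (fun x => c * X x).
Proof. by move=> bX; apply: bounded_mfunM => //; exact: bounded_mfun_cst. Qed.

Lemma bounded_mfunB X Y : bounded_mfun X -> bounded_mfun Y ->
  bounded_mfun (fun x => X x - Y x).
Proof.
move=> bX bY.
have -> : (fun x => X x - Y x) = (fun x => X x + -1 * Y x).
  by apply/funext => x; rewrite mulN1r.
by apply: bounded_mfunD => //; exact: bounded_mfunZ.
Qed.

Lemma bounded_mfunX X n : bounded_mfun X -> bounded_mfun (fun x => X x ^+ n).
Proof.
move=> bX; elim: n => [|n IH].
  by under eq_fun do rewrite expr0; exact: bounded_mfun_cst.
by under eq_fun do rewrite exprS; exact: bounded_mfunM.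
Qed.

Lemma bounded_mfun_sum (I : Type) (r : seq I) (p : pred I) (F : I -> T -> R) :
  (forall i, bounded_mfun (F i)) ->
  bounded_mfun (fun x => \sum_(i <- r | p i) F i x).
Proof.
move=> bF; elim: r => [|i r IH].
  by under eq_fun do rewrite big_nil; exact: bounded_mfun_cst.
under eq_fun do rewrite big_cons; case: (p i) => //; exact: bounded_mfunD.
Qed.

Lemma bounded_mfun_prod (I : Type) (r : seq I) (p : pred I) (F : I -> T -> R) :
  (forall i, bounded_mfun (F i)) ->
  bounded_mfun (fun x => \prod_(i <- r | p i) F i x).
Proof.
move=> bF; elim: r => [|i r IH].
  by under eq_fun do rewrite big_nil; exact: bounded_mfun_cst.
under eq_fun do rewrite big_cons; case: (p i) => //; exact: bounded_mfunM.
Qed.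

Lemma bounded_mfun_indic (A : set T) : measurable A -> bounded_mfun (\1_A : T -> R).
Proof.
move=> mA; split; first exact: measurable_indic.
by exists 1 => x; rewrite indicE; case: (_ \in _); rewrite /= ?normr1 ?normr0 ?ler01.
Qed.

Variable P : probability T R.

Lemma mean_indic (A : set T) : measurable A -> \int[P]_w \1_A w = fine (P A).
Proof. by move=> mA; rewrite /Rintegral integral_indic//= setIT. Qed.

Lemma bounded_mfun_integrable X : bounded_mfun X -> P.-integrable setT (EFin \o X).
Proof.
move=> [mX [M hM]]; apply: measurable_bounded_integrable => //.
  by rewrite (le_lt_trans (probability_le1 _ _))// ltry.
by exists M; split; [exact: num_real | move=> y My x _; exact: le_trans (ltW My)].
Qed.

Lemma bounded_mfun_integralE X : bounded_mfun X ->
  (\int[P]_w (X w)%:E)%E = (\int[P]_w X w)%:E.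
Proof.
move=> bX; rewrite /Rintegral fineK//.
by apply: integrable_fin_num => //; exact: bounded_mfun_integrable.
Qed.

Lemma mean_cst (c : R) : \int[P]_w c = c.
Proof. 
rewrite Rintegral_cst// -[RHS]mulr1 -[in RHS]/(fine 1%:E).
by congr (_ * fine _); exact: probability_setT.
 Qed.

Lemma meanD X Y : bounded_mfun X -> bounded_mfun Y ->
  \int[P]_w (X w + Y w) = \int[P]_w X w + \int[P]_w Y w.
Proof. by move=> bX bY; rewrite RintegralD//; exact: bounded_mfun_integrable. Qed.

Lemma meanB X Y : bounded_mfun X -> bounded_mfun Y ->
  \int[P]_w (X w - Y w) = \int[P]_w X w - \int[P]_w Y w.
Proof. by move=> bX bY; rewrite RintegralB//; exact: bounded_mfun_integrable. Qed.

Lemma meanZ (c : R) X : bounded_mfun X ->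
  \int[P]_w (c * X w) = c * \int[P]_w X w.
Proof. by move=> bX; rewrite RintegralZl//; exact: bounded_mfun_integrable. Qed.

Lemma mean_le X Y : bounded_mfun X -> bounded_mfun Y ->
  (forall w, X w <= Y w) -> \int[P]_w X w <= \int[P]_w Y w.
Proof. by move=> bX bY XY; apply: le_Rintegral => //; exact: bounded_mfun_integrable. Qed.

Lemma mean_norm_le X (M : R) : bounded_mfun X -> (forall w, `|X w| <= M) ->
  `|\int[P]_w X w| <= M.
Proof.
move=> bX hM; rewrite ler_norml -{1}(mean_cst (- M)) -{2}(mean_cst M).
by apply/andP; split; apply: mean_le => //; try exact: bounded_mfun_cst;
  move=> w; have := hM w; rewrite ler_norml => /andP[].
Qed.

Lemma mean_sum (I : Type) (r : seq I) (p : pred I) (F : I -> T -> R) :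
  (forall i, bounded_mfun (F i)) ->
  \int[P]_w (\sum_(i <- r | p i) F i w) = \sum_(i <- r | p i) \int[P]_w F i w.
Proof.
move=> bF; elim: r => [|i r IH].
  by under eq_Rintegral do rewrite big_nil; rewrite mean_cst big_nil.
rewrite big_cons -IH; under eq_Rintegral do rewrite big_cons.
by case: (p i) => //; rewrite meanD//; exact: bounded_mfun_sum.
Qed.

End bounded_measurable.

(** * Truncation to a compact interval *)

Section clamp.
Context (R : realType).

(** Composition with this map makes any continuous function bounded without changing its integral
    against a measure supported in [[- K, K]]. *)
Definition clamp (K x : R) : R := Num.max (- K) (Num.min K x).

Lemma clamp_bound (K x : R) : 0 <= K -> `|clamp K x| <= K.
Proof.
move=> K0; rewrite ler_norml /clamp le_max lexx /= ge_max ge_min lexx /=.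
by rewrite andbT; lra.
Qed.

Lemma clamp_id (K x : R) : `|x| <= K -> clamp K x = x.
Proof.
rewrite ler_norml => /andP[h1 h2]; rewrite /clamp.
by rewrite (min_idPr h2) (max_idPr h1).
Qed.

Lemma clamp_continuous (K : R) : continuous (clamp K).
Proof.
move=> x; apply: (@continuous_max R R (fun=> - K) (fun x => Num.min K x)).
  exact: cst_continuous.
apply: (@continuous_min R R (fun=> K) id); first exact: cst_continuous.
exact: cvg_id.
Qed.

Lemma bounded_mfun_continuous (f : R -> R) : continuous f ->
  (exists M, forall x, `|f x| <= M) -> bounded_mfun f.
Proof. by move=> cf bf; split => //; exact: continuous_measurable_fun. Qed.

Lemma bounded_on_segment (f : R -> R) (K : R) : continuous f ->
  exists2 M : R, 0 < M & forall x, `|x| <= K -> `|f x| <= M.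
Proof.
move=> cf; have : compact (f @` `[- K, K]).
  by apply: continuous_compact; [exact: continuous_subspaceT | exact: segment_compact].
move=> /compact_bounded[M [_ hM]]; exists (`|M| + 1) => [|x xK].
  by rewrite ltr_wpDl.
apply: (hM (`|M| + 1)); first by rewrite (le_lt_trans (ler_norm _))// ltrDl.
by exists x => //=; rewrite in_itv /= -ler_norml.
Qed.

Lemma clamp_comp_continuous (f : R -> R) (K : R) : continuous f ->
  continuous (fun x => f (clamp K x)).
Proof. by move=> cf x; apply: continuous_comp; [exact: clamp_continuous | exact: cf]. Qed.

Lemma clamp_comp_bounded (f : R -> R) (K : R) : 0 <= K -> continuous f ->
  exists M, forall x, `|f (clamp K x)| <= M.
Proof.
move=> K0 cf; have [M _ hM] := bounded_on_segment K cf.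
by exists M => x; apply: hM; exact: clamp_bound.
Qed.

Lemma bounded_mfun_clamp (f : R -> R) (K : R) : 0 <= K -> continuous f ->
  bounded_mfun (fun x => f (clamp K x)).
Proof.
move=> K0 cf; apply: bounded_mfun_continuous; first exact: clamp_comp_continuous.
exact: clamp_comp_bounded.
Qed.

Lemma bounded_mfun_clampX (K : R) n : 0 <= K -> bounded_mfun (fun x => clamp K x ^+ n).
Proof. by move=> K0; apply: bounded_mfunX; apply: (@bounded_mfun_clamp id) => // x; exact: cvg_id. Qed.

Definition supported_in (mu : probability R R) (K : R) := mu (~` `[- K, K]) = 0%E.

Lemma supported_in_ae (mu : probability R R) (K : R) : supported_in mu K ->
  {ae mu, forall x, `|x| <= K}.
Proof.
move=> smu; exists (~` `[- K, K]); split => //; first exact: measurableC.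
by move=> x nx xin; apply: nx; move: xin => /=; rewrite in_itv /= ler_norml.
Qed.

Lemma supported_integralE (mu : probability R R) (K : R) (f : R -> R) :
  0 <= K -> supported_in mu K -> continuous f ->
  (\int[mu]_x (f x)%:E)%E = (\int[mu]_x f (clamp K x))%:E.
Proof.
move=> K0 smu cf; rewrite -bounded_mfun_integralE; last exact: bounded_mfun_clamp.
apply: ae_eq_integral => //.
- by apply/measurable_EFinP; exact: continuous_measurable_fun.
- by apply/measurable_EFinP; apply: continuous_measurable_fun; exact: clamp_comp_continuous.
- by apply: filterS (supported_in_ae smu) => x xK _; rewrite clamp_id.
Qed.

Lemma compact_support (mu : probability R R) (K : R) :
  supported_in mu K -> compactly_supported mu.
Proof. by exists (`[- K, K]%classic) => //; exact: segment_compact. Qed.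

End clamp.

(** * Weierstrass approximation *)

Lemma uniform_continuity_segment (R : realType) (f : R -> R) (a c : R) :
  continuous f -> forall e : R, 0 < e -> exists2 d : R, 0 < d &
    forall x y, a <= x <= c -> `|x - y| < d -> `|f x - f y| <= e.
Proof.
move=> cf e e0.
(* Compactness in near-covering form: it suffices to find, around each point, a property that holds
   jointly for nearby points and for all small [d > 0]. *)
have /compact_near_coveringP := @segment_compact R a c.
move=> /(_ R (0^'+) (fun d x => forall y, `|x - y| < d -> `|f x - f y| <= e)).
move=> H.
have {H} : \forall d \near 0^'+, `[a, c] `<=`
    (fun x => forall y, `|x - y| < d -> `|f x - f y| <= e).
  apply: H => x _.
  have e2 : 0 < e / 2 by rewrite divr_gt0.
  have /cvgrPdist_le /(_ _ e2) /nbhs_ballP [r /= r0 hr] := cf x.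
  have r2 : 0 < r / 2 by rewrite divr_gt0.
  (* One half of the radius is spent on moving from [x] to [x'], the other on moving from [x'] to
     [y]. *)
  exists (ball x (r / 2), [set d | 0 < d < r / 2]).
    split; first exact: nbhsx_ballx.
    near=> d => /=; apply/andP; split; near: d.
      exact: nbhs_right_gt.
    exact: nbhs_right_lt.
  move=> [x' d] /= [bx' /andP[d0 dr]] y x'y.
  have h1 : `|f x - f x'| <= e / 2.
    apply: hr; apply: lt_trans bx' _; lra.
  have h2 : `|f x - f y| <= e / 2.
    apply: hr; rewrite /ball /=.
    have -> : x - y = (x - x') + (x' - y) by ring.
    apply: le_lt_trans (ler_normD _ _) _.
    by move: bx' x'y; rewrite /ball /=; lra.
  have -> : f x' - f y = (f x - f y) - (f x - f x') by ring.
  apply: le_trans (ler_normB _ _) _; lra.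
move=> H; have [d [d0 h]] := filter_ex (filterI (nbhs_right_gt 0) H).
by exists d => // x y xac xy; apply: h => //=; rewrite in_itv.
Unshelve. all: by end_near. Qed.

(** [bernstein n g = \sum_k g k 'C(n, k) 'X^k (1 - 'X)^(n - k)]. *)
Fixpoint bernstein (R : realType) (n : nat) (g : nat -> R) : {poly R} :=
  if n is m.+1 then
    'X * bernstein m (fun k => g k.+1) + (1 - 'X) * bernstein m g
  else (g 0%N)%:P.

Lemma bernsteinS (R : realType) n (g : nat -> R) x :
  (bernstein n.+1 g).[x] = x * (bernstein n (fun k => g k.+1)).[x]
    + (1 - x) * (bernstein n g).[x].
Proof. by rewrite /= !hornerE. Qed.

Lemma bernstein_le (R : realType) n (g h : nat -> R) (x : R) : 0 <= x <= 1 ->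
  (forall k, (k <= n)%N -> g k <= h k) ->
  (bernstein n g).[x] <= (bernstein n h).[x].
Proof.
move=> /andP[x0 x1]; elim: n g h => [|n IH] g h gh; first by rewrite /= !hornerC gh.
rewrite !bernsteinS; apply: lerD; apply: ler_wpM2l; rewrite ?subr_ge0//.
  by apply: IH => k kn; exact: gh.
by apply: IH => k kn; apply: gh; exact: leqW.
Qed.

Lemma bernstein_linear (R : realType) n (u v : R) (g h : nat -> R) (x : R) :
  (bernstein n (fun k => u * g k + v * h k)).[x] =
  u * (bernstein n g).[x] + v * (bernstein n h).[x].
Proof.
elim: n g h => [|n IH] g h; first by rewrite /= !hornerC.
by rewrite !bernsteinS !IH; ring.
Qed.

Lemma bernstein_cst (R : realType) n (u x : R) :
  (bernstein n (fun=> u)).[x] = u.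
Proof.
by elim: n => [|n IH]; [rewrite /= hornerC | rewrite bernsteinS IH; ring].
Qed.

(** For [x] in [0, 1] this is the mean of (S - a)^2 with S binomial of parameters n and x: variance
    plus squared bias. The induction conditions on one trial, a success replacing [a] by [a - 1]. *)
Lemma bernstein_sqr (R : realType) n (a x : R) :
  (bernstein n (fun k => (k%:R - a) ^+ 2)).[x] =
  n%:R * (x * (1 - x)) + (n%:R * x - a) ^+ 2.
Proof.
elim: n a => [|n IH] a; first by rewrite /= hornerC; ring.
rewrite bernsteinS IH.
have -> : (fun k : nat => (k.+1%:R - a) ^+ 2) =
          (fun k : nat => (k%:R - (a - 1)) ^+ 2).
  by apply/funext => k; rewrite -natr1; congr (_ ^+ 2); ring.
by rewrite IH -natr1; ring.
Qed.

Lemma weierstrass01 (R : realType) (f : R -> R) : continuous f ->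
  forall e : R, 0 < e -> exists p : {poly R},
    forall x : R, 0 <= x <= 1 -> `|f x - p.[x]| <= e.
Proof.
move=> cf e e0.
have e2 : 0 < e / 2 by rewrite divr_gt0.
have [d d0 hd] := @uniform_continuity_segment R f 0 1 cf _ e2.
have [M M0 hM'] := bounded_on_segment 1 cf.
have hM (x : R) : 0 <= x <= 1 -> `|f x| <= M.
  by move=> x01; apply: hM'; rewrite ler_norml; lra.
(* Chebyshev constant: if |x - k/n| >= d, then 2M <= 2M |x - k/n|^2 / d^2 = (C / n^2) (k - n
   x)^2. *)
pose C := 2 * M / d ^+ 2.
have C0 : 0 < C by rewrite /C divr_gt0 ?exprn_gt0// mulr_gt0.
have [n n0 hn] : exists2 n : nat, (0 < n)%N & C / n%:R <= e / 2.
  exists (Num.truncn (C / (e / 2))).+1 => //.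
  rewrite ler_pdivrMr ?ltr0n// mulrC -ler_pdivrMr//.
  by apply/ltW/truncnS_gt; rewrite divr_ge0// ltW.
have n0' : 0 < n%:R :> R by rewrite ltr0n.
exists (bernstein n (fun k => f (k%:R / n%:R))) => x x01.
have key k : (k <= n)%N ->
    `|f x - f (k%:R / n%:R)| <= e / 2 + C / n%:R ^+ 2 * (k%:R - n%:R * x) ^+ 2.
  move=> kn.
  have k01 : 0 <= (k%:R / n%:R : R) <= 1.
    by rewrite divr_ge0//= ler_pdivrMr// mul1r ler_nat.
  have q0 : 0 <= C / n%:R ^+ 2 * (k%:R - n%:R * x) ^+ 2.
    by rewrite mulr_ge0 ?sqr_ge0// divr_ge0 ?sqr_ge0// ltW.
  have [lt|ge] := ltP (`|x - k%:R / n%:R|) d.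
    by apply: le_trans (hd _ _ x01 lt) _; rewrite lerDl.
  apply: le_trans (ler_normB _ _) _.
  apply: (@le_trans _ _ (2 * M)).
    by have := hM _ x01; have := hM _ k01; lra.
  have -> : C / n%:R ^+ 2 * (k%:R - n%:R * x) ^+ 2 =
            2 * M * (`|x - k%:R / n%:R| ^+ 2 / d ^+ 2).
    rewrite real_normK ?num_real// /C; field.
    by rewrite !gt_eqF.
  apply: ler_wpDl; first exact: ltW.
  rewrite ler_pMr ?mulr_gt0// ler_pdivlMr ?exprn_gt0// mul1r.
  by rewrite ler_pXn2r// nnegrE ltW.
(* The binomial variance n x (1 - x) is at most n, which leaves C / n. *)
have fin : C / n%:R ^+ 2 * (n%:R * (x * (1 - x)) + (n%:R * x - n%:R * x) ^+ 2)
    <= e / 2.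
  apply: le_trans hn; rewrite subrr expr0n addr0.
  have -> : C / n%:R ^+ 2 * (n%:R * (x * (1 - x))) = C / n%:R * (x * (1 - x)).
    by field; rewrite gt_eqF.
  by rewrite ler_piMr ?divr_ge0 1?ltW//; case/andP: x01 => *; nra.
have le1 : (bernstein n (fun k => 1 * f (k%:R / n%:R) + -1 * f x)).[x] <= e.
  apply: le_trans (_ : (bernstein n (fun k => 1 * (e / 2) +
      C / n%:R ^+ 2 * (k%:R - n%:R * x) ^+ 2)).[x] <= _).
    apply: bernstein_le => // k kn; rewrite mul1r mulN1r mul1r.
    by apply: le_trans (key k kn); rewrite distrC ler_norm.
  by rewrite (bernstein_linear _ _ _ (fun=> e / 2)) bernstein_cst bernstein_sqr; lra.
have le2 : (bernstein n (fun k => 1 * f x + -1 * f (k%:R / n%:R))).[x] <= e.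
  apply: le_trans (_ : (bernstein n (fun k => 1 * (e / 2) +
      C / n%:R ^+ 2 * (k%:R - n%:R * x) ^+ 2)).[x] <= _).
    apply: bernstein_le => // k kn; rewrite mul1r mulN1r mul1r.
    by apply: le_trans (key k kn); rewrite ler_norm.
  by rewrite (bernstein_linear _ _ _ (fun=> e / 2)) bernstein_cst bernstein_sqr; lra.
move: le1 le2.
rewrite (bernstein_linear _ _ _ _ (fun=> f x)) (bernstein_linear _ _ _ (fun=> f x)).
by rewrite bernstein_cst ler_norml; lra.
Qed.

Lemma weierstrass (R : realType) (f : R -> R) (K : R) : continuous f -> 0 < K ->
  forall e : R, 0 < e -> exists p : {poly R},
    forall x, `|x| <= K -> `|f x - p.[x]| <= e.
Proof.
move=> cf K0 e e0.
have [|p hp] := @weierstrass01 R (fun t => f (2 * K * t - K)) _ e e0.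
  move=> t; apply: continuous_comp; last exact: cf.
  apply: continuousB; last exact: cst_continuous.
  by apply: continuousM; [exact: cst_continuous | exact: cvg_id].
exists (p \Po ((2 * K)^-1 *: 'X + 2^-1%:P)) => x xK.
rewrite horner_comp !hornerE.
have := hp ((2 * K)^-1 * x + 2^-1).
have -> : 2 * K * ((2 * K)^-1 * x + 2^-1) - K = x by field; rewrite gt_eqF.
apply; move: xK; rewrite ler_norml => /andP[x1 x2].
have -> : (2 * K)^-1 * x + 2^-1 = (x + K) / (2 * K) by field; rewrite gt_eqF.
rewrite divr_ge0 ?ler_pdivrMr//; nra.
Qed.

(** * Positive functionals on continuous functions *)

Section cdf_existence.
Context (R : realType) (f : cumulativeBounded (0 : R) (1 : R)).

Let idTR : measurableTypeR R -> R := idfun.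

#[local] HB.instance Definition _ :=
  @isMeasurableFun.Build _ _ _ _ idTR (@measurable_id _ _ setT).

(** The Lebesgue-Stieltjes measure lives on [measurableTypeR R]; its image by the identity is a
    probability on [R] itself. *)
Lemma probability_of_cumulative :
  exists mu : probability R R, forall r, mu `]-oo, r]%classic = (f r)%:E.
Proof.
exists (distribution (lebesgue_stieltjes_measure f) idTR) => r.
exact: cdf_lebesgue_stieltjes_id.
Qed.

End cdf_existence.

Lemma cont_cst (R : realType) (c : R) : continuous (fun _ : R => c).
Proof. by move=> x; exact: cst_continuous. Qed.

Section cdf_right.
Context (R : realType) (m : probability R R).

Let idR : R -> R := idfun.

#[local] HB.instance Definition _ :=
  @isMeasurableFun.Build _ _ _ _ idR (@measurable_id _ _ setT).

Lemma cdf_cvg_right (r : R) :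
  m `]-oo, x]%classic @[x --> r^'+] --> m `]-oo, r]%classic.
Proof. exact: (@cdf_right_continuous _ _ _ m idR r). Qed.

End cdf_right.

Section ramp.
Context (R : realType).
Implicit Types a c t : R.

(** For [a < c], a continuous substitute for the indicator of []-oo, a]]: 1 up to [a], 0 from [c]
    on, affine in between. *)
Definition ramp a c t : R := clamp 1 (Num.max 0 ((c - t) / (c - a))).

Lemma ramp_continuous a c : continuous (ramp a c).
Proof.
move=> t; apply: (@continuous_comp _ _ _ (fun t => Num.max 0 ((c - t) / (c - a)))).
  apply: (@continuous_max R R (fun=> 0)); first exact: cst_continuous.
  apply: continuousM; last exact: cst_continuous.
  by apply: continuousB; [exact: cst_continuous | exact: cvg_id].
exact: clamp_continuous.
Qed.

Lemma ramp_ge0 a c t : 0 <= ramp a c t.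
Proof.
have h : 0 <= Num.max 0 ((c - t) / (c - a)) by rewrite le_max lexx.
by rewrite /ramp /clamp le_max le_min h ler01 orbT.
Qed.

Lemma ramp_le1 a c t : ramp a c t <= 1.
Proof. by have := clamp_bound (Num.max 0 ((c - t) / (c - a))) ler01; rewrite ler_norml => /andP[]. Qed.

Lemma ramp_left a c t : a < c -> t <= a -> ramp a c t = 1.
Proof.
move=> ac ta; apply/le_anti; rewrite ramp_le1 /= /ramp /clamp le_max le_min lexx /=.
rewrite le_max ler_pdivlMr ?subr_gt0// mul1r lerD2l lerN2 ta.
by rewrite !orbT.
Qed.

Lemma ramp_right a c t : a < c -> c <= t -> ramp a c t = 0.
Proof.
move=> ac ct; rewrite /ramp (max_idPl _); last first.
  by rewrite ler_pdivrMr ?subr_gt0// mul0r subr_le0.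
by rewrite clamp_id // normr0.
Qed.

Lemma ramp_le a c a' c' t : a < c -> a' < c' -> c <= a' -> ramp a c t <= ramp a' c' t.
Proof.
move=> ac ac' ca; have [ta|ta] := leP t a'; first by rewrite (ramp_left ac' ta) ramp_le1.
by rewrite ramp_right ?ramp_ge0// (le_trans ca)// ltW.
Qed.

Lemma ramp_bounded_mfun a c : bounded_mfun (ramp a c).
Proof.
apply: bounded_mfun_continuous; first exact: ramp_continuous.
by exists 1 => x; rewrite ger0_norm ?ramp_ge0 ?ramp_le1.
Qed.

End ramp.

(** * Riesz representation on a segment *)

Section riesz.
Context (R : realType) (K : R) (Lam : (R -> R) -> R).
Hypothesis K0 : 0 < K.
Hypothesis LamD : forall f g (u v : R), continuous f -> continuous g ->
  Lam (fun x => u * f x + v * g x) = u * Lam f + v * Lam g.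
Hypothesis Lam_le : forall f g, continuous f -> continuous g ->
  (forall x, `|x| <= K -> f x <= g x) -> Lam f <= Lam g.
Hypothesis Lam1 : Lam (fun=> 1) = 1.

Let Lam_cst (u : R) : Lam (fun=> u) = u.
Proof.
have c1 := @cont_cst R 1.
have := LamD u 0 c1 c1; rewrite Lam1 mul0r mulr1 addr0 => {2}<-; congr Lam.
Qed.

Let G a c := Lam (ramp a c).
Let S (x : R) := [set G p.1 p.2 | p in [set p : R * R | x < p.1 < p.2]].
(** The candidate distribution function. The infimum runs over ramps that start to fall strictly to
    the right of [x]; this strictness is what gives right continuity. *)
Let F (x : R) : R := inf (S x).

Let G_ge0 a c : 0 <= G a c.
Proof.
rewrite -(Lam_cst 0); apply: Lam_le; [exact: cont_cst|exact: ramp_continuous|].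
by move=> x _; exact: ramp_ge0.
Qed.

Let G_le a c a' c' : a < c -> a' < c' -> c <= a' -> G a c <= G a' c'.
Proof.
by move=> *; apply: Lam_le; [exact: ramp_continuous|exact: ramp_continuous|];
  move=> x _; exact: ramp_le.
Qed.

Let G_le1 a c : G a c <= 1.
Proof.
rewrite -(Lam_cst 1); apply: Lam_le; [exact: ramp_continuous|exact: cont_cst|].
by move=> x _; exact: ramp_le1.
Qed.

Let S_lbound x : has_lbound (S x).
Proof. by exists 0 => _ [p _ <-]; exact: G_ge0. Qed.

Let S_inf x : has_inf (S x).
Proof.
split => //; exists (G (x + 1) (x + 2)); exists (x + 1, x + 2) => //=.
by rewrite ltrDl ltr01 /= ltrD2l ltr1n.
Qed.

Let F_le x a c : x < a -> a < c -> F x <= G a c.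
Proof. by move=> xa ac; apply: ge_inf => //; exists (a, c) => //=; rewrite xa. Qed.

Let F_ge x a c : a < c -> c <= x -> G a c <= F x.
Proof.
move=> ac cx; apply: lb_le_inf; first by case: (S_inf x).
by move=> _ [[a' c'] /= /andP[xa ac'] <-]; apply: G_le => //; rewrite (le_trans cx)// ltW.
Qed.

Let F_nd : nondecreasing F.
Proof.
move=> x y xy; apply: lb_le_inf; first by case: (S_inf y).
by move=> _ [[a' c'] /= /andP[xa ac'] <-]; apply: F_le => //; exact: le_lt_trans xa.
Qed.

Let F_rc : right_continuous F.
Proof.
move=> x; apply/cvgrPdist_le => e e0.
have [_ [[a c] /= /andP[xa ac] <-] hG] := inf_adherent e0 (S_inf x).
near=> y.
have xy : x < y by near: y; exact: nbhs_right_gt.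
have ya : y < a by near: y; exact: nbhs_right_lt.
rewrite distrC ger0_norm ?subr_ge0; last exact/F_nd/ltW.
by rewrite lerBlDl; apply: (le_trans (F_le ya ac)); exact: ltW.
Unshelve. all: by end_near. Qed.

Let F_left x : x < - K -> F x = 0.
Proof.
move=> xK; apply/le_anti/andP; split; last first.
  by apply: (le_trans _ (@F_ge x (x - 1) x _ _)) => //; rewrite ?G_ge0// ltrBlDl ltrDr.
apply: (@le_trans _ _ (G ((x - K) / 2) (- K))).
  by apply: F_le; lra.
rewrite /G -(Lam_cst 0); apply: Lam_le.
- exact: ramp_continuous.
- exact: cont_cst.
- by move=> t /ler_normlP[h1 h2]; rewrite ramp_right //; lra.
Qed.

(** The ramp from [K] to [K + 1] is 1 wherever [Lam] looks and has finished falling at [x]; hence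
    the unit of slack in the support. *)
Let F_right x : K + 1 <= x -> F x = 1.
Proof.
move=> xK; apply/le_anti/andP; split.
  by apply: (le_trans (@F_le x (x + 1) (x + 2) _ _)) => //; lra.
apply: (le_trans _ (@F_ge x K (K + 1) _ _)) => //; last by lra.
rewrite /G -{1}(Lam_cst 1); apply: Lam_le.
- exact: cont_cst.
- exact: ramp_continuous.
- by move=> t /ler_normlP[h1 h2]; rewrite ramp_left //; lra.
Qed.

Let F_ge0 x : 0 <= F x.
Proof. by apply: (le_trans _ (@F_ge x (x - 1) x _ _)) => //; lra. Qed.

Let F_le1 x : F x <= 1.
Proof. by apply: (le_trans (@F_le x (x + 1) (x + 2) _ _)) => //; lra. Qed.

Let F_Ny : F @ -oo --> (0 : R).
Proof.
apply: cvg_near_cst; near=> x; apply: F_left; near: x.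
by apply: nbhs_ninfty_lt; exact: num_real.
Unshelve. all: by end_near. Qed.

Let F_y : F @ +oo --> (1 : R).
Proof.
apply: cvg_near_cst; near=> x; apply: F_right; near: x.
by apply: nbhs_pinfty_ge; exact: num_real.
Unshelve. all: by end_near. Qed.

#[local] HB.instance Definition _ := isCumulative.Build R _ R F F_nd F_rc.
#[local] HB.instance Definition _ := isCumulativeBounded.Build R 0 1 F F_Ny F_y.

(** [interp n] is the piecewise linear interpolation of [f] at [x 0, ..., x n]. *)
Let interp (f : R -> R) (x : nat -> R) := fix interp n (t : R) : R :=
  if n is m.+1 then
    interp m t + (f (x m.+1) - f (x m)) * (1 - ramp (x m) (x m.+1) t)
  else f (x 0%N).

Let interp_continuous f x n : continuous (interp f x n).
Proof.
elim: n => [|n IH] t /=; first exact: cst_continuous.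
apply: continuousD; first exact: IH.
apply: continuousM; first exact: cst_continuous.
by apply: continuousB; [exact: cst_continuous | exact: ramp_continuous].
Qed.

Let interp_bounded_mfun f x n : bounded_mfun (interp f x n).
Proof.
elim: n => [|n IH] /=; first exact: bounded_mfun_cst.
apply: bounded_mfunD => //; apply: bounded_mfunZ.
by apply: bounded_mfunB; [exact: bounded_mfun_cst|exact: ramp_bounded_mfun].
Qed.

(** Each stage changes the function only to the right of the last node, where the previous stage is
    constant. Inside a cell the error is thus the oscillation of [f] from the left node, plus at
    most one increment between nodes: [2 * e]. *)
Let interp_approx f (e h : R) (n : nat) : 0 < h -> h *+ n = 2 * (K + 1) ->
  (forall x y, - (K + 1) <= x <= K + 1 -> `|x - y| <= h -> `|f x - f y| <= e) ->
  forall t, `|f (clamp (K + 1) t) - interp f (fun i => - (K + 1) + h *+ i) n t| <= 2 * e.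
Proof.
set L := K + 1; set x := fun i => - L + h *+ i => h0 hn hf.
have e0 : 0 <= e.
  have LL : - L <= L <= L by rewrite lexx andbT /L; move: K0; lra.
  by apply: le_trans (normr_ge0 _) (hf L L LL _); rewrite subrr normr0 ltW.
have xS m : x m.+1 = x m + h by rewrite /x mulrSr addrA.
have xlt m : x m < x m.+1 by rewrite xS ltrDl.
have x_mono m m' : (m <= m')%N -> x m <= x m'.
  by move=> mm; rewrite /x lerD2l; rewrite -subr_ge0 -mulrnBr// mulrn_wge0// ltW.
have xn : x n = L by rewrite /x hn /L; ring.
have x0 : x 0%N = - L by rewrite /x mulr0n addr0.
have xL m : (m <= n)%N -> - L <= x m <= L.
  by move=> mn; rewrite -x0 -xn !x_mono.
have tail m t : x m <= t -> interp f x m t = f (x m).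
  elim: m => [|m IH]//= xt; rewrite IH; last exact: le_trans (ltW (xlt m)) xt.
  by rewrite ramp_right//; ring.
have main m t : (m <= n)%N -> t <= x m -> `|f (clamp L t) - interp f x m t| <= 2 * e.
  elim: m => [|m IH] mn /=.
    rewrite x0 => tL; rewrite (_ : clamp L t = - L) ?subrr ?normr0 ?mulr_ge0//.
    rewrite /clamp (min_idPr _) ?(max_idPl _)//.
    by apply: le_trans tL _; rewrite /L; move: K0; lra.
  have [txm|xmt] := leP t (x m).
    by move=> _; rewrite ramp_left// subrr mulr0 addr0; apply: IH => //; exact: ltnW.
  move=> txm; rewrite tail; last exact: ltW.
  have /andP[xm1 xm2] := xL m (ltnW mn); have /andP[xs1 xs2] := xL m.+1 mn.
  rewrite clamp_id; last by rewrite ler_norml; lra.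
  have -> : f t - (f (x m) + (f (x m.+1) - f (x m)) * (1 - ramp (x m) (x m.+1) t)) =
    (f t - f (x m)) + (f (x m) - f (x m.+1)) * (1 - ramp (x m) (x m.+1) t) by ring.
  have r0 := ramp_ge0 (x m) (x m.+1) t; have r1 := ramp_le1 (x m) (x m.+1) t.
  apply: le_trans (ler_normD _ _) _; rewrite normrM (_ : 2 * e = e + e * 1); last by ring.
  apply: lerD.
    by apply: hf; [lra | rewrite ler_norml; move: txm; rewrite xS; lra].
  apply: ler_pM => //; last by rewrite ler_norml; lra.
  by apply: hf; [exact/xL/ltnW | rewrite xS opprD addNKr normrN gtr0_norm].
move=> t; have [tL|Lt] := leP t L; first by apply: main => //; rewrite xn.
have -> : interp f x n t = f L by rewrite tail xn// ltW.
rewrite (_ : clamp L t = L) ?subrr ?normr0 ?mulr_ge0//.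
by rewrite /clamp (min_idPl (ltW Lt)) (max_idPr _)//; rewrite /L; move: K0; lra.
Qed.

(** The integral and [Lam] are compared on a piecewise linear interpolant, a combination of ramps.
    On the ramp of one cell both values lie between two nearby values of [F], so the total
    discrepancy telescopes and is controlled by the increments of [f] alone. *)
Lemma riesz_probability : exists mu : probability R R,
  supported_in mu (K + 1) /\
  forall f, continuous f -> \int[mu]_x f (clamp (K + 1) x) = Lam f.
Proof.
have [mu muF0] := probability_of_cumulative F.
have muF r : mu `]-oo, r]%classic = (F r)%:E by exact: muF0.
have mu_ind r : \int[mu]_x \1_(`]-oo, r]%classic) x = F r by rewrite mean_indic// muF.
have smu : supported_in mu (K + 1).
  apply/eqP; rewrite -measure_le0.
  apply: (@le_trans _ _ (mu (`]-oo, (- (K + 1))]%classic `|` ~` `]-oo, (K + 1)]%classic))).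
    apply: le_measure; rewrite ?inE//; first exact: measurableC.
      by apply: measurableU => //; exact: measurableC.
    move=> x /=; rewrite !in_itv /= => /negP; rewrite negb_and -!ltNge => /orP[h|h].
      by left; exact: ltW.
    by right; apply/negP; rewrite -ltNge.
  apply: le_trans (measureU2 _ _ _) _ => //; first exact: measurableC.
  have m1 : mu `]-oo, (- (K + 1))]%classic = 0%E by rewrite muF F_left//; lra.
  have m2 : mu (~` `]-oo, (K + 1)]%classic) = 0%E.
    by rewrite probability_setC// muF F_right// subee.
  rewrite (_ : (_ + _)%E = 0%E)// -[RHS](adde0 0%E).
  by congr (_ + _)%E; [exact: m1 | exact: m2].
exists mu; split => // f cf.
apply/eqP; rewrite -subr_eq0 -normr_le0; apply/ler_addgt0Pr => e6 e60; rewrite add0r.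
(* Three errors of [2 * e]: [f] against its interpolant under [mu], the same under [Lam], and [mu]
   against [Lam] on the interpolant. *)
pose e := e6 / 6; have e0 : 0 < e by rewrite divr_gt0.
set L := K + 1; have L0 : 0 < L by rewrite /L addr_gt0.
have [d d0 hd] := @uniform_continuity_segment R f (- L) L cf _ e0.
have [n hn] : exists n : nat, (2 * L) / n.+1%:R < d.
  exists (Num.truncn (2 * L / d)); rewrite ltr_pdivrMr// [d * _]mulrC -ltr_pdivrMr//.
  by apply: truncnS_gt; rewrite divr_ge0 1?ltW// mulr_gt0.
set h := 2 * L / n.+1%:R in hn; have h0 : 0 < h by rewrite divr_gt0// mulr_gt0.
have hf x y : - L <= x <= L -> `|x - y| <= h -> `|f x - f y| <= e.
  by move=> xL xy; apply: hd => //; exact: le_lt_trans hn.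
have hn' : h *+ n.+1 = 2 * L by rewrite -mulr_natr /h mulfVK// pnatr_eq0.
have approx := interp_approx h0 hn' hf.
rewrite -/L in approx.
set x := fun i : nat => - L + h *+ i in approx.
have xS m : x m.+1 = x m + h by rewrite /x mulrSr addrA.
have xL m : (m <= n.+1)%N -> - L <= x m <= L.
  move=> mn; have hm : h *+ m <= 2 * L.
    by rewrite -hn' -subr_ge0 -mulrnBr// mulrn_wge0// ltW.
  have hm0 : 0 <= h *+ m by rewrite mulrn_wge0// ltW.
  by rewrite /x; lra.
have muG m : F (x m) <= \int[mu]_t ramp (x m) (x m.+1) t <= F (x m.+1).
  have xx : x m < x m.+1 by rewrite xS ltrDl.
  rewrite -!mu_ind; apply/andP; split; apply: mean_le => //; 
    try exact: ramp_bounded_mfun; try exact: bounded_mfun_indic.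
    move=> t; rewrite indicE mem_setE in_itv /=; case: (leP t (x m)) => tx; last exact: ramp_ge0.
    by rewrite ramp_left.
  move=> t; rewrite indicE mem_setE in_itv /=; case: (leP t (x m.+1)) => tx; first exact: ramp_le1.
  by rewrite ramp_right// ltW.
(* [F_le] wants a point strictly to the left of the start of the ramp, hence [x m - h]. *)
have LG m : F (x m - h) <= Lam (ramp (x m) (x m.+1)) <= F (x m.+1).
  have xx : x m < x m.+1 by rewrite xS ltrDl.
  by rewrite F_le ?F_ge// ltrBlDr ltrDl.
(* Passing to [m.+1] adds at most e (F(x_(m+1)) - F(x_m - h)), which is exactly the growth of the
   bound since x_(m+1) - h = x_m. *)
have step m : (m <= n.+1)%N ->
  `|\int[mu]_t interp f x m t - Lam (interp f x m)| <= e * (F (x m) + F (x m - h)).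
  elim: m => [|m IH] mn /=.
    by rewrite mean_cst Lam_cst subrr normr0 mulr_ge0 ?addr_ge0// ltW.
  have c1 := @cont_cst R 1.
  have cr : continuous (fun t => 1 - ramp (x m) (x m.+1) t).
    by move=> t; apply: continuousB; [exact: cst_continuous | exact: ramp_continuous].
  have -> : (fun t => interp f x m t + (f (x m.+1) - f (x m)) * (1 - ramp (x m) (x m.+1) t))
    = (fun t => 1 * interp f x m t + (f (x m.+1) - f (x m)) * (1 - ramp (x m) (x m.+1) t)).
    by apply/funext => t; rewrite mul1r.
  rewrite (LamD _ _ (@interp_continuous f x m) cr) mul1r.
  have -> : Lam (fun t => 1 - ramp (x m) (x m.+1) t) = 1 - Lam (ramp (x m) (x m.+1)).
    rewrite (_ : (fun t => _) = (fun t => 1 * 1 + -1 * ramp (x m) (x m.+1) t)).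
      by rewrite (LamD _ _ c1 (@ramp_continuous R _ _)) Lam1; ring.
    by apply/funext => t; ring.
  have br : bounded_mfun (fun t => 1 - ramp (x m) (x m.+1) t).
    by apply: bounded_mfunB; [exact: bounded_mfun_cst|exact: ramp_bounded_mfun].
  under eq_Rintegral do rewrite mul1r.
  rewrite meanD//; last exact: bounded_mfunZ.
  rewrite meanZ// meanB; [|exact: bounded_mfun_cst|exact: ramp_bounded_mfun].
  rewrite mean_cst.
  have {IH} := IH (ltnW mn); have := muG m; have := LG m.
  set I := \int[mu]_t interp f x m t; set Q := \int[mu]_t ramp _ _ t.
  set a := Lam (interp f x m); set b := Lam (ramp _ _) => hLG hmu IH.
  have -> : I + (f (x m.+1) - f (x m)) * (1 - Q) - (a + (f (x m.+1) - f (x m)) * (1 - b))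
     = (I - a) + (f (x m) - f (x m.+1)) * (Q - b) by ring.
  apply: le_trans (ler_normD _ _) _; rewrite normrM.
  have fe : `|f (x m) - f (x m.+1)| <= e.
    by apply: hf; [exact/xL/ltnW | rewrite xS opprD addNKr normrN gtr0_norm].
  have Qb : `|Q - b| <= F (x m.+1) - F (x m - h).
    have := F_nd (_ : x m - h <= x m); rewrite gerBl ltW// => /(_ isT) hF.
    by rewrite ler_norml; lra.
  have -> : x m.+1 - h = x m by rewrite xS addrK.
  apply: le_trans (lerD IH (ler_pM _ _ fe Qb)) _ => //; lra.
have {step} step := step n.+1 (leqnn _).
(* [Lam] is only known to be linear and monotone, so the uniform bound is used by comparing [f] with
   the interpolant shifted by the constants [2 * e] and [- (2 * e)]. *)
have lamle : `|Lam f - Lam (interp f x n.+1)| <= 2 * e.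
  have Lc (u : R) : Lam (fun t => 1 * interp f x n.+1 t + u * 1) = Lam (interp f x n.+1) + u.
    rewrite LamD; first by rewrite Lam1 mul1r mulr1.
      exact: interp_continuous.
    exact: cont_cst.
  have cc (u : R) : continuous (fun t => 1 * interp f x n.+1 t + u * 1).
    move=> t; apply: (@continuousD _ _ _ (fun t => 1 * interp f x n.+1 t) (fun=> u * 1)).
      apply: (@continuousM _ _ (fun=> 1) (interp f x n.+1)); first exact: cst_continuous.
      exact: interp_continuous.
    exact: cst_continuous.
  rewrite ler_distl -!Lc; apply/andP; split; apply: Lam_le => // t tK;
    have := approx t; (rewrite clamp_id; last by rewrite /L; lra);
    rewrite ler_distl; lra.
have bfc : bounded_mfun (fun t => f (clamp L t)) by apply: bounded_mfun_clamp => //; exact: ltW.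
have mule : `|\int[mu]_t f (clamp L t) - \int[mu]_t interp f x n.+1 t| <= 2 * e.
  rewrite -meanB//; apply: mean_norm_le => //.
  exact: bounded_mfunB.
have := F_le1 (x n.+1); have := F_le1 (x n.+1 - h) => h1 h2.
have {}step : `|\int[mu]_t interp f x n.+1 t - Lam (interp f x n.+1)| <= 2 * e.
  apply: le_trans step _; rewrite [2 * e]mulrC; apply: ler_wpM2l; [exact: ltW | lra].
rewrite (_ : e6 = 6 * e); last by rewrite /e; field.
move: step lamle mule; rewrite !ler_distl; lra.
Qed.

End riesz.

(** * The method of moments on a compact interval *)

Lemma cvg_sum_seq (R : realType) (I : Type) (r : seq I) (p : pred I)
    (u : I -> nat -> R) (l : I -> R) :
  (forall i, u i k @[k --> \oo] --> l i) ->
  \sum_(i <- r | p i) u i k @[k --> \oo] --> \sum_(i <- r | p i) l i.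
Proof.
move=> ul; elim: r => [|i r IH].
  by under eq_fun do rewrite big_nil; rewrite big_nil; exact: cvg_cst.
under eq_fun do rewrite big_cons; rewrite big_cons.
by case: (p i) => //; exact: cvgD (ul i) IH.
Qed.

Lemma probability_eq_cdf (R : realType) (mu nu : probability R R) :
  (forall r, mu `]-oo, r]%classic = nu `]-oo, r]%classic) ->
  forall A, measurable A -> mu A = nu A.
Proof.
move=> munu A mA.
apply: (measure_unique (@ocitv R) (fun k => `]- k%:R, k%:R]%classic)) => //.
- exact: ocitvI.
- by move=> k; exact: is_ocitv.
- exact: bigcup_itvT.
- move=> _ [[a c] _ <-] /=.
  have [ac|ca] := leP a c; last first.
    by rewrite set_itv_ge ?measure0// bnd_simp -leNgt ltW.
  have -> : `]a, c]%classic = `]-oo, c] `\` `]-oo, a].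
    by rewrite -[RHS]setCK setCD setCitvl setUC -[LHS]setCK setCitv.
  have sub : `]-oo, a] `<=` `]-oo, c] by apply: subset_itvl; rewrite bnd_simp.
  have fin (m : probability R R) : (m `]-oo, c]%classic < +oo)%E.
    by rewrite (le_lt_trans (probability_le1 _ _))// ltry.
  have dec (m : probability R R) :
    m (`]-oo, c] `\` `]-oo, a]) = (m `]-oo, c]%classic - m `]-oo, a]%classic)%E.
    by rewrite measureD ?setIidr//; exact: fin.
  by rewrite [LHS]dec [RHS]dec !munu.
- by move=> k; rewrite (le_lt_trans (probability_le1 _ _))// ltry.
Qed.

(** A ramp from [r] to [y] lies between the indicators of the half-lines ending at [r] and at [y].
    Letting [y] decrease to [r] compares the distribution functions in one direction; exchanging the
    measures gives the other. *)
Lemma probability_eq_continuous (R : realType) (mu nu : probability R R) :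
  (forall f : R -> R, continuous f -> (exists M, forall x, `|f x| <= M) ->
     \int[mu]_x f x = \int[nu]_x f x) ->
  forall A, measurable A -> mu A = nu A.
Proof.
have main (m1 m2 : probability R R) :
  (forall f : R -> R, continuous f -> (exists M, forall x, `|f x| <= M) ->
     \int[m1]_x f x = \int[m2]_x f x) ->
  forall r, (m1 `]-oo, r]%classic <= m2 `]-oo, r]%classic)%E.
  move=> H r.
  have step y : r < y -> (m1 `]-oo, r]%classic <= m2 `]-oo, y]%classic)%E.
    move=> ry; rewrite -[leLHS]fineK ?fin_num_measure// -[leRHS]fineK ?fin_num_measure//.
    rewrite lee_fin -!mean_indic//.
    apply: (@le_trans _ _ (\int[m1]_x ramp r y x)).
      apply: mean_le; [exact: bounded_mfun_indic|exact: ramp_bounded_mfun|move=> t].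
      rewrite indicE mem_setE in_itv /=; case: (leP t r) => tx; last exact: ramp_ge0.
      by rewrite ramp_left.
    rewrite H; [|exact: ramp_continuous|by have [] := ramp_bounded_mfun r y].
    apply: mean_le; [exact: ramp_bounded_mfun|exact: bounded_mfun_indic|move=> t].
    rewrite indicE mem_setE in_itv /=; case: (leP t y) => tx; first exact: ramp_le1.
    by rewrite ramp_right// ltW.
  apply: (cvge_ge _ (cdf_cvg_right (m := m2) (r := r))).
  near=> y; apply: step; near: y; exact: nbhs_right_gt.
move=> H; apply: probability_eq_cdf => r; apply/le_anti.
by rewrite !main// => f cf bf; rewrite H.
Unshelve. all: by end_near. Qed.

(** * Averages over finite sequences, and their limits *)

Section averages.
Context (R : realType).
Implicit Types (s : seq R) (f g : R -> R).

Definition avg (T : Type) (s : seq T) (f : T -> R) : R :=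
  (size s)%:R^-1 * \sum_(x <- s) f x.

Lemma avgD (T : Type) (s : seq T) (f g : T -> R) (u v : R) :
  avg s (fun x => u * f x + v * g x) = u * avg s f + v * avg s g.
Proof. by rewrite /avg big_split /= -!mulr_sumr; ring. Qed.

Lemma avg_le s f g (K : R) : all (fun x => `|x| <= K) s ->
  (forall x, `|x| <= K -> f x <= g x) -> avg s f <= avg s g.
Proof.
move=> /allP sK fg; rewrite /avg ler_wpM2l ?invr_ge0//.
rewrite big_seq [leRHS]big_seq; apply: ler_sum => x xs.
by apply: fg; exact: sK.
Qed.

(** An inequality, because the average over the empty sequence is 0. *)
Lemma avg_cst_le (T : Type) (s : seq T) (u : R) : 0 <= u -> avg s (fun=> u) <= u.
Proof.
move=> u0; rewrite /avg big_const_seq count_predT iter_addr addr0.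
have [->|s0] := eqVneq (size s) 0%N; first by rewrite mulr0n mulr0.
by rewrite -[u *+ _]mulr_natl mulrA mulVf ?mul1r ?pnatr_eq0.
Qed.

Lemma avg_dist_le s f g (K e : R) : all (fun x => `|x| <= K) s -> 0 <= e ->
  (forall x, `|x| <= K -> `|f x - g x| <= e) -> `|avg s f - avg s g| <= e.
Proof.
move=> sK e0 fg.
have -> : avg s f - avg s g = avg s (fun x => 1 * f x + -1 * g x).
  by rewrite avgD; ring.
apply: le_trans (avg_cst_le s e0).
rewrite ler_norml; apply/andP; split.
  have -> : - avg s (fun=> e) = avg s (fun=> -1 * e + 0 * 0).
    by rewrite (avgD s (fun=> e) (fun=> 0)); ring.
  by apply: (avg_le sK) => x /fg; rewrite ler_norml; lra.
by apply: (avg_le sK) => x /fg; rewrite ler_norml; lra.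
Qed.

Lemma avg_poly s (p : {poly R}) :
  avg s (fun x => p.[x]) = \sum_(i < size p) p`_i * avg s (fun x => x ^+ i).
Proof.
rewrite /avg; under eq_bigr do rewrite horner_coef.
rewrite exchange_big /= mulr_sumr; apply: eq_bigr => i _.
by rewrite -mulr_sumr mulrCA.
Qed.

Lemma empirical_integral (d : measure_display) (T : measurableType d) (s : seq T)
    (f : T -> R) : measurable_fun setT f ->
  (\int[empirical_measure R s]_x (f x)%:E)%E = (avg s f)%:E.
Proof.
move=> mf; have ge0 (g : T -> R) : measurable_fun setT g -> (forall x, 0 <= g x) ->
  (\int[empirical_measure R s]_x (g x)%:E)%E = (avg s g)%:E.
  move=> mg g0; have mg' : measurable_fun setT (EFin \o g) by exact/measurable_EFinP.
  rewrite empirical_measureE ge0_integral_mscale//; last by move=> x _; rewrite lee_fin.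
  rewrite ge0_integral_measure_sum//; last by move=> x _; rewrite lee_fin.
  under eq_bigr => i _ do rewrite integral_dirac// diracT mul1e.
  by rewrite sumEFin /avg EFinM (big_nth point) big_mkord.
rewrite integralE.
have -> : (\int[empirical_measure R s]_x ((fun x => (f x)%:E)^\+ x))%E =
    (avg s (fun x => Num.max (f x) 0))%:E.
  rewrite -ge0; first by apply: eq_integral => x _; rewrite funeposE /= EFin_max.
    exact: measurable_maxr.
  by move=> x; rewrite le_max lexx orbT.
have -> : (\int[empirical_measure R s]_x ((fun x => (f x)%:E)^\- x))%E =
    (avg s (fun x => Num.max (- f x) 0))%:E.
  rewrite -ge0; first by apply: eq_integral => x _; rewrite funenegE /= EFin_max.
    by apply: measurable_maxr => //; exact: measurableT_comp.
  by move=> x; rewrite le_max lexx orbT.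
rewrite -EFinB; congr EFin; rewrite /avg -mulrBr -sumrB; congr (_ * _).
by apply: eq_bigr => x _; case: (leP (f x) 0) => h; case: (leP (- f x) 0); lra.
Qed.

Variables (K : R) (s : nat -> seq R).
Hypothesis K0 : 0 < K.
Hypothesis sK : forall n, all (fun x => `|x| <= K) (s n).

Lemma avg_moments_cvg (mu : probability R R) :
  (forall q, avg (s n) (fun x => x ^+ q) @[n --> \oo] -->
     \int[mu]_x (clamp K x ^+ q)) ->
  forall f, continuous f ->
    avg (s n) f @[n --> \oo] --> \int[mu]_x f (clamp K x).
Proof.
move=> hmom f cf; apply/cvgrPdist_le => e e0.
have e3 : 0 < e / 3 by rewrite divr_gt0.
have [p hp] := weierstrass cf K0 e3.
have cp : avg (s n) (fun x => p.[x]) @[n --> \oo] --> \int[mu]_x p.[clamp K x].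
  have -> : \int[mu]_x p.[clamp K x] =
      \sum_(i < size p) p`_i * \int[mu]_x (clamp K x ^+ i).
    have bX (i : nat) : bounded_mfun (fun x : R => clamp K x ^+ i).
      exact/bounded_mfun_clampX/ltW.
    under eq_Rintegral do rewrite horner_coef.
    rewrite mean_sum; last by move=> i; exact: bounded_mfunZ.
    by apply: eq_bigr => i _; rewrite meanZ.
  under eq_fun do rewrite avg_poly.
  apply: cvg_sum_seq => i; apply: cvgM; first exact: cvg_cst.
  exact: hmom.
have h1 : `|\int[mu]_x f (clamp K x) - \int[mu]_x p.[clamp K x]| <= e / 3.
  have bf : bounded_mfun (fun x => f (clamp K x)).
    by apply: bounded_mfun_clamp => //; exact: ltW.
  have bp : bounded_mfun (fun x => p.[clamp K x]).
    by apply: (bounded_mfun_clamp (ltW K0)); exact: continuous_horner.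
  rewrite -meanB//; apply: mean_norm_le; first exact: bounded_mfunB.
  by move=> x; apply: hp; apply: clamp_bound; exact: ltW.
have /cvgrPdist_le /(_ _ e3) := cp; apply: filterS => n h2.
have h3 := avg_dist_le (sK n) (ltW e3) hp.
move: h1 h2 h3; rewrite !ler_distl; lra.
Qed.

Lemma avg_moments_is_cvg : (forall q, cvgn (fun n => avg (s n) (fun x => x ^+ q))) ->
  forall f, continuous f -> cvgn (fun n => avg (s n) f).
Proof.
move=> hmom f cf; apply: cauchy_cvg; apply: cauchy_exP => e e0.
have e2 : 0 < e / 2 by rewrite divr_gt0.
have [p hp] := weierstrass cf K0 e2.
have : cvgn (fun n => avg (s n) (fun x => p.[x])).
  under eq_fun do rewrite avg_poly.
  apply/cvg_ex; exists (\sum_(i < size p) p`_i * limn (fun n => avg (s n) (fun x => x ^+ i))).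
  by apply: cvg_sum_seq => i; apply: cvgM; [exact: cvg_cst | exact: hmom].
move=> /cvgrPdist_lt /(_ _ e2) H.
exists (limn (fun n => avg (s n) (fun x => p.[x]))).
apply: filterS H => n h2; rewrite /ball /=.
have h3 := avg_dist_le (sK n) (ltW e2) hp.
move: h2 h3; rewrite !ler_distl ltr_distl; rewrite ltr_distl; lra.
Qed.

(** Positivity of the limit functional is inherited from the averages, so no positivity property of
    the sequence [m] has to be verified. *)
Lemma avg_limit_probability (m : nat -> R) : m 0%N = 1 ->
  (forall q, avg (s n) (fun x => x ^+ q) @[n --> \oo] --> m q) ->
  exists mu : probability R R, supported_in mu (K + 1) /\
    forall q, \int[mu]_x (clamp (K + 1) x ^+ q) = m q.
Proof.
move=> m0 hm; have cv f : continuous f -> cvgn (fun n => avg (s n) f).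
  by apply: avg_moments_is_cvg => q; apply/cvg_ex; exists (m q).
have [||| mu [smu hmu]] := @riesz_probability R K (fun f => limn (fun n => avg (s n) f)) K0.
- move=> f g u v cf cg; under eq_fun do rewrite avgD.
  apply/cvg_lim => //; apply: cvgD; apply: cvgM; first exact: cvg_cst.
  + exact: cv.
  + exact: cvg_cst.
  + exact: cv.
- move=> f g cf cg fg; apply: ler_lim; [exact: cv|exact: cv|].
  by apply: nearW => n; exact: avg_le (sK n) fg.
- by have := hm 0%N; rewrite m0 => h; apply/cvg_lim => //; exact: h.
exists mu; split => // q; rewrite (hmu (fun x => x ^+ q)); last exact: exprn_continuous.
by apply/cvg_lim => //; exact: hm.
Qed.

End averages.

Lemma probability_eq_moments (R : realType) (mu nu : probability R R) (K : R) :
  0 < K -> supported_in mu K -> supported_in nu K ->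
  (forall q, \int[mu]_x (clamp K x ^+ q) = \int[nu]_x (clamp K x ^+ q)) ->
  forall A, measurable A -> mu A = nu A.
Proof.
move=> K0 smu snu H; apply: probability_eq_continuous => f cf bf.
have red (m : probability R R) : supported_in m K ->
    \int[m]_x f x = \int[m]_x f (clamp K x).
  move=> sm; apply: EFin_inj; rewrite -(supported_integralE (ltW K0) sm cf).
  by rewrite bounded_mfun_integralE//; exact: bounded_mfun_continuous.
rewrite !red//; apply/eqP; rewrite -subr_eq0 -normr_le0; apply/ler_addgt0Pr => e e0.
rewrite add0r; have e2 : 0 < e / 2 by rewrite divr_gt0.
have [p hp] := weierstrass cf K0 e2.
have h1 (m : probability R R) :
   `|\int[m]_x f (clamp K x) - \int[m]_x p.[clamp K x]| <= e / 2.
  have bfc : bounded_mfun (fun x => f (clamp K x)).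
    by apply: bounded_mfun_clamp => //; exact: ltW.
  have bp : bounded_mfun (fun x => p.[clamp K x]).
    by apply: (bounded_mfun_clamp (ltW K0)); exact: continuous_horner.
  rewrite -meanB//; apply: mean_norm_le; first exact: bounded_mfunB.
  by move=> x; apply: hp; apply: clamp_bound; exact: ltW.
have h2 : \int[mu]_x p.[clamp K x] = \int[nu]_x p.[clamp K x].
  have E (m : probability R R) : \int[m]_x p.[clamp K x] =
      \sum_(i < size p) p`_i * \int[m]_x (clamp K x ^+ i).
    have bX (i : nat) : bounded_mfun (fun x : R => clamp K x ^+ i).
      exact/bounded_mfun_clampX/ltW.
    under eq_Rintegral do rewrite horner_coef.
    rewrite mean_sum; last by move=> i; exact: bounded_mfunZ.
    by apply: eq_bigr => i _; rewrite meanZ.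
  by rewrite !E; apply: eq_bigr => i _; rewrite H.
have := h1 mu; have := h1 nu; rewrite h2 !ler_distl; lra.
Qed.

(** * Independence *)

Section transfer.
Context (R : realType) (d : measure_display) (Om : measurableType d)
  (P : probability Om R).

Definition mfun_of (d' : measure_display) (T : measurableType d') (X : Om -> T)
    (mX : measurable_fun setT X) : {mfun Om >-> T} :=
  HB.pack X (isMeasurableFun.Build _ _ _ _ X mX).

Lemma mean_distribution (d' : measure_display) (T : measurableType d')
    (X : {mfun Om >-> T}) (f : T -> R) : bounded_mfun f ->
  \int[distribution P X]_y f y = \int[P]_w f (X w).
Proof.
move=> bf; rewrite /Rintegral integral_distribution//.
  by apply/measurable_EFinP; case: bf.
apply: (@bounded_mfun_integrable _ _ _ P (fun w => f (X w))).
case: bf => mf [M hM]; split; last by exists M.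
exact: measurableT_comp.
Qed.

(** Truncating at [C] turns the power into a bounded function on the line without changing the
    integrand, so the mean can be computed from the law. *)
Lemma mean_eq_distribution (X Y : Om -> R) (C : R) : 0 <= C ->
  measurable_fun setT X -> measurable_fun setT Y ->
  (forall w, `|X w| <= C) -> (forall w, `|Y w| <= C) ->
  (forall A : set R, measurable A -> P (X @^-1` A) = P (Y @^-1` A)) ->
  forall n, \int[P]_w (X w ^+ n) = \int[P]_w (Y w ^+ n).
Proof.
move=> C0 mX mY XC YC XY n.
have red (Z : Om -> R) (mZ : measurable_fun setT Z) : (forall w, `|Z w| <= C) ->
    \int[P]_w (Z w ^+ n) = \int[distribution P (mfun_of mZ)]_y (clamp C y ^+ n).
  move=> ZC; rewrite mean_distribution; last exact: bounded_mfun_clampX.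
  by apply: eq_Rintegral => w _ /=; rewrite clamp_id.
rewrite (red _ mX)// (red _ mY)// /Rintegral; congr fine.
by apply: eq_measure_integral => A mA _; exact: XY.
Qed.

End transfer.

Lemma mean_prod (R : realType) (d1 d2 : measure_display) (T1 : measurableType d1)
    (T2 : measurableType d2) (m1 : probability T1 R) (m2 : probability T2 R)
    (f : T1 -> R) (g : T2 -> R) : bounded_mfun f -> bounded_mfun g ->
  \int[(m1 \x m2)%E]_z (f z.1 * g z.2) = \int[m1]_x f x * \int[m2]_y g y.
Proof.
move=> bf bg.
have bfg : bounded_mfun (fun z : T1 * T2 => f z.1 * g z.2).
  apply: bounded_mfunM; [case: bf => mf [M hM]|case: bg => mf [M hM]].
    by split; [exact: measurableT_comp | exists M => z].
  by split; [exact: measurableT_comp | exists M => z].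
have := @bounded_mfun_integrable _ _ _ (m1 \x m2)%E _ bfg => ifg.
rewrite /Rintegral -(integral12_prod_meas1 ifg) /fubini_F /=.
transitivity (fine (\int[m1]_x (f x * \int[m2]_y g y)%:E)); last first.
  by rewrite -/(Rintegral m1 setT (fun x => f x * \int[m2]_y g y)) RintegralZr//;
    exact: bounded_mfun_integrable.
congr fine; apply: eq_integral => x _.
rewrite -(meanZ _ _ bg) -bounded_mfun_integralE//.
exact: bounded_mfunZ.
Qed.

(** * Independence of functions of disjoint sets of weights *)

Section independence.
Context (R : realType) (d : measure_display) (Om : measurableType d)
  (P : probability Om R) (b : nat -> Om -> R).
Hypothesis mb : forall k, measurable_fun setT (b k).
Hypothesis indep : forall (I : seq nat) (A : nat -> set R), uniq I ->
  all (leq 1) I -> (forall k, measurable (A k)) ->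
  P (\bigcap_(k in [set` I]) (b k @^-1` A k)) =
  (\prod_(k <- I) P (b k @^-1` A k))%E.

(** A pi-system generating the sigma-algebra of the [b k] with [k] in [I], on which the independence
    hypothesis speaks directly. *)
Definition cylinders (I : seq nat) : set (set Om) :=
  [set \bigcap_(k in [set` I]) (b k @^-1` A k) |
    A in [set A : nat -> set R | forall k, measurable (A k)]].

Lemma cylinder_measurable I : cylinders I `<=` measurable.
Proof.
move=> _ [A mA <-]; apply: fin_bigcap_measurable => // k _.
by rewrite -[X in measurable X]setTI; apply: mb.
Qed.

Lemma cylinderT I : cylinders I setT.
Proof.
exists (fun=> setT) => [k|]; first exact: measurableT.
by apply/seteqP; split => // w _ k _.
Qed.

Lemma cylindersI I : setI_closed (cylinders I).
Proof.
move=> _ _ [A mA <-] [A' mA' <-].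
exists (fun k => A k `&` A' k) => [k|]; first exact: measurableI.
apply/seteqP; split => w.
  by move=> h; split => k kI; have [] := h k kI.
by move=> [h1 h2] k kI; split; [exact: h1 | exact: h2].
Qed.

Lemma cylinders_indep I J E F : uniq (I ++ J) -> all (leq 1) (I ++ J) ->
  cylinders I E -> cylinders J F -> P (E `&` F) = (P E * P F)%E.
Proof.
move=> uIJ aIJ [A mA <-] [B mB <-].
move: (uIJ) (aIJ); rewrite cat_uniq all_cat => /and3P[uI nIJ uJ] /andP[aI aJ].
pose C k := if k \in I then A k else B k.
have mC k : measurable (C k) by rewrite /C; case: ifP.
have notI k : k \in J -> k \in I = false.
  by move=> kJ; apply/negP => kI; move/hasPn: nIJ => /(_ _ kJ); rewrite /= kI.
have -> : \bigcap_(k in [set` I]) (b k @^-1` A k) `&`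
    \bigcap_(k in [set` J]) (b k @^-1` B k) =
    \bigcap_(k in [set` I ++ J]) (b k @^-1` C k).
  apply/seteqP; split => w.
    move=> [h1 h2] k /=; rewrite mem_cat /C => /orP[kI|kJ].
      by rewrite kI; exact: h1.
    by rewrite notI//; exact: h2.
  move=> h; split => k /= kI.
    by have := h k; rewrite /= mem_cat kI /C kI; apply.
  by have := h k; rewrite /= mem_cat kI orbT /C notI//; apply.
rewrite !indep// big_cat /=; congr (_ * _)%E.
  by rewrite big_seq [RHS]big_seq; apply: eq_bigr => k kI; rewrite /C kI.
by rewrite big_seq [RHS]big_seq; apply: eq_bigr => k kJ; rewrite /C notI.
Qed.

Lemma sigma_cylinders_measurable I : <<s cylinders I >> `<=` measurable.
Proof.
apply: smallest_sub; first exact: sigma_algebra_measurable.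
exact: cylinder_measurable.
Qed.

(* Both sides are finite measures in [E] (resp. [F]) that agree on a pi-system. *)
Lemma sigma_cylinders_indep I J E F : uniq (I ++ J) -> all (leq 1) (I ++ J) ->
  <<s cylinders I >> E -> <<s cylinders J >> F -> P (E `&` F) = (P E * P F)%E.
Proof.
move=> uIJ aIJ sE sF.
have ext G (F0 : set Om) (mF0 : measurable F0) : setI_closed G -> G `<=` measurable ->
    G setT -> (forall E0, G E0 -> P (E0 `&` F0) = (P E0 * P F0)%E) ->
    forall E0, <<s G >> E0 -> P (E0 `&` F0) = (P E0 * P F0)%E.
  move=> GI mG GT HG E0 sE0.
  pose r := NngNum (fine_ge0 (measure_ge0 P F0)).
  have cov : \bigcup_(k : nat) [set: Om] = setT.
    by apply/seteqP; split => // w _; exists 0%N.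
  have PF0 : (r%:num)%:E = P F0 by rewrite /= fineK// fin_num_measure.
  have H1 A : G A -> mrestr P mF0 A = mscale r P A.
    by move=> GA; rewrite /mrestr /mscale PF0 muleC; exact: HG.
  have H2 (k : nat) : (mrestr P mF0 [set: Om] < +oo)%E.
    by rewrite /mrestr setTI (le_lt_trans (probability_le1 _ _))// ltry.
  transitivity (mscale r P E0); last by rewrite /mscale PF0 muleC.
  exact: (@g_sigma_algebra_measure_unique _ R Om G mG (fun=> setT) (fun=> GT) cov
    (mrestr P mF0) (mscale r P) GI H1 H2 E0 sE0).
have mF := sigma_cylinders_measurable sF.
have mE := sigma_cylinders_measurable sE.
apply: (ext (cylinders I)) => //; [exact: cylindersI|exact: cylinder_measurable|exact: cylinderT|].
move=> E0 cE0; have mE0 := cylinder_measurable cE0.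
rewrite setIC muleC; apply: (ext (cylinders J)) => //; [exact: cylindersI|exact: cylinder_measurable|exact: cylinderT|].
by move=> F0 cF0; rewrite setIC muleC; exact: cylinders_indep cE0 cF0.
Qed.

Definition depends_on (I : seq nat) (X : Om -> R) :=
  measurable_fun setT (X : g_sigma_algebraType (cylinders I) -> R).

Lemma depends_on_var I k : k \in I -> depends_on I (b k).
Proof.
move=> kI _ B mB; rewrite setTI; apply: sub_sigma_algebra.
exists (fun j => if j == k then B else setT) => [j|]; first by case: ifP.
apply/seteqP; split => w; first by move=> /(_ k kI) /=; rewrite eqxx.
by move=> bw j jI /=; case: eqP => // ->.
Qed.

Lemma depends_onW I J X : {subset I <= J} -> depends_on I X -> depends_on J X.
Proof.
move=> IJ dX _ B mB; have := dX measurableT B mB; apply.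
split; first exact: smallest_sigma_algebra.
move=> _ [A mA <-]; apply: sub_sigma_algebra.
exists (fun k => if k \in I then A k else setT) => [k|]; first by case: ifP.
apply/seteqP; split => w.
  by move=> h k /= kI; have := h k (IJ _ kI); rewrite kI.
by move=> h k kJ /=; case: ifP => // kI; exact: h.
Qed.

Lemma depends_on_mfun I X : depends_on I X -> measurable_fun setT X.
Proof.
by move=> dX _ B mB; apply: (@sigma_cylinders_measurable I); exact: dX.
Qed.

Lemma depends_on_prod J (I : seq nat) (F : nat -> Om -> R) :
  (forall k, k \in I -> depends_on J (F k)) ->
  depends_on J (fun w => \prod_(k <- I) F k w).
Proof.
elim: I => [_|k I IH H].
  by rewrite /depends_on; under eq_fun do rewrite big_nil; exact: measurable_cst.
rewrite /depends_on; under eq_fun do rewrite big_cons.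
apply: measurable_funM; first by apply: H; rewrite mem_head.
by apply: IH => j jI; apply: H; rewrite inE jI orbT.
Qed.

(** The joint law of [X] and [Y] agrees with the product of their laws on rectangles, hence
    everywhere, and Fubini concludes. Truncation at a common bound makes the product of the
    coordinates a bounded function on the whole plane. *)
Lemma indep_mean I J (X Y : Om -> R) : uniq (I ++ J) -> all (leq 1) (I ++ J) ->
  depends_on I X -> depends_on J Y ->
  (exists M, forall w, `|X w| <= M) -> (exists M, forall w, `|Y w| <= M) ->
  \int[P]_w (X w * Y w) = \int[P]_w X w * \int[P]_w Y w.
Proof.
move=> uIJ aIJ dX dY bX bY.
have [C C0 [XC YC]] : exists2 C : R, 0 <= C &
    (forall w, `|X w| <= C) /\ (forall w, `|Y w| <= C).
  move: bX bY => [M hM] [L hL]; exists (Num.max 0 (Num.max M L)).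
    by rewrite le_max lexx.
  by split => w; rewrite !le_max ?hM ?hL ?orbT.
have mX := depends_on_mfun dX; have mY := depends_on_mfun dY.
pose X' := mfun_of mX; pose Y' := mfun_of mY.
pose Z' := mfun_of (measurable_fun_pair mX mY).
have bc : bounded_mfun (fun x : R => clamp C x).
  by apply: (@bounded_mfun_clamp R id) => // x; exact: cvg_id.
have bcc : bounded_mfun (fun z : R * R => clamp C z.1 * clamp C z.2).
  case: bc => mc [M hM].
  by apply: bounded_mfunM; split; try (by exists M => z); exact: measurableT_comp.
transitivity (\int[distribution P Z']_z (clamp C z.1 * clamp C z.2)).
  rewrite mean_distribution//; apply: eq_Rintegral => w _ /=.
  by rewrite !clamp_id.
transitivity (\int[(distribution P X' \x distribution P Y')%E]_z (clamp C z.1 * clamp C z.2)).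
  rewrite /Rintegral; congr fine; apply: eq_measure_integral => A mA _.
  apply/esym/product_measure_unique => // B1 B2 mB1 mB2.
  apply: (sigma_cylinders_indep uIJ aIJ); rewrite -[X in <<s _ >> X]setTI.
    exact: (dX measurableT).
  exact: (dY measurableT).
rewrite mean_prod// !mean_distribution//.
by congr (_ * _); apply: eq_Rintegral => w _ /=; rewrite clamp_id.
Qed.

Hypothesis ident : forall k, (1 <= k)%N -> forall A : set R, measurable A ->
  P (b k @^-1` A) = P (b 1%N @^-1` A).

Lemma mean_prod_pow (C : R) (I : seq nat) (a : nat -> nat) :
  (forall k w, `|b k w| <= C) -> uniq I -> all (leq 1) I ->
  \int[P]_w (\prod_(k <- I) b k w ^+ a k) = \prod_(k <- I) \int[P]_w (b 1%N w ^+ a k).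
Proof.
move=> bC; have C0 : 0 <= C by exact: le_trans (bC 0%N point).
have bdb k : bounded_mfun (b k) by split => //; exists C.
elim: I => [|k I IH] /=.
  by move=> _ _; under eq_Rintegral do rewrite big_nil; rewrite mean_cst big_nil.
move=> /andP[kI uI] /andP[k1 aI]; rewrite big_cons -IH//.
under eq_Rintegral do rewrite big_cons.
rewrite (@indep_mean [:: k] I); first last.
- by case: (bounded_mfun_prod I xpredT (fun k => bounded_mfunX (a k) (bdb k))).
- by case: (bounded_mfunX (a k) (bdb k)).
- by apply: depends_on_prod => j jI; apply: measurable_funX; exact: depends_on_var.
- by apply: measurable_funX; apply: depends_on_var; rewrite inE.
- by rewrite /= k1 aI.
- by rewrite /= kI.
congr (_ * _); apply: (mean_eq_distribution C0) => //; exact: ident.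
Qed.

End independence.

(** * Window products and closed paths *)

Section window_products.
Context (R : realType).

Lemma fsbig_prod_pow (F : int -> R) (l : int -> nat) (r : seq int) : uniq r ->
  (forall i, l i <> 0%N -> i \in r) ->
  \big[*%R/1]_(i \in [set: int]) F i ^+ l i = \prod_(i <- r) F i ^+ l i.
Proof.
move=> ur hr; rewrite [RHS]fsbig_seq//; symmetry; apply: fsbig_widen => //.
move=> i /= [_ ir]; case: (eqVneq (l i) 0%N) => [->|/eqP /hr//].
by rewrite expr0.
Qed.

Lemma fsbig_prod_fun (F : nat -> R) (l : int -> nat) (r : seq int) : uniq r ->
  F 0%N = 1 -> (forall i, l i <> 0%N -> i \in r) ->
  \big[*%R/1]_(i \in [set: int]) F (l i) = \prod_(i <- r) F (l i).
Proof.
move=> ur F0 hr; rewrite [RHS]fsbig_seq//; symmetry; apply: fsbig_widen => //.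
by move=> i /= [_ ir]; case: (eqVneq (l i) 0%N) => [->|/eqP /hr//].
Qed.

Lemma finite_support_seq (l : int -> nat) : finite_set [set i | l i <> 0%N] ->
  exists2 r : seq int, uniq r & forall i, (l i <> 0%N) <-> (i \in r).
Proof.
move=> /finite_seqP[s hs]; exists (undup s) => [|i]; first exact: undup_uniq.
rewrite mem_undup; split => [h|h].
  by have : [set` s] i by rewrite -hs.
by have : [set i | l i <> 0%N] i by rewrite hs.
Qed.

(** Extension by zero turns the restriction on [p] in [window_avg] into a vanishing factor: a power
    of 0 vanishes exactly when the exponent is nonzero, that is, when the site belongs to the
    support. *)
Definition zext (sigma : nat -> nat -> R) (N : nat) (k : int) : R :=
  if 1 <= k <= N%:Z then sigma N (absz k) else 0.

Lemma window_avgE (sigma : nat -> nat -> R) (l : int -> nat) (r : seq int) N :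
  uniq r -> (forall i, (l i <> 0%N) -> (i \in r)) ->
  window_avg sigma l N =
  N%:R^-1 * \sum_(1 <= p < N.+1) \prod_(i <- r) zext sigma N (p%:Z + i) ^+ l i.
Proof.
move=> ur hr; rewrite /window_avg; congr (_ * _); rewrite big_mkcond /=.
apply: eq_bigr => p _; case: asboolP => [h|/existsNP[i /not_implyP[li hi]]].
  rewrite (fsbig_prod_pow _ ur hr); apply: eq_bigr => i _.
  have [->|/eqP li] := eqVneq (l i) 0%N; first by rewrite !expr0.
  by rewrite /zext h.
rewrite (bigD1_seq i) ?hr//= /zext ifF; last exact/negP.
by rewrite expr0n (negbTE (introN eqP li)) mul0r.
Qed.

End window_products.

(** * Nearest-neighbour paths and their crossing counts *)

Section walks.
Context (R : realType).

(** Paths from [x] to 0. The free starting point allows recursion on the first step; closed paths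
    are the case [x = 0]. *)
Fixpoint walks (q : nat) (x : int) : seq (q.+1.-tuple int) :=
  match q with
  | 0 => if x == 0 then [:: [tuple x]] else [::]
  | q'.+1 => [seq cons_tuple x g | g <- walks q' (x + 1) ++ walks q' (x - 1)]
  end.

Lemma walksP q x (g : q.+1.-tuple int) : reflect
  [/\ nth 0 g 0 = x, nth 0 g q = 0 &
    forall s, (1 <= s <= q)%N -> `|nth 0 g s - nth 0 g s.-1| = 1]
  (g \in walks q x).
Proof.
elim: q x g => [|q IH] x g.
  case: (tupleP g) => a h; rewrite (tuple0 h) /=.
  apply: (iffP idP).
    case: (x =P 0) => [->|]//; rewrite inE => /eqP gE.
    by move: (congr1 val gE) => /= [->]; split => // s; lia.
  move=> [<- /= -> _]; rewrite (eqxx (0 : int)) inE; exact/eqP/val_inj.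
case: (tupleP g) => a h; apply: (iffP mapP) => /=.
  move=> [h']; rewrite mem_cat => hh' /(congr1 val) /= [-> hE].
  have {hE} -> : h = h' by exact: val_inj.
  have [y [yx h0 hq hs]] : exists y, [/\ `|y - x| = 1, nth 0 h' 0 = y, nth 0 h' q = 0 &
      forall s, (1 <= s <= q)%N -> `|nth 0 h' s - nth 0 h' s.-1| = 1].
    by case/orP: hh' => /IH[h0 hq hs]; [exists (x + 1)|exists (x - 1)]; split => //; lia.
  split => // -[//|[_|s sq]] /=; first by rewrite h0.
  exact: (hs s.+1).
move=> [<- hq hs]; exists h => //; rewrite mem_cat.
have h01 := hs 1%N isT.
have hs' s : (1 <= s <= q)%N -> `|nth 0 h s - nth 0 h s.-1| = 1.
  by case: s => // s sq; exact: (hs s.+2).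
have : nth 0 h 0 = a + 1 \/ nth 0 h 0 = a - 1 by move: h01 => /=; lia.
by case=> E; apply/orP; [left|right]; apply/IH.
Qed.

Lemma walks_uniq q x : uniq (walks q x).
Proof.
elim: q x => [|q IH] x /=; first by case: ifP.
rewrite map_inj_uniq; last by move=> g h /(congr1 val) /= [] gh; exact: val_inj.
rewrite cat_uniq !IH /= andbT; apply/hasPn => g /walksP[g0 _ _].
by apply/negP => /walksP[]; rewrite g0 => /eqP; lia.
Qed.

Lemma closed_path_walks q : closed_path q = [set` walks q 0].
Proof. by apply/seteqP; split => g /=; [move=> h; exact/walksP | move/walksP]. Qed.

(** An edge is named by its left end, here the minimum of the first two positions. *)
Lemma crossings_cons q (x : int) (g : q.+1.-tuple int) (i : int) :
  crossings (cons_tuple x g) i =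
  (nat_of_bool ((Num.min x (nth 0 g 0%N) == i) && (`|nth 0 g 0%N - x| == 1))%R
    + crossings g i)%N.
Proof.
rewrite /crossings /=; congr (_ + _)%N; last first.
  rewrite -[iota 2 q]/(iota (1 + 1) q) iotaDl count_map.
  by apply: eq_in_count => -[|s]; rewrite mem_iota.
by congr (nat_of_bool _); lia.
Qed.

(** With [t i] as weight of the edge {i, i + 1}, this is the entry (x, 0) of the q-th power of the
    bi-infinite tridiagonal matrix, computed by expanding along the first step. *)
Definition trans_weight (t : int -> R) := fix trans_weight (q : nat) (x : int) : R :=
  if q is q'.+1 then
    t x * trans_weight q' (x + 1) + t (x - 1) * trans_weight q' (x - 1)
  else (x == 0)%:R.

Lemma crossings_range q x (g : q.+1.-tuple int) i : g \in walks q x ->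
  crossings g i <> 0%N -> x - q%:Z <= i <= x + q%:Z.
Proof.
elim: q x g => [|q IH] x g; first by [].
rewrite /= => /mapP[h hh ->]; rewrite crossings_cons => H.
have {H} : (Num.min x (nth 0 h 0) = i /\ `|nth 0 h 0 - x| = 1) \/ crossings h i <> 0%N.
  by move: H; case: eqP => [->|]; case: eqP; intuition.
move: hh; rewrite mem_cat => /orP[] hh [[]|/(IH _ _ hh)]; lia.
Qed.

Lemma trans_weightE (t : int -> R) q (r : seq int) (x : int) : uniq r ->
  (forall i, x - q%:Z <= i <= x + q%:Z -> i \in r) ->
  trans_weight t q x = \sum_(g <- walks q x) \prod_(i <- r) t i ^+ crossings g i.
Proof.
move=> ur; elim: q x => [|q IH] x hr /=.
  case: eqP => _; last by rewrite big_nil.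
  by rewrite big_seq1 big1 // => i _; rewrite /crossings /= expr0.
have IH1 := IH (x + 1); have IH2 := IH (x - 1).
rewrite IH1; last by move=> i hi; apply: hr; lia.
rewrite IH2; last by move=> i hi; apply: hr; lia.
rewrite big_map big_cat /= !mulr_sumr; congr (_ + _).
  rewrite big_seq [RHS]big_seq; apply: eq_bigr => g /walksP[g0 _ _].
  under [RHS]eq_bigr do rewrite crossings_cons exprD.
  rewrite big_split /=; congr (_ * _).
  rewrite (bigD1_seq x) //=; last by apply: hr; lia.
  rewrite big1 ?mulr1; first by rewrite g0 (_ : _ && _ = true) ?expr1//; lia.
  by move=> i ix; rewrite g0 (_ : _ && _ = false) ?expr0//; lia.
rewrite big_seq [RHS]big_seq; apply: eq_bigr => g /walksP[g0 _ _].
under [RHS]eq_bigr do rewrite crossings_cons exprD.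
rewrite big_split /=; congr (_ * _).
rewrite (bigD1_seq (x - 1)) //=; last by apply: hr; lia.
rewrite big1 ?mulr1; first by rewrite g0 (_ : _ && _ = true) ?expr1//; lia.
by move=> i ix; rewrite g0 (_ : _ && _ = false) ?expr0//; lia.
Qed.

Lemma sum_crossings q x (g : q.+1.-tuple int) (r : seq int) : uniq r ->
  (forall i, x - q%:Z <= i <= x + q%:Z -> i \in r) -> g \in walks q x ->
  (\sum_(i <- r) crossings g i)%N = q.
Proof.
move=> ur; elim: q x g => [|q IH] x g hr.
  by move=> _; rewrite big1.
rewrite /= => /mapP[h hh ->]; under eq_bigr do rewrite crossings_cons.
rewrite big_split /= -[RHS]add1n.
have [y [yx hy]] : exists y, (y = x + 1 \/ y = x - 1) /\ h \in walks q y.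
  by move: hh; rewrite mem_cat => /orP[] hh; [exists (x + 1)|exists (x - 1)]; split; auto.
rewrite (IH y h _ hy); last by move=> i hi; apply: hr; lia.
congr (_ + _)%N; case/walksP: hy => h0 _ _.
rewrite (bigD1_seq (Num.min x y)) //=; last by apply: hr; lia.
rewrite h0 big1; first by rewrite eqxx /=; lia.
by move=> i ix; rewrite (_ : _ && _ = false)//; lia.
Qed.

End walks.

(** * Spectral moments of Jacobi matrices *)

Section jacobi_spectrum.
Local Open Scope complex_scope.

Lemma conj_mulmx (F : comUnitRingType) (n : nat) (U D E : 'M[F]_n) : U \in unitmx ->
  (invmx U *m D *m U) *m (invmx U *m E *m U) = invmx U *m (D *m E) *m U.
Proof. by move=> hU; rewrite !mulmxA mulmxK. Qed.

Section spectral_moments.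
Context (R : realType) (n : nat) (A : 'M[R[i]]_n).
Hypothesis hA : A \is hermsymmx.

Lemma hermitian_exp_spectral q : A ^+ q =
  invmx (spectralmx A) *m diag_mx (\row_k (spectral_diag A 0 k ^+ q)) *m spectralmx A.
Proof.
have /hermitian_normalmx/orthomx_spectralP AE := hA.
elim: q => [|q IH].
  rewrite expr0 (_ : diag_mx _ = 1%:M) ?mulmx1 ?mulVmx ?spectral_unit//.
  by apply/matrixP => i j; rewrite !mxE expr0.
rewrite exprS IH; set U := spectralmx A in AE *; set D := diag_mx _.
have UU : U \in unitmx by exact: spectral_unit.
transitivity ((invmx U *m diag_mx (spectral_diag A) *m U) *m (invmx U *m D *m U)).
  exact: (congr1 (fun B => B *m (invmx U *m D *m U)) AE).
rewrite (conj_mulmx _ _ UU) /D mulmx_diag.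
by congr (_ *m diag_mx _ *m _); apply/rowP => k; rewrite !mxE exprS.
Qed.

Lemma eigenvalues_size : size (eigenvalues A) = n.
Proof. by rewrite size_map size_enum_ord. Qed.

Lemma avg_eigenvalues (q : nat) :
  (avg (eigenvalues A) (fun x => x ^+ q))%:C = ntr (A ^+ q).
Proof.
have /hermitian_spectral_diag_real /mxOverP rsp := hA.
rewrite /ntr hermitian_exp_spectral mxtrace_mulC mulmxA mulmxV ?spectral_unit//.
rewrite mul1mx mxtrace_diag /avg eigenvalues_size rmorphM fmorphV rmorph_nat.
congr (_ * _); rewrite /eigenvalues big_map big_enum rmorph_sum /=.
by apply: eq_bigr => k _; rewrite mxE rmorphXn /= RRe_real.
Qed.

End spectral_moments.

Lemma bernoulli_ineq (R : realType) (h : R) n : 0 <= h -> 1 + n%:R * h <= (1 + h) ^+ n.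
Proof.
move=> h0; elim: n => [|n IH]; first by rewrite expr0 mul0r addr0.
rewrite exprS; apply: le_trans (_ : (1 + h) * (1 + n%:R * h) <= _); last first.
  by apply: ler_wpM2l IH; lra.
rewrite -natr1; have : 0 <= n%:R * h * h by rewrite !mulr_ge0.
lra.
Qed.

(** Otherwise x = (1 + h) c with h > 0, and by the Bernoulli inequality some even power of 1 + h
    exceeds the fixed number [N]. *)
Lemma le_of_pow_le (R : realType) (x c : R) (N : nat) : 0 < c -> 0 <= x ->
  (forall q, x ^+ q.*2 <= N%:R * c ^+ q.*2) -> x <= c.
Proof.
move=> c0 x0 H; rewrite leNgt; apply/negP => cx.
pose h := x / c - 1; have h0 : 0 < h by rewrite /h subr_gt0 ltr_pdivlMr// mul1r.
pose q := Num.truncn (N%:R / h).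
have Nq : N%:R < q.+1%:R * h.
  by rewrite -ltr_pdivrMr//; apply: truncnS_gt; rewrite divr_ge0// ltW.
have := H q.+1; apply/negP; rewrite -ltNge.
have -> : x = (1 + h) * c by rewrite /h addrCA subrr addr0 mulfVK// gt_eqF.
rewrite exprMn ltr_pM2r ?exprn_gt0//.
apply: lt_le_trans (bernoulli_ineq _ (ltW h0)).
apply: lt_trans Nq _; rewrite ltr_pwDl// ler_pM2r// ler_nat -addnn; lia.
Qed.

Section jacobi.
Context (R : realType) (sigma : nat -> nat -> R) (b : nat -> R) (N : nat).

(** The off-diagonal entries of the matrix, extended to all integers. The zeros at 0 and at [N] keep
    the contributing paths inside 1, ..., N, so traces become sums over paths in the whole line. *)
Definition bond (k : int) : R :=
  if 1 <= k < N%:Z then sigma N (absz k) * b (absz k) else 0.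

Lemma jacobi_mxE (i j : 'I_N) : jacobi_mx sigma b N i j =
  (if j == i.+1 :> nat then bond i.+1%:Z
   else if i == j.+1 :> nat then bond j.+1%:Z else 0)%:C.
Proof.
rewrite /jacobi_mx /weight_mx /profile_mx mxE.
rewrite -mulmxA mulmx_diag [X in X + _]mxE [X in _ + X]mxE.
rewrite (bigD1 j) //= big1 ?addr0; last first.
  by move=> k kj; rewrite !mxE (negbTE kj) mulr0n mulr0.
rewrite (bigD1 i) //= big1 ?addr0; last first.
  by move=> k ki; rewrite mulmx_diag !mxE eq_sym (negbTE ki) mulr0n mul0r.
rewrite mulmx_diag !mxE !eqxx !mulr1n /bond -!rmorphM /=.
have iN := ltn_ord i; have jN := ltn_ord j.
have [ji|ji] := eqVneq (j : nat) i.+1.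
  rewrite (_ : (i == j.+1 :> nat) = false); last by lia.
  rewrite mul0r add0r rmorph1 mulr1 ifT; last by lia.
  by rewrite ifT; [rewrite mulrC|lia].
rewrite rmorph0 mulr0 addr0; have [ij|ij] := eqVneq (i : nat) j.+1.
  by rewrite mul1r ifT; [rewrite ifT //; lia|lia].
by rewrite mul0r rmorph0.
Qed.

Lemma jacobi_hermitian : jacobi_mx sigma b N \is hermsymmx.
Proof.
apply: realsym_hermsym.
  apply/is_hermitianmxP; rewrite expr0 scale1r; apply/matrixP => i j.
  rewrite [RHS]mxE [in RHS]mxE /= !jacobi_mxE; congr (_%:C).
  by case: eqP => ij; case: eqP => ji //; exfalso; lia.
by apply/mxOverP => i j; rewrite jacobi_mxE; apply/complex_realP; eexists.
Qed.

Lemma sum_ord_eq (V : nmodType) (m n : nat) (f : nat -> V) :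
  \sum_(k < n) (if k == m :> nat then f k else 0) = if (m < n)%N then f m else 0.
Proof.
case: ifP => mn.
  rewrite (bigD1 (Ordinal mn)) //= eqxx big1 ?addr0// => k.
  by rewrite -val_eqE /= => /negbTE ->.
rewrite big1 // => k _; case: eqP => // km.
by have := ltn_ord k; rewrite km mn.
Qed.

(** The walk is recentred at the column. Matrix indices start at 0 and bonds at 1, hence the shift
    by [j.+1]. *)
Lemma jacobi_exp q (i j : 'I_N) : (jacobi_mx sigma b N ^+ q) i j =
  (trans_weight (fun k => bond (k + j.+1%:Z)) q (i%:Z - j%:Z))%:C.
Proof.
elim: q i j => [|q IH] i j /=.
  by rewrite expr0 mxE -val_eqE /= subr_eq0 eqz_nat rmorph_nat.
rewrite exprS mxE; under eq_bigr do rewrite IH jacobi_mxE -rmorphM.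
rewrite -rmorph_sum; congr (_%:C).
set W := trans_weight _ q.
(* In the first row [i.-1] is 0 again instead of a neighbour; that spurious term is killed by the
   vanishing bond at 0. *)
transitivity (\sum_(k < N) (if k == i.+1 :> nat then bond i.+1%:Z * W (k%:Z - j%:Z) else 0) +
  \sum_(k < N) (if k == i.-1 :> nat then bond i%:Z * W (k%:Z - j%:Z) else 0)).
  rewrite -big_split /=; apply: eq_bigr => k _.
  have [ki|ki] := eqVneq (k : nat) i.+1.
    by rewrite ifF ?addr0//; lia.
  rewrite add0r; have [ik|ik] := eqVneq (i : nat) k.+1.
    by rewrite ik /= eqxx.
  case: eqP => [ki'|]; last by rewrite mul0r.
  have -> : bond i%:Z = 0 by rewrite /bond ifF//; lia.
  by rewrite !mul0r.
rewrite (sum_ord_eq i.+1 N (fun k => bond i.+1%:Z * W (k%:Z - j%:Z))).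
rewrite (sum_ord_eq i.-1 N (fun k => bond i%:Z * W (k%:Z - j%:Z))).
have iN := ltn_ord i; rewrite [X in _ + X]ifT; last by lia.
congr (_ + _).
  have -> : i%:Z - j%:Z + j.+1%:Z = i.+1%:Z by lia.
  have -> : i.+1%:Z - j%:Z = i%:Z - j%:Z + 1 by lia.
  by case: ifP => // iN'; rewrite /bond ifF ?mul0r//; lia.
have -> : i%:Z - j%:Z - 1 + j.+1%:Z = i%:Z by lia.
have [i0|i0] := eqVneq (i : nat) 0%N.
  have -> : bond i%:Z = 0 by rewrite /bond ifF//; lia.
  by rewrite !mul0r.
by congr (_ * W _); lia.
Qed.

Lemma avg_jacobi q : avg (eigenvalues (jacobi_mx sigma b N)) (fun x => x ^+ q) =
  N%:R^-1 * \sum_(1 <= p < N.+1) trans_weight (fun k => bond (p%:Z + k)) q 0.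
Proof.
apply: complexI; rewrite (avg_eigenvalues jacobi_hermitian) /ntr rmorphM fmorphV rmorph_nat.
congr (_ * _); rewrite /mxtrace big_add1 /= big_mkord rmorph_sum /=.
apply: eq_bigr => i _; rewrite jacobi_exp subrr; congr (trans_weight _ _ _)%:C.
by apply/funext => k; rewrite addrC.
Qed.

Lemma trans_weight_bound (t : int -> R) (c : R) q x : 0 <= c ->
  (forall k, `|t k| <= c) -> `|trans_weight t q x| <= (2 * c) ^+ q.
Proof.
move=> c0 tc; elim: q x => [|q IH] x /=.
  by rewrite expr0; case: (_ == _); rewrite /= ?normr1 ?normr0.
apply: le_trans (ler_normD _ _) _; rewrite !normrM.
have -> : (2 * c) ^+ q.+1 = c * (2 * c) ^+ q + c * (2 * c) ^+ q by rewrite exprS; ring.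
by apply: lerD; apply: ler_pM.
Qed.

(** One even power |x|^(2q) is at most the sum over the spectrum, which is N times an average of
    path sums, hence at most N (2c)^(2q). Holding for every q, this forces |x| <= 2c. *)
Lemma jacobi_eigenvalue_bound (c : R) : 0 < c -> (forall k, `|bond k| <= c) ->
  all (fun x => `|x| <= 2 * c) (eigenvalues (jacobi_mx sigma b N)).
Proof.
move=> c0 bc; apply/allP => x xs.
have [N0|N0] := posnP N.
  have /size0nil E : size (eigenvalues (jacobi_mx sigma b N)) = 0%N.
    by rewrite eigenvalues_size.
  by rewrite E in xs.
apply: (@le_of_pow_le _ _ _ N) => [||q]; rewrite ?mulr_gt0//.
have sqE (y : R) : `|y| ^+ q.*2 = y ^+ q.*2.
  by rewrite -mul2n !exprM real_normK// num_real.
have Nn : N%:R != 0 :> R by rewrite pnatr_eq0 -lt0n.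
have : \sum_(y <- eigenvalues (jacobi_mx sigma b N)) y ^+ q.*2 <= N%:R * (2 * c) ^+ q.*2.
  have := avg_jacobi q.*2; rewrite /avg eigenvalues_size.
  move=> /(mulfI (invr_neq0 Nn)) ->.
  apply: le_trans (_ : \sum_(1 <= p < N.+1) (2 * c) ^+ q.*2 <= _).
    apply: ler_sum => p _; apply: le_trans (ler_norm _) _.
    by apply: trans_weight_bound => //; exact: ltW.
  by rewrite sumr_const_nat subn1 [leRHS]mulr_natl.
apply: le_trans; rewrite (big_rem x)//= sqE lerDl sumr_ge0// => y _.
by rewrite -sqE exprn_ge0.
Qed.

End jacobi.

Lemma tridiag_jacobi (R : realType) (b : nat -> R) (N : nat) :
  tridiag_mx b N = jacobi_mx (fun _ _ => 1) b N.
Proof.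
apply/matrixP => i j; rewrite jacobi_mxE mxE /bond !mul1r; congr (_%:C).
have iN := ltn_ord i; have jN := ltn_ord j.
case: eqP => ji; first by rewrite ifT//; lia.
by case: eqP => // ij; rewrite ifT//; lia.
Qed.

End jacobi_spectrum.

(** * Fourth moments and almost sure convergence *)

Section fourth_moment.
Context (R : realType) (d : measure_display) (Om : measurableType d)
  (P : probability Om R).

Definition near_nat (m p q : nat) := ((p <= q + m) && (q <= p + m))%N.

Lemma near_nat_sum (m N p : nat) :
  \sum_(1 <= q < N.+1) (near_nat m p q)%:R <= (m.*2.+1)%:R :> R.
Proof.
rewrite -natr_sum ler_nat.
have -> : (\sum_(1 <= q < N.+1) near_nat m p q)%N =
    count (near_nat m p) (index_iota 1 N.+1).
  by elim: index_iota => [|x s IH]; rewrite ?big_nil ?big_cons//= IH.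
rewrite -size_filter.
have <- : size (iota (p - m) m.*2.+1) = m.*2.+1 by rewrite size_iota.
apply: uniq_leq_size; first exact/filter_uniq/iota_uniq.
by move=> q; rewrite mem_filter /near_nat !mem_iota; lia.
Qed.

(* The factor 2 is needed when all close pairs share one index. *)
Lemma near_pairing (m p1 p2 p3 p4 : nat) :
  near_nat m p1 p2 || near_nat m p1 p3 || near_nat m p1 p4 ->
  near_nat m p2 p1 || near_nat m p2 p3 || near_nat m p2 p4 ->
  near_nat m p3 p1 || near_nat m p3 p2 || near_nat m p3 p4 ->
  near_nat m p4 p1 || near_nat m p4 p2 || near_nat m p4 p3 ->
  [|| near_nat m.*2 p1 p2 && near_nat m.*2 p3 p4,
      near_nat m.*2 p1 p3 && near_nat m.*2 p2 p4 |
      near_nat m.*2 p1 p4 && near_nat m.*2 p2 p3].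
Proof. rewrite /near_nat; lia. Qed.

(** An index far from the three others makes the mean vanish; the surviving quadruples split into
    two pairs within distance 2m. There are 3 ways to pair, and for each at most N (4m + 1) choices
    per pair. *)
Lemma fourth_moment_le (W : nat -> Om -> R) (N m : nat) (K : R) :
  (forall p, measurable_fun setT (W p)) -> (forall p w, `|W p w| <= K) ->
  (forall p1 p2 p3 p4, (0 < p1)%N -> (0 < p2)%N -> (0 < p3)%N -> (0 < p4)%N ->
     ~~ near_nat m p1 p2 -> ~~ near_nat m p1 p3 ->
     ~~ near_nat m p1 p4 -> \int[P]_w (W p1 w * (W p2 w * (W p3 w * W p4 w))) = 0) ->
  \int[P]_w ((\sum_(1 <= p < N.+1) W p w) ^+ 4) <=
    3 * K ^+ 4 * (N%:R * (m.*2.*2.+1)%:R) ^+ 2.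
Proof.
move=> mW WK iso; have K0 : 0 <= K by exact: le_trans (WK 0%N point).
have bW p : bounded_mfun (W p) by split => //; exists K.
have bW4 p1 p2 p3 p4 : bounded_mfun (fun w => W p1 w * (W p2 w * (W p3 w * W p4 w))).
  by do !apply: bounded_mfunM.
pose n (p q : nat) : R := (near_nat m.*2 p q)%:R.
have n0 p q : 0 <= n p q by rewrite /n ler0n.
pose r := index_iota 1 N.+1.
have rpos p : p \in r -> (0 < p)%N by rewrite mem_index_iota => /andP[].
have term p1 p2 p3 p4 : p1 \in r -> p2 \in r -> p3 \in r -> p4 \in r ->
   \int[P]_w (W p1 w * (W p2 w * (W p3 w * W p4 w))) <=
   K ^+ 4 * (n p1 p2 * n p3 p4 + n p1 p3 * n p2 p4 + n p1 p4 * n p2 p3).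
  move=> /rpos r1 /rpos r2 /rpos r3 /rpos r4.
  have rhs0 : 0 <= K ^+ 4 * (n p1 p2 * n p3 p4 + n p1 p3 * n p2 p4 + n p1 p4 * n p2 p3).
    by rewrite mulr_ge0 ?exprn_ge0// !addr_ge0// mulr_ge0.
  (* The four indices are examined in turn as candidates for isolation; the product is rearranged so
     that the isolated one comes first. *)
  have [h1|] := boolP (near_nat m p1 p2 || near_nat m p1 p3 || near_nat m p1 p4); last first.
    by rewrite !negb_or => /andP[/andP[? ?] ?]; rewrite iso.
  have [h2|] := boolP (near_nat m p2 p1 || near_nat m p2 p3 || near_nat m p2 p4); last first.
    rewrite !negb_or => /andP[/andP[? ?] ?].
    under eq_Rintegral do rewrite mulrCA.
    by rewrite iso.
  have [h3|] := boolP (near_nat m p3 p1 || near_nat m p3 p2 || near_nat m p3 p4); last first.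
    rewrite !negb_or => /andP[/andP[? ?] ?].
    rewrite (_ : Rintegral _ _ _ = \int[P]_w (W p3 w * (W p1 w * (W p2 w * W p4 w)))); last first.
      by apply: eq_Rintegral => w _; ring.
    by rewrite iso.
  have [h4|] := boolP (near_nat m p4 p1 || near_nat m p4 p2 || near_nat m p4 p3); last first.
    rewrite !negb_or => /andP[/andP[? ?] ?].
    rewrite (_ : Rintegral _ _ _ = \int[P]_w (W p4 w * (W p1 w * (W p2 w * W p3 w)))); last first.
      by apply: eq_Rintegral => w _; ring.
    by rewrite iso.
  apply: le_trans (_ : K ^+ 4 <= _).
    apply: le_trans (ler_norm _) _; apply: mean_norm_le => // w.
    by rewrite !normrM 3!exprS expr1; do !apply: ler_pM => //; rewrite ?mulr_ge0.
  rewrite ler_peMr ?exprn_ge0//.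
  have := near_pairing h1 h2 h3 h4; rewrite /n.
  case/or3P => /andP[-> ->]; rewrite mulr1.
  - by rewrite -addrA lerDl addr_ge0// mulr_ge0 ?ler0n.
  - by rewrite addrAC lerDr addr_ge0// mulr_ge0 ?ler0n.
  - by rewrite lerDr addr_ge0// mulr_ge0 ?ler0n.
pose D : R := (m.*2.*2.+1)%:R.
have deg p : \sum_(q <- r) n p q <= D by exact: near_nat_sum.
have S0 : 0 <= \sum_(p <- r) \sum_(q <- r) n p q.
  by apply: sumr_ge0 => p _; apply: sumr_ge0.
have S_le : \sum_(p <- r) \sum_(q <- r) n p q <= N%:R * D.
  apply: le_trans (ler_sum _ (fun p _ => deg p)) _.
  by rewrite big_const_seq count_predT iter_addr addr0 size_iota subSS subn0 mulr_natl.
have expand w : (\sum_(1 <= p < N.+1) W p w) ^+ 4 =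
    \sum_(p1 <- r) \sum_(p2 <- r) \sum_(p3 <- r) \sum_(p4 <- r)
      W p1 w * (W p2 w * (W p3 w * W p4 w)).
  rewrite 3!exprS expr1 -/r.
  have E (X : R) : (\sum_(p <- r) W p w) * X = \sum_(p <- r) W p w * X by rewrite mulr_suml.
  rewrite E; apply: eq_bigr => p1 _; rewrite E mulr_sumr; apply: eq_bigr => p2 _.
  by rewrite E !mulr_sumr; apply: eq_bigr => p3 _; rewrite !mulr_sumr.
under eq_Rintegral do rewrite expand.
rewrite mean_sum; last by move=> p1; do 3 (apply: bounded_mfun_sum => ?).
under eq_bigr => p1 _.
  rewrite mean_sum; last by move=> p2; do 2 (apply: bounded_mfun_sum => ?).
  under eq_bigr => p2 _.
    rewrite mean_sum; last by move=> p3; apply: bounded_mfun_sum => ?.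
    under eq_bigr => p3 _ do rewrite mean_sum//.
    over.
  over.
apply: le_trans (_ : \sum_(p1 <- r) \sum_(p2 <- r) \sum_(p3 <- r) \sum_(p4 <- r)
   K ^+ 4 * (n p1 p2 * n p3 p4 + n p1 p3 * n p2 p4 + n p1 p4 * n p2 p3) <= _).
  rewrite big_seq [leRHS]big_seq; apply: ler_sum => p1 r1.
  rewrite big_seq [leRHS]big_seq; apply: ler_sum => p2 r2.
  rewrite big_seq [leRHS]big_seq; apply: ler_sum => p3 r3.
  by rewrite big_seq [leRHS]big_seq; apply: ler_sum => p4 r4; exact: term.
set S := \sum_(p <- r) \sum_(q <- r) n p q in S0 S_le.
have EA : \sum_(p1 <- r) \sum_(p2 <- r) \sum_(p3 <- r) \sum_(p4 <- r)
    n p1 p2 * n p3 p4 = S ^+ 2.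
  rewrite expr2 mulr_suml; apply: eq_bigr => p1 _; rewrite mulr_suml; apply: eq_bigr => p2 _.
  by rewrite mulr_sumr; apply: eq_bigr => p3 _; rewrite mulr_sumr.
have EB : \sum_(p1 <- r) \sum_(p2 <- r) \sum_(p3 <- r) \sum_(p4 <- r)
    n p1 p3 * n p2 p4 = S ^+ 2.
  rewrite expr2 mulr_suml; apply: eq_bigr => p1 _; rewrite mulr_sumr; apply: eq_bigr => p2 _.
  by rewrite mulr_suml; apply: eq_bigr => p3 _; rewrite mulr_sumr.
have EC : \sum_(p1 <- r) \sum_(p2 <- r) \sum_(p3 <- r) \sum_(p4 <- r)
    n p1 p4 * n p2 p3 = S ^+ 2.
  rewrite expr2 mulr_suml; apply: eq_bigr => p1 _; rewrite mulr_sumr; apply: eq_bigr => p2 _.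
  rewrite mulrC mulr_suml; apply: eq_bigr => p3 _; rewrite mulr_sumr.
  by apply: eq_bigr => p4 _; rewrite mulrC.
have -> : \sum_(p1 <- r) \sum_(p2 <- r) \sum_(p3 <- r) \sum_(p4 <- r)
   K ^+ 4 * (n p1 p2 * n p3 p4 + n p1 p3 * n p2 p4 + n p1 p4 * n p2 p3) =
   K ^+ 4 * (S ^+ 2 + S ^+ 2 + S ^+ 2).
  rewrite -{1}EA -{1}EB -EC -!big_split mulr_sumr /=; apply: eq_bigr => p1 _.
  rewrite -!big_split mulr_sumr /=; apply: eq_bigr => p2 _.
  rewrite -!big_split mulr_sumr /=; apply: eq_bigr => p3 _.
  by rewrite -!big_split mulr_sumr.
rewrite (_ : S ^+ 2 + _ + _ = 3 * S ^+ 2); last by ring.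
rewrite mulrA [K ^+ 4 * 3]mulrC ler_wpM2l ?mulr_ge0 ?exprn_ge0//.
by rewrite ler_pXn2r// nnegrE mulr_ge0 ?ler0n.
Qed.

End fourth_moment.

(** * Almost sure convergence from summable fourth moments *)

Section almost_sure.
Context (R : realType) (d : measure_display) (Om : measurableType d)
  (P : probability Om R).

(** 1/(n+1)^2 is at most 2/((n+1)(n+2)), which telescopes. *)
Lemma sum_inv_sqr_le (n : nat) : \sum_(0 <= k < n) (k.+1%:R ^- 2) <= 2 - 2 / n.+1%:R :> R.
Proof.
elim: n => [|n IH]; first by rewrite big_geq// invr1; lra.
rewrite big_nat_recr//=; apply: le_trans (lerD IH (lexx _)) _.
have p1 : 0 < n.+1%:R :> R by []; have p2 : 0 < n.+2%:R :> R by [].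
rewrite -subr_ge0 (_ : _ - _ = n%:R / (n.+1%:R ^+ 2 * n.+2%:R)).
  by rewrite divr_ge0// mulr_ge0.
rewrite -![n.+2%:R]natr1 -![n.+1%:R]natr1 in p1 p2 *; field.
by rewrite !gt_eqF.
Qed.

(** The sum of the fourth powers has a finite integral, hence is finite almost everywhere, and then
    its terms tend to 0. *)
Lemma as_cvg0 (Y : nat -> Om -> R) (C : R) : (forall n, bounded_mfun (Y n)) -> 0 <= C ->
  (forall n, \int[P]_w (Y n.+1 w ^+ 4) <= C / n.+1%:R ^+ 2) ->
  {ae P, forall w, Y n w @[n --> \oo] --> (0 : R)}.
Proof.
move=> bY C0 hY.
pose f n w : \bar R := (Y n.+1 w ^+ 4)%:E.
have b4 n : bounded_mfun (fun w => Y n w ^+ 4) by exact: bounded_mfunX.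
have mf n : measurable_fun setT (f n) by apply/measurable_EFinP; case: (b4 n.+1).
have f0 n w : (0 <= f n w)%E by rewrite lee_fin exprn_even_ge0.
have If n : (\int[P]_w f n w <= (C / n.+1%:R ^+ 2)%:E)%E.
  by rewrite bounded_mfun_integralE// lee_fin.
have Isum : (\int[P]_w \sum_(0 <= n <oo) f n w <= (2 * C)%:E)%E.
  rewrite integral_nneseries//; apply: lime_le.
    by apply: is_cvg_nneseries => n _ _; exact: integral_ge0.
  apply: nearW => n; apply: le_trans (lee_sum _ (fun k _ => If k)) _.
  rewrite sumEFin lee_fin -mulr_sumr mulrC; apply: ler_wpM2r => //.
  apply: le_trans (sum_inv_sqr_le n) _.
  by rewrite gerBl divr_ge0.
have fin : {ae P, forall w, (\sum_(0 <= n <oo) f n w < +oo)%E}.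
  have : P.-integrable setT (fun w => (\sum_(0 <= n <oo) f n w)%E).
    apply/integrableP; split.
      by apply: ge0_emeasurable_sum.
    under eq_integral do rewrite gee0_abs ?nneseries_ge0//.
    by apply: le_lt_trans Isum _; rewrite ltry.
  move=> /(integrable_ae measurableT); apply: filterS => w /(_ I).
  by rewrite fin_numElt => /andP[].
apply: filterS fin => w hw.
have s0 n : 0 <= Y n.+1 w ^+ 4 by exact: exprn_even_ge0.
have cv : cvgn (series (fun n => Y n.+1 w ^+ 4)).
  apply: nondecreasing_is_cvgn; first by apply: nondecreasing_series => n _ _.
  exists (fine (\sum_(0 <= n <oo) f n w)%E) => _ [n _ <-].
  rewrite -lee_fin fineK; last by rewrite ge0_fin_numE// nneseries_ge0.
  by rewrite /series /= -sumEFin; apply: nneseries_lim_ge => k _ _; exact: f0.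
have c0 := cvg_series_cvg_0 cv.
rewrite -(cvg_shiftS (fun n => Y n w)) /=.
apply/cvgrPdist_lt => e e0; move/cvgrPdist_lt: c0 => /(_ (e ^+ 4) (exprn_gt0 _ e0)).
apply: filterS => n; rewrite !sub0r !normrN normrX.
by rewrite ltr_pXn2r// nnegrE ltW.
Qed.

End almost_sure.

(** * The limit law for bounded weights *)

Definition irange (q : nat) : seq int := [seq k%:Z - q%:Z | k <- iota 0 q.*2.+1].

Lemma irange_uniq q : uniq (irange q).
Proof. by rewrite map_inj_uniq ?iota_uniq// => x y; lia. Qed.

Lemma mem_irange q (i : int) : (- q%:Z <= i <= q%:Z) = (i \in irange q).
Proof.
apply/idP/mapP => [h|[k]]; last by rewrite mem_iota; lia.
by exists (absz (i + q%:Z)); [rewrite mem_iota; lia|lia].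
Qed.

(** Index 0 is left out: independence concerns positive indices only, and the bond at 0 vanishes. *)
Definition window (q p : nat) : seq nat := [seq k <- iota 1 (p + q) | (p <= k + q)%N].

Lemma mem_window q p k : (k \in window q p) = [&& 1 <= k, k <= p + q & p <= k + q]%N.
Proof. by rewrite mem_filter mem_iota; lia. Qed.

Lemma ae_exists (R : realType) (d : measure_display) (Om : measurableType d)
  (P : probability Om R) (Q : Om -> Prop) : {ae P, forall w, Q w} -> exists w, Q w.
Proof.
move=> [A [mA PA hA]]; apply: contrapT => /forallNP nQ.
have AT : A = setT by apply/seteqP; split => // w _; apply: hA => /=; exact: nQ.
have : P setT = 1%E by exact: probability_setT.
by rewrite -AT PA => /eqP; rewrite eq_sym onee_eq0.
Qed.

Lemma prod_norm_le (R : realType) (I : Type) (r : seq I) (F : I -> R) (l : I -> nat) (M : R) :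
  (forall i, `|F i| <= M) ->
  `|\prod_(i <- r) F i ^+ l i| <= \prod_(i <- r) M ^+ l i.
Proof.
move=> FM; rewrite normr_prod; apply: ler_prod => i _.
by rewrite normr_ge0 /= normrX lerXn2r ?nnegrE//; exact: le_trans (FM i).
Qed.

Lemma cvg_harmonicZ (R : realType) (c : R) : c / n%:R @[n --> \oo] --> (0 : R).
Proof.
have h : (n.+1%:R : R)^-1 @[n --> \oo] --> (0 : R) by exact: cvg_harmonic.
have h2 : c / n.+1%:R @[n --> \oo] --> c * 0 by apply: cvgM; [exact: cvg_cst | exact: h].
by rewrite mulr0 in h2; rewrite -(cvg_shiftS (fun n : nat => c / n%:R)).
Qed.

Section model.
Context (R : realType) (d : measure_display) (Om : measurableType d)
  (P : probability Om R) (b : nat -> Om -> R) (sigma : nat -> nat -> R) (M C : R).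
Hypothesis mb : forall k, measurable_fun setT (b k).
Hypothesis indep : forall (I : seq nat) (A : nat -> set R), uniq I ->
  all (leq 1) I -> (forall k, measurable (A k)) ->
  P (\bigcap_(k in [set` I]) (b k @^-1` A k)) =
  (\prod_(k <- I) P (b k @^-1` A k))%E.
Hypothesis ident : forall k, (1 <= k)%N -> forall A : set R, measurable A ->
  P (b k @^-1` A) = P (b 1%N @^-1` A).
Hypothesis bC : forall k w, `|b k w| <= C.
Hypothesis M0 : 0 < M.
Hypothesis C0 : 0 < C.
Hypothesis sM : forall N k, (1 <= k <= N)%N -> `|sigma N k| <= M.
Hypothesis wcvg : forall l : int -> nat, finite_set [set i | l i <> 0%N] ->
  (exists i, l i <> 0%N) -> cvgn (window_avg sigma l).

Let bond' N w := bond sigma (fun k => b k w) N.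
(** Differs from [zext] only at [k = N], where the profile has an entry but the matrix no bond. *)
Let sig N (k : int) : R := if 1 <= k < N%:Z then sigma N (absz k) else 0.
Let beta n := \int[P]_w (b 1%N w ^+ n).
Let Z q N p w := trans_weight (fun k => bond' N w (p%:Z + k)) q 0.

Let bondE N w k : bond' N w k = sig N k * b (absz k) w.
Proof. by rewrite /bond' /bond /sig; case: ifP => // _; rewrite mul0r. Qed.

Let sig_bound N k : `|sig N k| <= M.
Proof.
by rewrite /sig; case: ifP => [h|_]; [apply: sM; lia|rewrite normr0 ltW].
Qed.

Let zext_bound N k : `|zext sigma N k| <= M.
Proof.
by rewrite /zext; case: ifP => [h|_]; [apply: sM; lia|rewrite normr0 ltW].
Qed.

Let bond_bound N w k : `|bond' N w k| <= M * C.
Proof. by rewrite bondE normrM ler_pM. Qed.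

Let Z_bound q N p w : `|Z q N p w| <= (2 * (M * C)) ^+ q.
Proof. by apply: trans_weight_bound => //; rewrite mulr_ge0// ltW. Qed.

Let Z_depends q N p : depends_on b (window q p) (Z q N p).
Proof.
(* The invariant |x| + q' <= q says that the steps still to come stay within distance [q] of the
   base point. *)
have main q' x : (absz x + q' <= q)%N ->
    depends_on b (window q p) (fun w => trans_weight (fun k => bond' N w (p%:Z + k)) q' x).
  elim: q' x => [|q' IH] x hx /=; first exact: measurable_cst.
  have bd y : (absz y <= q)%N -> depends_on b (window q p) (fun w => bond' N w (p%:Z + y)).
    move=> yq; rewrite /depends_on /bond' /bond.
    have [h|h] := boolP (1 <= p%:Z + y < N%:Z); last exact: measurable_cst.
    apply: measurable_funM; first exact: measurable_cst.
    by apply: depends_on_var; rewrite mem_window; lia.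
  apply: measurable_funD; apply: measurable_funM.
  - by apply: bd; lia.
  - by apply: IH; lia.
  - by apply: bd; lia.
  - by apply: IH; lia.
exact: main.
Qed.

Let Z_bounded q N p : bounded_mfun (Z q N p).
Proof.
split; first exact: (depends_on_mfun mb (@Z_depends q N p)).
by exists ((2 * (M * C)) ^+ q) => w; exact: Z_bound.
Qed.

Let J N w := jacobi_mx sigma (fun k => b k w) N.

Lemma model_eigenvalues N w : all (fun x => `|x| <= 2 * (M * C)) (eigenvalues (J N w)).
Proof. by apply: jacobi_eigenvalue_bound; [exact: mulr_gt0|exact: bond_bound]. Qed.

Let Y q N w := N%:R^-1 * \sum_(1 <= p < N.+1) (Z q N p w - \int[P]_w Z q N p w).

Let fluctuation q : {ae P, forall w, Y q N w @[N --> \oo] --> (0 : R)}.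
Proof.
pose K := 2 * (2 * (M * C)) ^+ q.
(* Windows of radius q with centres more than 2q apart are disjoint, so the fourth moment bound is
   used with m = 2q, and D = 4m + 1. *)
pose D : R := ((q.*2).*2.*2.+1)%:R.
apply: (@as_cvg0 _ _ _ _ _ (3 * K ^+ 4 * D ^+ 2)) => [N||N].
- apply: bounded_mfunZ; apply: bounded_mfun_sum => p.
  by apply: bounded_mfunB; [exact: Z_bounded|exact: bounded_mfun_cst].
- have K0 : 0 <= K by rewrite /K mulr_ge0// exprn_ge0// mulr_ge0// mulr_ge0// ltW.
  by rewrite mulr_ge0 ?sqr_ge0// mulr_ge0// exprn_ge0.
rewrite /Y; under eq_Rintegral do rewrite exprMn.
have bS : bounded_mfun (fun w =>
    (\sum_(1 <= p < N.+2) (Z q N.+1 p w - \int[P]_w Z q N.+1 p w)) ^+ 4).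
  apply: bounded_mfunX; apply: bounded_mfun_sum => p.
  by apply: bounded_mfunB; [exact: Z_bounded|exact: bounded_mfun_cst].
rewrite meanZ//.
pose W p w := Z q N.+1 p w - \int[P]_w Z q N.+1 p w.
have bW p : bounded_mfun (W p) by apply: bounded_mfunB; [exact: Z_bounded|exact: bounded_mfun_cst].
have := @fourth_moment_le R d Om P W N.+1 q.*2 K.
have WK p w : `|W p w| <= K.
  rewrite /W /K mulr2n mulrDl mul1r; apply: le_trans (ler_normB _ _) _.
  by apply: lerD; [exact: Z_bound|apply: mean_norm_le; [exact: Z_bounded|move=> w'; exact: Z_bound]].
move=> /(_ (fun p => (bW p).1) WK) H4.
have {H4} H4 : \int[P]_w ((\sum_(1 <= p < N.+2) W p w) ^+ 4) <= 3 * K ^+ 4 * (N.+1%:R * D) ^+ 2.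
  apply: H4 => p1 p2 p3 p4 _ _ _ _ f2 f3 f4.
  have depW p : depends_on b (window q p) (W p).
    by apply: measurable_funB; [exact: Z_depends|exact: measurable_cst].
  pose I := window q p1; pose J' := undup (window q p2 ++ window q p3 ++ window q p4).
  have uIJ : uniq (I ++ J').
    rewrite cat_uniq undup_uniq andbT filter_uniq ?iota_uniq//=.
    apply/hasPn => k; rewrite mem_undup !mem_cat => kJ; apply/negP => kI.
    have {}kI : k \in window q p1 by exact: kI.
    by move: kJ kI f2 f3 f4; rewrite /near_nat !mem_window; lia.
  have aIJ : all (leq 1) (I ++ J').
    by apply/allP => k; rewrite mem_cat mem_undup !mem_cat !mem_window; lia.
  have dJ : depends_on b J' (fun w => W p2 w * (W p3 w * W p4 w)).
    apply: measurable_funM.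
      by apply: depends_onW (depW p2) => k kI; rewrite mem_undup !mem_cat kI.
    by apply: measurable_funM; [apply: depends_onW (depW p3)|apply: depends_onW (depW p4)];
      move=> k kI; rewrite mem_undup !mem_cat kI ?orbT.
  have bJ : bounded_mfun (fun w => W p2 w * (W p3 w * W p4 w)) by do !apply: bounded_mfunM.
  rewrite (indep_mean mb indep uIJ aIJ (depW p1) dJ (bW p1).2 bJ.2).
  rewrite meanB; [|exact: Z_bounded|exact: bounded_mfun_cst].
  by rewrite mean_cst subrr mul0r.
apply: le_trans (ler_wpM2l _ H4) _; first by rewrite exprn_ge0// invr_ge0.
rewrite le_eqVlt; apply/orP; left; apply/eqP.
have : N.+1%:R != 0 :> R by rewrite pnatr_eq0.
by move: (N.+1%:R : R) => n n0; field.
Qed.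

(** If an edge in use falls outside the matrix, both sides vanish. Otherwise the edges in use carry
    distinct positive indices, and the mean factors by independence. *)
Let mean_bond_prod N p (l : int -> nat) (r : seq int) : uniq r ->
  \int[P]_w (\prod_(i <- r) bond' N w (p%:Z + i) ^+ l i) =
  \prod_(i <- r) sig N (p%:Z + i) ^+ l i * \prod_(i <- r) beta (l i).
Proof.
move=> ur.
have beta0 : beta 0 = 1 by rewrite /beta; under eq_Rintegral do rewrite expr0; rewrite mean_cst.
have bb k : bounded_mfun (b k) by split => //; exists C.
under eq_Rintegral => w _.
  under eq_bigr do rewrite bondE exprMn.
  rewrite big_split /=; over.
rewrite meanZ; last by apply: bounded_mfun_prod => i; exact: bounded_mfunX.
have [/hasP[i ir /andP[li hi]]|/hasPn H] :=
    boolP (has (fun i => (l i != 0%N) && ~~ (1 <= p%:Z + i < N%:Z)) r).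
  rewrite (bigD1_seq i)//= /sig (negbTE hi) expr0n (negbTE li).
  by rewrite !mul0r.
congr (_ * _).
pose a (k : nat) := l (k%:Z - p%:Z).
pose I' := [seq i <- r | l i != 0%N].
pose I := [seq absz (p%:Z + i) | i <- I'].
have I'P i : i \in I' -> 1 <= p%:Z + i.
  by rewrite mem_filter => /andP[li ir]; have := H i ir; rewrite li /=; lia.
transitivity (\int[P]_w (\prod_(k <- I) b k w ^+ a k)).
  apply: eq_Rintegral => w _; rewrite /I big_map big_filter [RHS]big_mkcond /=.
  rewrite big_seq [RHS]big_seq; apply: eq_bigr => i ir.
  case: (eqVneq (l i) 0%N) => [->|li] /=; first by rewrite expr0.
  have := I'P i; rewrite mem_filter li ir => /(_ isT) pi.
  by congr (_ ^+ _); rewrite /a; congr l; lia.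
rewrite (mean_prod_pow mb indep ident _ bC).
- rewrite /I big_map big_filter big_mkcond /=.
  rewrite big_seq [RHS]big_seq; apply: eq_bigr => i ir.
  case: (eqVneq (l i) 0%N) => [->|li] /=; first by rewrite beta0.
  have := I'P i; rewrite mem_filter li ir => /(_ isT) pi.
  by rewrite /beta (_ : a _ = l i)// /a; congr l; lia.
- rewrite map_inj_in_uniq ?filter_uniq// => i j /I'P hi /I'P hj; lia.
- by apply/allP => k /mapP[i /I'P hi ->]; lia.
Qed.

(** Replacing [zext] by [sig] changes the summand only if p + i = N for some [i] in [r]: this
    concerns at most [size r] values of [p], each contributing at most [B]. *)
Let window_cvg (l : int -> nat) (r : seq int) : uniq r -> (forall i, l i <> 0%N -> i \in r) ->
  N%:R^-1 * (\sum_(1 <= p < N.+1) \prod_(i <- r) sig N (p%:Z + i) ^+ l i)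
    @[N --> \oo] --> window_limit sigma l.
Proof.
move=> ur hr; rewrite /window_limit; case: asboolP => [l0|nl0].
  rewrite -(cvg_shiftS (fun N : nat => _ : R)) /=; apply: cvg_near_cst; apply: nearW => N.
  under eq_bigr do (rewrite big1; last by move=> i _; rewrite l0 expr0).
  by rewrite sumr_const_nat subn1 mulVf// pnatr_eq0.
have cw : cvgn (window_avg sigma l).
  apply: wcvg; last by apply: contrapT => /forallNP h; apply: nl0 => i; apply: contrapT; exact: h.
  by apply: (@sub_finite_set _ _ [set` r]) => // i /= /hr.
pose B := \prod_(i <- r) M ^+ l i.
have B0 : 0 <= B by apply: prodr_ge0 => i _; rewrite exprn_ge0// ltW.
have diff N : `|window_avg sigma l N -
    N%:R^-1 * (\sum_(1 <= p < N.+1) \prod_(i <- r) sig N (p%:Z + i) ^+ l i)|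
    <= ((size r)%:R * B) / N%:R.
  rewrite (window_avgE _ _ ur hr) -mulrBr -sumrB normrM ger0_norm ?invr_ge0//.
  rewrite [leRHS]mulrC ler_wpM2l ?invr_ge0//; apply: le_trans (ler_norm_sum _ _ _) _.
  apply: le_trans (_ : \sum_(1 <= p < N.+1) \sum_(i <- r) (if p%:Z + i == N%:Z then B else 0) <= _).
    apply: ler_sum => p _.
    have [/hasP[i ir /andP[li /eqP pi]]|/hasPn H] :=
        boolP (has (fun i => (l i != 0%N) && (p%:Z + i == N%:Z)) r).
      have -> : \prod_(i <- r) sig N (p%:Z + i) ^+ l i = 0.
        by rewrite (bigD1_seq i)//= pi /sig ltxx andbF expr0n (negbTE li) mul0r.
      rewrite subr0 [leRHS](bigD1_seq i)//= pi eqxx; apply: ler_wpDr.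
        by apply: sumr_ge0 => j _; case: ifP.
      exact: prod_norm_le.
    rewrite (_ : \prod_(i <- r) sig N (p%:Z + i) ^+ l i = \prod_(i <- r) zext sigma N (p%:Z + i) ^+ l i).
      by rewrite subrr normr0; apply: sumr_ge0 => j _; case: ifP.
    rewrite big_seq [RHS]big_seq; apply: eq_bigr => i /H.
    case: (eqVneq (l i) 0%N) => [->|li] /=; first by rewrite !expr0.
    move=> pi; congr (_ ^+ _); rewrite /sig /zext.
    by rewrite (_ : (1 <= p%:Z + i < N%:Z) = (1 <= p%:Z + i <= N%:Z))//; lia.
  rewrite exchange_big /=.
  apply: le_trans (_ : \sum_(i <- r) B <= _); last first.
    by rewrite big_const_seq count_predT iter_addr addr0 mulr_natl.
  apply: ler_sum => i _; rewrite -big_mkcond /=.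
  rewrite big_const_seq iter_addr addr0 -[leRHS]mulr1n.
  have cnt : (count (fun p : nat => (p%:Z + i == N%:Z)%R) (index_iota 1 N.+1) <= 1)%N.
    apply: (@leq_trans (count (pred1 (absz (N%:Z - i))) (index_iota 1 N.+1))).
      by apply: sub_count => p /= /eqP pi; apply/eqP; lia.
    by rewrite count_uniq_mem ?iota_uniq// leq_b1.
  by rewrite -subr_ge0 -mulrnBr// mulrn_wge0.
have -> : (fun N : nat => N%:R^-1 * (\sum_(1 <= p < N.+1) \prod_(i <- r) sig N (p%:Z + i) ^+ l i)) =
  (fun N => window_avg sigma l N - (window_avg sigma l N -
    N%:R^-1 * (\sum_(1 <= p < N.+1) \prod_(i <- r) sig N (p%:Z + i) ^+ l i))).
  by apply/funext => N; rewrite opprB addrC subrK.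
rewrite -[X in _ --> X]subr0; apply: cvgB; first exact: cw.
apply/norm_cvg0P; apply: (@squeeze_cvgr _ _ _ _ (fun=> 0) (fun N : nat => ((size r)%:R * B) / N%:R)).
- by apply: nearW => N; rewrite normr_ge0 diff.
- exact: cvg_cst.
- exact: cvg_harmonicZ.
Qed.

Definition limit_moment q : R := \sum_(g <- walks q 0)
  window_limit sigma (crossings g) * \prod_(i <- irange q) \int[P]_w (b 1%N w ^+ crossings g i).

Let mean_cvg q : N%:R^-1 * (\sum_(1 <= p < N.+1) \int[P]_w Z q N p w) @[N --> \oo]
  --> limit_moment q.
Proof.
have E N p : \int[P]_w Z q N p w = \sum_(g <- walks q 0)
    \prod_(i <- irange q) sig N (p%:Z + i) ^+ crossings g i *
    \prod_(i <- irange q) beta (crossings g i).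
  rewrite /Z; under eq_Rintegral => w _.
    rewrite (@trans_weightE _ _ _ (irange q)); last 2 first.
    - exact: irange_uniq.
    - by move=> i hi; rewrite -mem_irange; lia.
    over.
  rewrite mean_sum.
    by apply: eq_bigr => g _; rewrite mean_bond_prod//; exact: irange_uniq.
  move=> g; apply: bounded_mfun_prod => i; apply: bounded_mfunX; split.
    rewrite (_ : (fun w => _) = (fun w => sig N (p%:Z + i) * b (absz (p%:Z + i)) w)).
      by apply: measurable_funM => //; exact: measurable_cst.
    by apply/funext => w; rewrite bondE.
  by exists (M * C) => w; exact: bond_bound.
(* [cvg_sum_seq] asks for convergence at every index, so the summand is set to 0 for tuples that are
   not walks, whose crossings need not lie in [irange q]. *)
have -> : (fun N : nat => N%:R^-1 * (\sum_(1 <= p < N.+1) \int[P]_w Z q N p w)) =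
  (fun N : nat => \sum_(g <- walks q 0) (if g \in walks q 0 then
     N%:R^-1 * (\sum_(1 <= p < N.+1) \prod_(i <- irange q) sig N (p%:Z + i) ^+ crossings g i) *
     \prod_(i <- irange q) beta (crossings g i) else 0)).
  apply/funext => N; under eq_bigr do rewrite E.
  rewrite exchange_big /= mulr_sumr big_seq [RHS]big_seq; apply: eq_bigr => g ->.
  by rewrite -mulr_suml mulrA.
have -> : limit_moment q = \sum_(g <- walks q 0) (if g \in walks q 0 then
   window_limit sigma (crossings g) * \prod_(i <- irange q) beta (crossings g i) else 0).
  by rewrite /limit_moment big_seq [RHS]big_seq; apply: eq_bigr => g ->.
apply: cvg_sum_seq => g; case: ifPn => [gw|_]; last exact: cvg_cst.
apply: cvgM; last exact: cvg_cst.
apply: window_cvg; first exact: irange_uniq.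
by move=> i /(crossings_range gw); rewrite -mem_irange; lia.
Qed.

Lemma model_moments_as q : {ae P, forall w,
  avg (eigenvalues (J N w)) (fun x => x ^+ q) @[N --> \oo] --> limit_moment q}.
Proof.
apply: filterS (fluctuation q) => w hw.
have -> : (fun N => avg (eigenvalues (J N w)) (fun x => x ^+ q)) =
  (fun N : nat => Y q N w + N%:R^-1 * (\sum_(1 <= p < N.+1) \int[P]_w Z q N p w)).
  by apply/funext => N; rewrite /J avg_jacobi /Y -mulrDr sumrB subrK.
by rewrite -[limit_moment q]add0r; apply: cvgD; [exact: hw|exact: mean_cvg].
Qed.

Lemma limit_moment0 : limit_moment 0 = 1.
Proof.
rewrite /limit_moment /= big_seq1 /window_limit asboolT//.
rewrite big1 ?mulr1// => i _; under eq_Rintegral do rewrite expr0.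
by rewrite mean_cst.
Qed.

Lemma model_limit : exists mu : probability R R,
  [/\ supported_in mu (2 * (M * C) + 1),
      forall q, \int[mu]_x (clamp (2 * (M * C) + 1) x ^+ q) = limit_moment q &
      {ae P, forall w, weak_cvg (fun N => esd (J N w)) mu}].
Proof.
set K := 2 * (M * C); have K0 : 0 < K by rewrite /K !mulr_gt0.
have hall : {ae P, forall w, forall q,
    avg (eigenvalues (J N w)) (fun x => x ^+ q) @[N --> \oo] --> limit_moment q}.
  by apply: ae_foralln => q; exact: model_moments_as.
(* The limits of the moments do not depend on the sample, so the measure built at one good point
   serves for almost all of them. *)
have [w0 hw0] := ae_exists hall.
have [mu [smu mmu]] := @avg_limit_probability _ K (fun N => eigenvalues (J N w0)) K0
  (fun N => model_eigenvalues N w0) limit_moment limit_moment0 hw0.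
exists mu; split => //; apply: filterS hall => w hw f cf bf.
have K1 : 0 < K + 1 by rewrite addr_gt0.
have sK N : all (fun x => `|x| <= K + 1) (eigenvalues (J N w)).
  apply: sub_all (model_eigenvalues N w) => x /= h; apply: le_trans h _.
  by rewrite lerDl.
rewrite (supported_integralE (ltW K1) smu cf).
have E N : (\int[esd (J N w)]_x (f x)%:E)%E = (avg (eigenvalues (J N w)) f)%:E.
  by apply: empirical_integral; exact: continuous_measurable_fun.
under eq_fun do rewrite E.
apply/cvg_EFin; first exact: nearW.
apply: (avg_moments_cvg K1 sK) => // q; rewrite mmu; exact: hw.
Qed.

End model.

(** * The expected spectral distribution *)

Section half_line_polynomials.
Context (R : realType).

(** The n-th polynomial follows a ramp of width 1/(n+1) on [-(n+1), n+1]; every fixed point ends up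
    in that interval and outside the sloping part. Half-line indicators are thus pointwise limits of
    functions whose spectral averages are measurable. *)
Lemma half_line_poly (r : R) : exists p : nat -> {poly R}, forall x,
  (p n).[x] @[n --> \oo] --> ((x <= r)%R%:R : R).
Proof.
have H (n : nat) : exists p : {poly R}, forall x, `|x| <= n.+1%:R ->
    `|ramp r (r + n.+1%:R^-1) x - p.[x]| <= n.+1%:R^-1.
  by apply: weierstrass => //; exact: ramp_continuous.
have [p hp] := choice H; exists p => x.
apply/cvgrPdist_le => e e0.
have c0 : (n.+1%:R : R)^-1 @[n --> \oo] --> (0 : R) by exact: cvg_harmonic.
have near_r : \forall n \near \oo, ramp r (r + n.+1%:R^-1) x = (x <= r)%R%:R.
  have [xr|rx] := leP x r.
    by apply: nearW => n; rewrite ramp_left// ltrDl invr_gt0.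
  have rx0 : 0 < x - r by rewrite subr_gt0.
  move/cvgrPdist_le: (c0) => /(_ _ rx0); apply: filterS => n.
  rewrite sub0r normrN ger0_norm ?invr_ge0// => h.
  have h1 : r < r + n.+1%:R^-1 by rewrite ltrDl invr_gt0.
  have h2 : r + n.+1%:R^-1 <= x by rewrite -lerBrDl.
  by rewrite ramp_right.
near=> n.
have <- : ramp r (r + n.+1%:R^-1) x = (x <= r)%R%:R by near: n.
apply: le_trans (hp n x _) _.
  apply: le_trans (_ : n%:R <= _); last by rewrite ler_nat.
  by near: n; exact: nbhs_infty_ger.
have : `|0 - (n.+1%:R : R)^-1| <= e by near: n; move/cvgrPdist_le: c0; apply.
by rewrite sub0r normrN ger0_norm ?invr_ge0.
Unshelve. all: by end_near. Qed.

End half_line_polynomials.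

(** * Measurability of the random spectral distribution, and its mean *)

Section random_esd.
Context (R : realType) (d : measure_display) (Om : measurableType d)
  (P : probability Om R) (b : nat -> Om -> R) (sigma : nat -> nat -> R) (N : nat).
Hypothesis mb : forall k, measurable_fun setT (b k).

Let J w := jacobi_mx sigma (fun k => b k w) N.

Let measurable_moment q :
  measurable_fun setT (fun w => avg (eigenvalues (J w)) (fun x => x ^+ q)).
Proof.
under eq_fun do rewrite avg_jacobi.
apply: measurable_funM; first exact: measurable_cst.
have mt (p : nat) q' x : measurable_fun setT (fun w =>
    trans_weight (fun k => bond sigma (fun k => b k w) N (p%:Z + k)) q' x).
  elim: q' x => [|q' IH] x /=; first exact: measurable_cst.
  have bd y : measurable_fun setT (fun w => bond sigma (fun k => b k w) N (p%:Z + y)).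
    rewrite /bond; have [h|h] := boolP (1 <= p%:Z + y < N%:Z); last exact: measurable_cst.
    by apply: measurable_funM => //; exact: measurable_cst.
  by apply: measurable_funD; apply: measurable_funM.
exact: measurable_sum.
Qed.

Let measurable_avg_poly (p : {poly R}) :
  measurable_fun setT (fun w => avg (eigenvalues (J w)) (fun x => p.[x])).
Proof.
under eq_fun do rewrite avg_poly.
apply: measurable_sum => i; apply: measurable_funM => //; exact: measurable_cst.
Qed.

Let measurable_half (r : R) : measurable_fun setT (fun w => esd (J w) `]-oo, r]%classic).
Proof.
have E w : esd (J w) `]-oo, r]%classic = (avg (eigenvalues (J w)) (fun x => (x <= r)%R%:R))%:E.
  rewrite /esd /= /empirical_measure /avg EFinM -sumEFin; congr (_ * _)%E.
  by apply: eq_bigr => x _; rewrite diracE mem_setE in_itv.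
under eq_fun do rewrite E; apply/measurable_EFinP.
have [p hp] := half_line_poly r.
apply: (@measurable_fun_cvg _ _ _ _ (fun n w => avg (eigenvalues (J w)) (fun x => (p n).[x]))) => //.
move=> w _; rewrite /avg; apply: cvgM; first exact: cvg_cst.
exact: cvg_sum_seq.
Qed.

Lemma esd_le1 w : (esd (J w) setT <= 1)%E.
Proof.
rewrite /esd /= /empirical_measure.
under eq_bigr do rewrite diracT.
rewrite sumEFin -EFinM lee_fin.
exact: (@avg_cst_le R R (eigenvalues (J w)) 1 ler01).
Qed.

Lemma esd_fin_num w U : measurable U -> esd (J w) U \is a fin_num.
Proof.
move=> mU; rewrite ge0_fin_numE//; apply: le_lt_trans (_ : 1 < +oo)%E; last exact: ltry.
by apply: le_trans (esd_le1 w); apply: le_measure; rewrite ?inE.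
Qed.

(** Half-lines are reached by polynomials, half-open intervals by difference, and Borel sets by
    Dynkin induction, where finiteness of the measures permits complements. *)
Lemma measurable_esd U : measurable U -> measurable_fun setT (fun w => esd (J w) U).
Proof.
move=> mU.
have mT : measurable_fun setT (fun w => esd (J w) setT).
  have E w : esd (J w) setT = (avg (eigenvalues (J w)) (fun x => x ^+ 0))%:E.
    rewrite /esd /= /empirical_measure /avg EFinM -sumEFin; congr (_ * _)%E.
    by apply: eq_bigr => x _; rewrite diracT expr0.
  by under eq_fun do rewrite E; apply/measurable_EFinP; exact: measurable_moment.
apply: (@dynkin_induction _ R (@ocitv R)
  [set U | measurable_fun setT (fun w => esd (J w) U)]) => //.
- exact: ocitvI.
- move=> _ [[a c] _ <-] /=.
  have [ac|ca] := leP a c; last first.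
    rewrite set_itv_ge; last by rewrite bnd_simp -leNgt ltW.
    by under eq_fun do rewrite measure0; exact: measurable_cst.
  have -> : `]a, c]%classic = `]-oo, c] `\` `]-oo, a].
    by rewrite -[RHS]setCK setCD setCitvl setUC -[LHS]setCK setCitv.
  have sub : `]-oo, a] `<=` `]-oo, c] by apply: subset_itvl; rewrite bnd_simp.
  have E w : esd (J w) (`]-oo, c] `\` `]-oo, a]) =
      (esd (J w) `]-oo, c]%classic - esd (J w) `]-oo, a]%classic)%E.
    rewrite measureD ?setIidr//; rewrite -ge0_fin_numE//; exact: esd_fin_num.
  by under eq_fun do rewrite E; exact: emeasurable_funB.
- move=> S mS /= hS.
  have E w : esd (J w) (~` S) = (esd (J w) setT - esd (J w) S)%E.
    rewrite -setTD measureD ?setTI//; rewrite -ge0_fin_numE//; exact: esd_fin_num.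
  by under eq_fun do rewrite E; exact: emeasurable_funB.
- move=> F mF tF hF /=.
  have E w : esd (J w) (\bigcup_k F k) = (\sum_(0 <= k <oo) esd (J w) (F k))%E.
    by rewrite measure_bigcup//=; apply: eq_eseriesl => k; rewrite in_setT.
  by under eq_fun do rewrite E; apply: ge0_emeasurable_sum => [k w _ _|k _]; [exact: measure_ge0|exact: hF].
Qed.

(** The expected distribution is the composition of [P], viewed as a kernel from [unit], with this
    kernel. Kernel composition then supplies the measure structure and the iterated integral; the
    component in [unit] is there to fit its format. *)
Let ker (x : unit * Om) : {measure set R -> \bar R} := esd (J x.2).

Let ker_measurable U : measurable U -> measurable_fun setT (ker ^~ U).
Proof.
by move=> mU; exact: (measurableT_comp (measurable_esd mU) measurable_snd).
Qed.

#[local] HB.instance Definition _ := isKernel.Build _ _ _ _ R ker ker_measurable.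

Let ker_uub : measure_fam_uub ker.
Proof.
exists 2 => x; apply: le_lt_trans (esd_le1 x.2) _.
by rewrite lte_fin ltr1n.
Qed.

#[local] HB.instance Definition _ := Kernel_isFinite.Build _ _ _ _ R ker ker_uub.

Let Pker (x : unit) : {measure set Om -> \bar R} := P.

Let Pker_measurable U : measurable U -> measurable_fun setT (Pker ^~ U).
Proof. by move=> mU; exact: measurable_cst. Qed.

#[local] HB.instance Definition _ := isKernel.Build _ _ _ _ R Pker Pker_measurable.

Let Pker_uub : measure_fam_uub Pker.
Proof.
exists 2 => x; apply: le_lt_trans (_ : 1 < 2%:E)%E; last by rewrite lte_fin ltr1n.
exact: probability_le1.
Qed.

#[local] HB.instance Definition _ := Kernel_isFinite.Build _ _ _ _ R Pker Pker_uub.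

Lemma measurable_avg (f : R -> R) : measurable_fun setT f -> (forall x, 0 <= f x) ->
  measurable_fun setT (fun w => avg (eigenvalues (J w)) f).
Proof.
move=> mf f0.
have mk : measurable_fun setT (fun x : unit * Om => \int[ker x]_y (f y)%:E)%E.
  have k0 (z : (unit * Om) * R) : (0 <= (f z.2)%:E)%E by rewrite lee_fin.
  have mfz : measurable_fun setT (fun z : (unit * Om) * R => (f z.2)%:E).
    by apply/measurable_EFinP; exact: measurableT_comp.
  exact: (@measurable_fun_integral_sfinite_kernel _ _ _ _ _ _ ker k0 mfz).
apply/measurable_EFinP.
rewrite (_ : _ \o _ = (fun x : unit * Om => \int[ker x]_y (f y)%:E)%E \o pair tt).
  by apply: measurableT_comp => //; exact: measurable_pair1.
by apply/funext => w /=; apply/esym; exact: empirical_integral.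
Qed.

Lemma expected_esd_integral_ge0 (f : R -> R) : measurable_fun setT f -> (forall x, 0 <= f x) ->
  (\int[expected_esd P J]_x (f x)%:E = \int[P]_w (avg (eigenvalues (J w)) f)%:E)%E.
Proof.
move=> mf f0; have -> : expected_esd P J = kcomp Pker ker tt by [].
have f0' x : (0 <= (f x)%:E)%E by rewrite lee_fin.
have mf' : measurable_fun setT (EFin \o f) by exact/measurable_EFinP.
rewrite (integral_kcomp _ _ _ f0' mf').
by apply: eq_integral => w _; exact: empirical_integral.
Qed.

Lemma avg_bound (s : seq R) (f : R -> R) (M : R) : 0 <= M -> (forall x, `|f x| <= M) ->
  `|avg s f| <= M.
Proof.
move=> M0 fM; apply: le_trans (avg_cst_le s M0); rewrite /avg normrM ger0_norm ?invr_ge0//.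
rewrite ler_wpM2l ?invr_ge0//; apply: le_trans (ler_norm_sum _ _ _) _.
by apply: ler_sum => x _.
Qed.

Lemma expected_esd_integral (f : R -> R) (M : R) : 0 <= M -> measurable_fun setT f ->
  (forall x, `|f x| <= M) ->
  bounded_mfun (fun w => avg (eigenvalues (J w)) f) /\
  (\int[expected_esd P J]_x (f x)%:E = (\int[P]_w avg (eigenvalues (J w)) f)%:E)%E.
Proof.
move=> M0 mf fM.
pose fp x := Num.max (f x) 0; pose fn x := Num.max (- f x) 0.
have mp : measurable_fun setT fp by exact: measurable_maxr.
have mn : measurable_fun setT fn by apply: measurable_maxr => //; exact: measurableT_comp.
have p0 x : 0 <= fp x by rewrite le_max lexx orbT.
have n0 x : 0 <= fn x by rewrite le_max lexx orbT.
have pM x : `|fp x| <= M.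
  by rewrite ger0_norm// ge_max M0 andbT; have := fM x; rewrite ler_norml => /andP[].
have nM x : `|fn x| <= M.
  by rewrite ger0_norm// ge_max M0 andbT lerNl; have := fM x; rewrite ler_norml => /andP[].
have bp : bounded_mfun (fun w => avg (eigenvalues (J w)) fp).
  by split; [exact: measurable_avg | exists M => w; exact: avg_bound].
have bn : bounded_mfun (fun w => avg (eigenvalues (J w)) fn).
  by split; [exact: measurable_avg | exists M => w; exact: avg_bound].
have E : (fun w => avg (eigenvalues (J w)) f) =
    (fun w => avg (eigenvalues (J w)) fp - avg (eigenvalues (J w)) fn).
  apply/funext => w; rewrite /avg -mulrBr -sumrB; congr (_ * _).
  by apply: eq_bigr => x _; rewrite /fp /fn; case: (leP (f x) 0) => h; case: (leP (- f x) 0); lra.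
split; first by rewrite E; exact: bounded_mfunB.
rewrite E meanB// EFinB -!bounded_mfun_integralE// -!expected_esd_integral_ge0//.
rewrite (_ : expected_esd P J = kcomp Pker ker tt)// integralE.
congr (_ - _)%E; apply: eq_integral => x _.
  by rewrite funeposE /= EFin_max.
by rewrite funenegE /= EFin_max.
Qed.

End random_esd.

(** Integrals against the expected distribution are means of spectral averages, all bounded by the
    bound of the test function, so almost sure convergence passes to means by domination. *)
Lemma expected_weak_cvg (R : realType) (d : measure_display) (Om : measurableType d)
    (P : probability Om R) (b : nat -> Om -> R) (sigma : nat -> nat -> R)
    (mu : probability R R) : (forall k, measurable_fun setT (b k)) ->
  {ae P, forall w, weak_cvg (fun N => esd (jacobi_mx sigma (fun k => b k w) N)) mu} ->
  weak_cvg (fun N => expected_esd P (fun w => jacobi_mx sigma (fun k => b k w) N)) mu.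
Proof.
move=> mb H f cf [M hM]; have mf := continuous_measurable_fun cf.
have M0 : 0 <= M by exact: le_trans (hM 0).
have bf : bounded_mfun f by split => //; exists M.
pose a N w := avg (eigenvalues (jacobi_mx sigma (fun k => b k w) N)) f.
have hN N := expected_esd_integral P sigma N mb M0 mf hM.
rewrite bounded_mfun_integralE//.
have E N : (\int[expected_esd P (fun w => jacobi_mx sigma (fun k => b k w) N)]_x (f x)%:E =
    \int[P]_w (a N w)%:E)%E.
  by rewrite (hN N).2 bounded_mfun_integralE//; exact: (hN N).1.
under eq_fun do rewrite E.
have E2 : (\int[mu]_x f x)%:E = (\int[P]_w (\int[mu]_x f x)%:E)%E.
  by rewrite bounded_mfun_integralE ?mean_cst//; exact: bounded_mfun_cst.
rewrite E2.
have mfN N : measurable_fun setT (fun w => (a N w)%:E).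
  by apply/measurable_EFinP; case: (hN N).1.
have cvN : {ae P, forall w, setT w -> (a N w)%:E @[N --> \oo] --> (\int[mu]_x f x)%:E}.
  apply: filterS H => w hw _; have := hw f cf (ex_intro _ M hM).
  rewrite bounded_mfun_integralE//.
  have E' N : (\int[esd (jacobi_mx sigma (fun k => b k w) N)]_x (f x)%:E)%E = (a N w)%:E.
    exact: empirical_integral.
  by under eq_fun do rewrite E'.
have dom : {ae P, forall w N, setT w -> (`|(a N w)%:E| <= M%:E)%E}.
  by apply: aeW => w N _; rewrite lee_fin; exact: avg_bound.
have iM := bounded_mfun_integrable P (bounded_mfun_cst _ M).
have [_ _ h] := @dominated_convergence _ _ _ P setT measurableT _ _ _ mfN
  (measurable_cst _) cvN iM dom.
exact: h.
Qed.

(** * Window averages from joint moments *)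

Section star_moments.
Local Open Scope complex_scope.
Local Open Scope sesquilinear_scope.

(** Each entry is, in absolute value, the length of the image of a basis vector. A bound at least 1
    is chosen so that its powers increase with the exponent. *)
Lemma profile_bound (R : realType) (sigma : nat -> nat -> R) :
  (ereal_sup [set opnorm (profile_mx sigma N) | N in [set N | (1 <= N)%N]] < +oo)%E ->
  exists2 M : R, 1 <= M & forall N k, (1 <= k <= N)%N -> `|sigma N k| <= M.
Proof.
set S := ereal_sup _ => Soo; exists (Num.max 1 (fine S)); first by rewrite le_max lexx.
move=> N k /andP[k1 kN].
have SN : (`|sigma N k|%:E <= S)%E.
  apply: (@le_trans _ _ (opnorm (profile_mx sigma N))); last first.
    by apply: ereal_sup_ubound; exists N => //=; exact: leq_trans kN.
  have kN' : (k.-1 < N)%N by case: (k) k1 kN.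
  pose i := Ordinal kN'; apply: ereal_sup_ubound.
  have l2 (c : R) (v : 'cV[R[i]]_N) : v i 0 = c%:C ->
      (forall j, j != i -> v j 0 = 0) -> l2norm v = `|c|.
    move=> vi vj; rewrite /l2norm (bigD1 i)//= big1 ?addr0; last first.
      by move=> j ji; rewrite vj// Normc.normc0 expr0n.
    rewrite vi /Normc.normc /= [in X in _ + X]expr0n addr0 sqrtr_sqr real_normK ?num_real//.
    by rewrite sqrtr_sqr.
  exists (delta_mx i 0) => /=.
    rewrite (l2 1) ?normr1//; first by rewrite mxE !eqxx.
    by move=> j ji; rewrite mxE (negbTE ji).
  congr EFin; rewrite /profile_mx (l2 (sigma N k)) //.
    by rewrite mul_diag_mx !mxE !eqxx mulr1 /= prednK.
  by move=> j ji; rewrite mul_diag_mx !mxE (negbTE ji) mulr0.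
rewrite le_max; apply/orP; right; rewrite -lee_fin fineK//.
by rewrite fin_numElt Soo andbT (lt_le_trans _ SN)// ltNyr.
Qed.

Section words.
Context (R : realType) (sigma : nat -> nat -> R) (N : nat).

(* [0], [1] and [2] stand for [D_N], [S_N] and its adjoint; [x] and [y] are the
   row and the column, numbered from 1. *)
Fixpoint word_entry (w : seq 'I_3) (x y : int) : R :=
  if 1 <= x <= N%:Z then
    match w with
    | [::] => (x == y)%:R
    | a :: w' => if a == 0 :> nat then zext sigma N x * word_entry w' x y
                 else if a == 1 :> nat then word_entry w' (x - 1) y
                 else word_entry w' (x + 1) y
    end
  else 0.

Lemma word_entry_out w x y : ~~ (1 <= x <= N%:Z) -> word_entry w x y = 0.
Proof. by case: w => [|a w] /negbTE /= ->. Qed.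

Let X := tnth [tuple profile_mx sigma N; shift_mx R N; (shift_mx R N)^t*].

Lemma word_prodE (w : seq 'I_3) (i j : 'I_N) :
  (\prod_(a <- w) X a) i j = (word_entry w i.+1%:Z j.+1%:Z)%:C.
Proof.
have rng (k : 'I_N) : 1 <= k.+1%:Z <= N%:Z by have := ltn_ord k; lia.
elim: w i j => [|a w IH] i j; rewrite /word_entry -/word_entry rng.
  by rewrite big_nil mxE -val_eqE /= eqz_nat eqSS rmorph_nat.
rewrite big_cons; set Y := \prod_(a <- w) X a in IH *.
have -> : (X a * Y) i j = \sum_k X a i k * Y k j by rewrite mxE.
have -> : X a = if a == 0 :> nat then profile_mx sigma N
    else if a == 1 :> nat then shift_mx R N else (shift_mx R N)^t*.
  rewrite /X (tnth_nth 0) /=; case: a => -[|[|[|a]]] //=.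
case: ifP => _.
  rewrite (bigD1 i)//= big1 ?addr0; last first.
    by move=> k ki; rewrite !mxE eq_sym (negbTE ki) mul0r.
  by rewrite IH !mxE eqxx mulr1n -rmorphM /= /zext rng.
case: ifP => _.
  (* The first row has no predecessor: the inner test discards the index 0 that the truncated [i.-1]
     would select. *)
  transitivity (\sum_(k < N) (if k == i.-1 :> nat then
     (if (0 < i)%N then (word_entry w k.+1%:Z j.+1%:Z)%:C else 0) else 0)).
    apply: eq_bigr => k _; rewrite IH !mxE; case: (posnP i) => i0.
      by rewrite i0 mul0r; case: ifP.
    rewrite (_ : (i == k.+1 :> nat) = (k == i.-1 :> nat)); last by lia.
    by case: ifP => _; rewrite ?mul1r ?mul0r.
  rewrite (sum_ord_eq i.-1 N (fun k => if (0 < i)%N then (word_entry w k.+1%:Z j.+1%:Z)%:C else 0)).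
  rewrite ifT; last by have := ltn_ord i; lia.
  case: ifP => i0; first by congr (word_entry _ _ _)%:C; lia.
  by rewrite word_entry_out ?rmorph0//; lia.
transitivity (\sum_(k < N) (if k == i.+1 :> nat then (word_entry w k.+1%:Z j.+1%:Z)%:C else 0)).
  apply: eq_bigr => k _; rewrite IH !mxE.
  by case: ifP => _; rewrite ?conjC1 ?conjC0 ?mul1r ?mul0r.
rewrite (sum_ord_eq i.+1 N (fun k => (word_entry w k.+1%:Z j.+1%:Z)%:C)).
case: ifP => iN; first by congr (word_entry _ _ _)%:C; lia.
by rewrite word_entry_out ?rmorph0//; lia.
Qed.

Lemma ntr_word (w : seq 'I_3) : ntr (\prod_(a <- w) X a) =
  (N%:R^-1 * \sum_(1 <= p < N.+1) word_entry w p%:Z p%:Z)%:C.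
Proof.
rewrite /ntr rmorphM fmorphV rmorph_nat; congr (_ * _).
rewrite /mxtrace big_add1 /= big_mkord rmorph_sum /=.
by apply: eq_bigr => i _; rewrite word_prodE.
Qed.

Lemma word_entry_pow n w x y : 1 <= x <= N%:Z ->
  word_entry (nseq n ord0 ++ w) x y = zext sigma N x ^+ n * word_entry w x y.
Proof.
move=> hx; elim: n => [|n IH]; first by rewrite expr0 mul1r.
by rewrite /= hx /= IH exprS mulrA.
Qed.

Lemma word_entry_down n w (x y : int) : 1 <= x <= N%:Z ->
  word_entry (nseq n ord_max ++ w) x y =
  if x + n%:Z <= N%:Z then word_entry w (x + n%:Z) y else 0.
Proof.
elim: n x => [|n IH] x hx.
  by rewrite /= addr0 ifT//; case/andP: hx.
rewrite /= hx /=; case: (boolP (1 <= x + 1 <= N%:Z)) => h.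
  by rewrite IH// (_ : x + 1 + n%:Z = x + n.+1%:Z)//; lia.
by rewrite word_entry_out// ifF//; lia.
Qed.

Variables (l : int -> nat) (a : nat).

(** The word D^(l j) S D^(l (j - 1)) S ... S D^(l (j - n)) followed by [a] adjoint shifts. Followed
    along the rows from p + j, it descends site by site to p + j - n, collecting the required power
    of the profile at each, then climbs [a] steps. *)
Fixpoint sweep (n : nat) (j : int) : seq 'I_3 :=
  nseq (l j) ord0 ++
  (if n is m.+1 then (inord 1 : 'I_3) :: sweep m (j - 1) else nseq a ord_max).

(** As j - n = -a, the descent ends at p - a and the climb closes the path at p. The truncation
    kills the entry as soon as the descent passes below 1. *)
Lemma word_entry_sweep n (j p : int) : 1 <= p <= N%:Z -> 1 <= p + j <= N%:Z ->
  j - n%:Z = - a%:Z ->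
  word_entry (sweep n j) (p + j) p =
  if 1 <= p - a%:Z then \prod_(k < n.+1) zext sigma N (p + j - k%:Z) ^+ l (j - k%:Z) else 0.
Proof.
move=> hp; elim: n j => [|n IH] j hj jn.
  rewrite big_ord1 !subr0 /= word_entry_pow//.
  have -> : nseq a ord_max = nseq a (ord_max : 'I_3) ++ [::] by rewrite cats0.
  rewrite word_entry_down// (_ : p + j + a%:Z = p); last by lia.
  have [hp1 hp2] := andP hp; rewrite hp2 ifT; last by lia.
  by rewrite /= hp eqxx mulr1.
rewrite /= word_entry_pow// /= hj inordK//= big_ord_recl /= !subr0.
case: (boolP (1 <= p + (j - 1) <= N%:Z)) => h.
  rewrite -addrA IH//; last by lia.
  case: ifP => _; last by rewrite mulr0.
  congr (_ * _); apply: eq_bigr => k _; rewrite /bump /= add1n.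
  by congr (zext _ _ _ ^+ l _); lia.
rewrite word_entry_out; last by lia.
by rewrite mulr0 ifF//; lia.
Qed.

End words.

Lemma nceval_word (R : realType) (k n : nat) (X : 'I_k -> 'M[R[i]]_n) (w : seq 'I_k) :
  nceval X (monalg.mkmalgU (monalg.FMonom w) 1 : ncpoly R k) = \prod_(a <- w) X a.
Proof.
rewrite /nceval monalg.msuppU oner_eq0 finmap.big_seq_fset1.
by rewrite monalg.mcoeffUU scale1r.
Qed.

(** The distance from a real number to the real part of the limit is at most its distance to the
    limit. *)
Lemma cvgn_complex_re (R : realType) (u : nat -> R) :
  cvgn (fun n => (u n)%:C : R[i]^o) -> cvgn u.
Proof.
move=> /cvg_ex[/= z hz]; apply/cvg_ex; exists (complex.Re z).
apply/cvgrPdist_le => e e0.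
have e0' : 0 < e%:C by rewrite ltcR.
move/cvgrPdist_le: hz => /(_ _ e0'); apply: filterS => n.
case: z => x y; rewrite /= normc_def /= lecR subr0.
apply: le_trans; rewrite -[leLHS]sqrtr_sqr.
by apply: ler_wsqrtr; rewrite lerDl sqr_ge0.
Qed.

(** The word climbs from p to p + hi, sweeps down to p + lo and climbs back to p; its diagonal entry
    at p is the window product. *)
Lemma window_avg_cvg (R : realType) (sigma : nat -> nat -> R) : star_moments_cvg sigma ->
  forall l : int -> nat, finite_set [set i | l i <> 0%N] ->
    (exists i, l i <> 0%N) -> cvgn (window_avg sigma l).
Proof.
move=> H l fl _; have [r ur hr] := finite_support_seq fl.
pose lo := foldr Num.min 0 r; pose hi := foldr Num.max 0 r.
have lo0 : lo <= 0 by rewrite /lo; elim: (r) => //= x s IH; lia.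
have hi0 : 0 <= hi by rewrite /hi; elim: (r) => //= x s IH; lia.
have lor i : i \in r -> lo <= i.
  by rewrite /lo; elim: (r) => //= x s IH; rewrite inE => /orP[/eqP->|/IH]; lia.
have hir i : i \in r -> i <= hi.
  by rewrite /hi; elim: (r) => //= x s IH; rewrite inE => /orP[/eqP->|/IH]; lia.
(* An extreme point is either 0 or in the support, so the truncation of the shifts kills only those
   [p] that the window average excludes as well. *)
have loc : lo = 0 \/ lo \in r.
  rewrite /lo; elim: (r) => [|x s IH] /=; first by left.
  rewrite inE; case: leP => hx; last by case: IH => ->; auto; rewrite orbT; right.
  by right; rewrite eqxx.
have hic : hi = 0 \/ hi \in r.
  rewrite /hi; elim: (r) => [|x s IH] /=; first by left.
  rewrite inE; case: leP => hx; first by case: IH => ->; auto; rewrite orbT; right.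
  by right; rewrite eqxx.
pose a := absz lo; pose h := absz hi.
pose w := nseq h (ord_max : 'I_3) ++ sweep l a (h + a) hi.
have E N : window_avg sigma l N =
    N%:R^-1 * \sum_(1 <= p < N.+1) word_entry sigma N w p%:Z p%:Z.
  (* The support is enlarged to the whole interval from [hi] down to [lo], in the order of the
     sweep; the sites added have exponent 0. *)
  pose r' := [seq hi - k%:Z | k <- iota 0 (h + a).+1].
  have ur' : uniq r' by rewrite map_inj_uniq ?iota_uniq// => x y; lia.
  have hr' i : l i <> 0%N -> i \in r'.
    move=> /hr ir; have := lor i ir; have := hir i ir => h1 h2; apply/mapP.
    by exists (absz (hi - i)); [rewrite mem_iota; lia|lia].
  rewrite (window_avgE sigma _ ur' hr'); congr (_ * _).
  rewrite big_nat [RHS]big_nat; apply: eq_bigr => p /andP[p1 pN].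
  have hp : 1 <= p%:Z <= N%:Z by lia.
  have bad i : i \in r -> ~~ (1 <= p%:Z + i <= N%:Z) ->
      \prod_(i <- r') zext sigma N (p%:Z + i) ^+ l i = 0.
    move=> ir /negbTE hi'; have /hr li := ir.
    rewrite (bigD1_seq i) ?hr'//= /zext hi' expr0n (negbTE (introN eqP li)).
    by rewrite mul0r.
  rewrite /w word_entry_down//; case: ifP => hN; last first.
    case: hic => hic; first by lia.
    by apply: (bad hi) => //; lia.
  rewrite (_ : h%:Z = hi) in hN *; last by lia.
  rewrite word_entry_sweep//; [|lia|lia].
  case: ifP => ha; last first.
    case: loc => loc; first by lia.
    by apply: (bad lo) => //; lia.
  rewrite /r' big_map -[iota 0 _]/(index_iota 0 (h + a).+1) big_mkord.
  by apply: eq_bigr => k _; rewrite addrA.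
have -> : window_avg sigma l = (fun N => N%:R^-1 * \sum_(1 <= p < N.+1) word_entry sigma N w p%:Z p%:Z).
  exact/funext.
apply: cvgn_complex_re; have := H (monalg.mkmalgU (monalg.FMonom w) 1).
by under eq_fun do rewrite nceval_word ntr_word.
Qed.

End star_moments.

(** * Slowly varying profiles *)

(** Since M is at least 1, [M ^+ n] can stand for the sharper factor [M ^+ n.-1]. *)
Lemma pow_diff_le (R : realType) (M x y : R) n : 1 <= M -> `|x| <= M -> `|y| <= M ->
  `|x ^+ n - y ^+ n| <= M ^+ n * (n%:R * `|x - y|).
Proof.
move=> M1 xM yM; have M0 : 0 <= M by exact: le_trans M1.
elim: n => [|n IH]; first by rewrite !expr0 subrr normr0 mul0r mulr0.
have -> : x ^+ n.+1 - y ^+ n.+1 = x * (x ^+ n - y ^+ n) + y ^+ n * (x - y).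
  by rewrite !exprS; ring.
apply: le_trans (ler_normD _ _) _; rewrite !normrM.
have h1 : `|x| * `|x ^+ n - y ^+ n| <= M ^+ n.+1 * (n%:R * `|x - y|).
  by rewrite exprS -mulrA; apply: ler_pM.
have h2 : `|y ^+ n| * `|x - y| <= M ^+ n.+1 * `|x - y|.
  apply: ler_wpM2r => //; rewrite normrX.
  apply: le_trans (_ : M ^+ n <= _); first by rewrite lerXn2r ?nnegrE.
  by rewrite exprS ler_peMl// exprn_ge0.
apply: le_trans (lerD h1 h2) _.
by rewrite -mulrDr -natr1 mulrDl mul1r.
Qed.

Lemma prod_pow_diff_le (R : realType) (I : Type) (r : seq I) (M y : R) (x : I -> R)
    (l : I -> nat) : 1 <= M -> (forall i, `|x i| <= M) -> `|y| <= M ->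
  `|\prod_(i <- r) x i ^+ l i - y ^+ (\sum_(i <- r) l i)%N| <=
  M ^+ (\sum_(i <- r) l i)%N * \sum_(i <- r) (l i)%:R * `|x i - y|.
Proof.
move=> M1 xM yM; have M0 : 0 <= M by exact: le_trans M1.
elim: r => [|i r IH].
  by rewrite !big_nil expr0 subrr normr0 mulr0.
rewrite !big_cons; set n := (\sum_(j <- r) l j)%N in IH *.
set Q := \prod_(j <- r) _ in IH *; set S := \sum_(j <- r) _ in IH *.
have -> : x i ^+ l i * Q - y ^+ (l i + n)%N =
    x i ^+ l i * (Q - y ^+ n) + y ^+ n * (x i ^+ l i - y ^+ l i).
  by rewrite exprD; ring.
apply: le_trans (ler_normD _ _) _; rewrite !normrM.
have h1 : `|x i ^+ l i| * `|Q - y ^+ n| <= M ^+ l i * (M ^+ n * S).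
  by apply: ler_pM => //; rewrite normrX lerXn2r ?nnegrE.
have h2 : `|y ^+ n| * `|x i ^+ l i - y ^+ l i| <= M ^+ n * (M ^+ l i * ((l i)%:R * `|x i - y|)).
  by apply: ler_pM => //; [rewrite normrX lerXn2r ?nnegrE|exact: pow_diff_le].
apply: le_trans (lerD h1 h2) _.
rewrite exprD le_eqVlt; apply/orP; left; apply/eqP; ring.
Qed.

Section slow_profile.
Context (R : realType) (sigma : nat -> nat -> R) (M : R).
Hypothesis M1 : 1 <= M.
Hypothesis sM : forall N k, (1 <= k <= N)%N -> `|sigma N k| <= M.

Let M0 : 0 <= M. Proof. exact: le_trans M1. Qed.

Let zb N k : `|zext sigma N k| <= M.
Proof. by rewrite /zext; case: ifP => [h|_]; [apply: sM; lia|rewrite normr0]. Qed.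

Let z0 N k : ~~ (1 <= k <= N%:Z) -> zext sigma N k = 0.
Proof. by rewrite /zext => /negbTE ->. Qed.

Let zin N k : (1 <= k <= N)%N -> zext sigma N k%:Z = sigma N k.
Proof. by move=> h; rewrite /zext ifT//; lia. Qed.

Let var N := \sum_(1 <= k < N) `|sigma N k - sigma N k.+1|.
Let step N (k : int) := `|zext sigma N (k + 1) - zext sigma N k|.
Let T N (j : int) := \sum_(1 <= p < N.+1) step N (p%:Z + j).

Let step0 N k : ~~ (0 <= k <= N%:Z) -> step N k = 0.
Proof. by move=> h; rewrite /step !z0 ?subrr ?normr0//; lia. Qed.

(** Moving the window by one lets one step enter on the right and one leave on the left. *)
Let T_shift N j : T N (j + 1) + step N (j + 1) = T N j + step N (N%:Z + (j + 1)).
Proof.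
rewrite /T; have [->|N0] := posnP N.
  by rewrite !big_geq// !add0r.
rewrite [X in X + _ = _]big_nat_recr//= [in RHS]big_nat_recl//=.
have -> : 1%:Z + j = j + 1 by rewrite addrC.
have -> : \sum_(1 <= i < N) step N (i.+1%:Z + j) = \sum_(1 <= i < N) step N (i%:Z + (j + 1)).
  by apply: eq_bigr => i _; congr step; lia.
ring.
Qed.

Let T0_le N : T N 0 <= var N + M.
Proof.
rewrite /T /var; have [->|N0] := posnP N.
  by rewrite !big_geq// add0r.
rewrite big_nat_recr//=; apply: lerD; last first.
  by rewrite /step addr0 [zext _ _ (_ + 1)]z0 ?sub0r ?normrN//; lia.
rewrite le_eqVlt; apply/orP; left; apply/eqP; rewrite big_nat [RHS]big_nat; apply: eq_bigr => i hi.
rewrite /step addr0 (_ : i%:Z + 1 = i.+1%:Z); last by lia.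
have -> : zext sigma N i.+1%:Z = sigma N i.+1 by apply: zin; lia.
have -> : zext sigma N i%:Z = sigma N i by apply: zin; lia.
exact: distrC.
Qed.

(** The right-hand side bounds the total variation of the profile extended by zero: the inner
    variation and two end jumps of at most [M] each. Moving right, only zero steps enter. *)
Let T_pos_le N (j : nat) : T N j%:Z <= var N + 2 * M.
Proof.
elim: j => [|j IH]; first by apply: le_trans (T0_le N) _; have := M0; lra.
have := T_shift N j%:Z; rewrite [step N (N%:Z + _)]step0 ?addr0; last by lia.
rewrite (_ : j%:Z + 1 = j.+1%:Z); last by lia.
move=> E; apply: le_trans IH; rewrite -E lerDl; exact: normr_ge0.
Qed.

Let T_neg_le N (j : nat) : T N (- j%:Z) <= var N + 2 * M.
Proof.
have base : T N (-1) <= var N + 2 * M.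
  have := T_shift N (-1); rewrite addNr addr0 => E.
  have h := T0_le N.
  have h1 : step N 0 <= M by rewrite /step [X in _ - X]z0// subr0.
  have h2 : 0 <= step N N%:Z by exact: normr_ge0.
  lra.
elim: j => [|[|j] IH]; first by rewrite oppr0; exact: (T_pos_le N 0).
  exact: base.
have := T_shift N (- j.+2%:Z); rewrite (_ : - j.+2%:Z + 1 = - j.+1%:Z); last by lia.
rewrite [step N (- _)]step0 ?addr0; last by lia.
by move=> E; apply: le_trans IH; rewrite E lerDl; exact: normr_ge0.
Qed.

Let B N (i : int) := \sum_(1 <= p < N.+1) `|zext sigma N (p%:Z + i) - zext sigma N p%:Z|.

(** The displacement [i] is made of |i| unit steps, each of which costs at most the total variation
    of the extended profile. *)
Let B_le N (i : int) : B N i <= (absz i)%:R * (var N + 2 * M).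
Proof.
have v0 : 0 <= var N + 2 * M by rewrite addr_ge0 ?mulr_ge0// sumr_ge0.
have stepB j : `|B N (j + 1) - B N j| <= T N j.
  rewrite /B -sumrB; apply: le_trans (ler_norm_sum _ _ _) _; apply: ler_sum => p _.
  apply: le_trans (ler_dist_dist _ _) _; rewrite /step.
  rewrite (_ : p%:Z + (j + 1) = p%:Z + j + 1); last by lia.
  by rewrite opprB addrA subrK.
have B0 : B N 0 = 0 by rewrite /B big1// => p _; rewrite addr0 subrr normr0.
have pos (n : nat) : B N n%:Z <= n%:R * (var N + 2 * M).
  elim: n => [|n IH]; first by rewrite B0 mul0r.
  have := stepB n%:Z; rewrite (_ : n%:Z + 1 = n.+1%:Z); last by lia.
  have := T_pos_le N n; rewrite ler_distl -natr1 mulrDl mul1r; lra.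
have neg (n : nat) : B N (- n%:Z) <= n%:R * (var N + 2 * M).
  elim: n => [|n IH]; first by rewrite oppr0 B0 mul0r.
  have := stepB (- n.+1%:Z); rewrite (_ : - n.+1%:Z + 1 = - n%:Z); last by lia.
  have := T_neg_le N n.+1; rewrite ler_distl -natr1 mulrDl mul1r; lra.
case: (lerP 0 i) => hi.
  by have := pos (absz i); rewrite (_ : (absz i)%:Z = i)//; lia.
by have := neg (absz i); rewrite (_ : - (absz i)%:Z = i)//; lia.
Qed.

Variable m : nat -> R.
Hypothesis hvar : N%:R^-1 * var N @[N --> \oo] --> (0 : R).
Hypothesis hmom : forall n, (0 < n)%N ->
  N%:R^-1 * (\sum_(1 <= k < N.+1) sigma N k ^+ n) @[N --> \oo] --> m n.

Lemma slow_window_cvg (l : int -> nat) (r : seq int) : uniq r ->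
  (forall i, l i <> 0%N -> i \in r) -> (0 < \sum_(i <- r) l i)%N ->
  window_avg sigma l N @[N --> \oo] --> m (\sum_(i <- r) l i)%N.
Proof.
move=> ur hr; set n := (\sum_(i <- r) l i)%N => n0.
(* Each site contributes its Lipschitz factor M^n l_i times its distance |i| from [p]. *)
pose c := M ^+ n * \sum_(i <- r) (l i)%:R * (absz i)%:R.
have c0 : 0 <= c by rewrite mulr_ge0 ?exprn_ge0// sumr_ge0// => i _; rewrite mulr_ge0.
have diff N : `|window_avg sigma l N - N%:R^-1 * (\sum_(1 <= k < N.+1) sigma N k ^+ n)| <=
    c * (N%:R^-1 * var N) + (c * (2 * M)) / N%:R.
  rewrite (window_avgE _ _ ur hr) -mulrBr -sumrB normrM ger0_norm ?invr_ge0//.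
  have -> : c * (N%:R^-1 * var N) + (c * (2 * M)) / N%:R = N%:R^-1 * (c * (var N + 2 * M)).
    by ring.
  rewrite ler_wpM2l ?invr_ge0//; apply: le_trans (ler_norm_sum _ _ _) _.
  apply: le_trans (_ : \sum_(1 <= p < N.+1) M ^+ n * \sum_(i <- r) (l i)%:R *
      `|zext sigma N (p%:Z + i) - zext sigma N p%:Z| <= _).
    rewrite big_nat [leRHS]big_nat; apply: ler_sum => p hp.
    by rewrite -(zin (N := N) (k := p))//; exact: prod_pow_diff_le.
  rewrite -mulr_sumr exchange_big /= /c -mulrA; apply: ler_wpM2l; first exact: exprn_ge0.
  rewrite mulr_suml; apply: ler_sum => i _; rewrite -mulr_sumr -mulrA.
  by apply: ler_wpM2l => //; exact: B_le.
have -> : window_avg sigma l = (fun N : nat => (window_avg sigma l N -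
    N%:R^-1 * (\sum_(1 <= k < N.+1) sigma N k ^+ n)) +
    N%:R^-1 * (\sum_(1 <= k < N.+1) sigma N k ^+ n)).
  by apply/funext => N; rewrite subrK.
rewrite -[m n]add0r; apply: cvgD; last exact: hmom.
apply/norm_cvg0P; apply: (@squeeze_cvgr _ _ _ _ (fun=> 0)
  (fun N : nat => c * (N%:R^-1 * var N) + (c * (2 * M)) / N%:R)).
- by apply: nearW => N; rewrite normr_ge0 diff.
- exact: cvg_cst.
- have := cvgD (cvgM (cvg_cst c) hvar) (cvg_harmonicZ (c * (2 * M))).
  by rewrite mulr0 addr0; apply.
Qed.

End slow_profile.

Lemma mean_ae_eq (R : realType) (d : measure_display) (T : measurableType d)
    (P : probability T R) (X Y : T -> R) : measurable_fun setT X -> measurable_fun setT Y ->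
  {ae P, forall w, X w = Y w} -> \int[P]_w X w = \int[P]_w Y w.
Proof.
move=> mX mY XY; rewrite /Rintegral; congr fine; apply: ae_eq_integral => //.
- exact/measurable_EFinP.
- exact/measurable_EFinP.
- by apply: filterS XY => w /= -> _.
Qed.

(** Neighbouring pairs are averaged over N - 1 sites. The factor (N - 1)/N tends to 1, and the last
    term, bounded by [M], disappears after division by N. *)
Lemma cvg_avg_pred (R : realType) (u : nat -> nat -> R) (M l : R) :
  (forall N k, (1 <= k <= N)%N -> `|u N k| <= M) ->
  (N.-1)%:R^-1 * (\sum_(1 <= k < N) u N k) @[N --> \oo] --> l ->
  N%:R^-1 * (\sum_(1 <= k < N) u N k) @[N --> \oo] --> l /\
  N%:R^-1 * (\sum_(1 <= k < N.+1) u N k) @[N --> \oo] --> l.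
Proof.
move=> uM ul.
have h1 : N%:R^-1 * (\sum_(1 <= k < N) u N k) @[N --> \oo] --> l.
  have : (1 - 1 / N%:R) * ((N.-1)%:R^-1 * (\sum_(1 <= k < N) u N k)) @[N --> \oo] --> (1 - 0) * l.
    by apply: cvgM ul; apply: cvgB; [exact: cvg_cst|exact: cvg_harmonicZ].
  rewrite subr0 mul1r; apply: cvg_trans; apply: near_eq_cvg.
  near=> N; have N2 : (2 <= N)%N by near: N; exact: nbhs_infty_ge.
  rewrite mulrA; congr (_ * _).
  have -> : N = N.-1.+1 by rewrite prednK// (leq_trans _ N2).
  rewrite /= -natr1; have : 0 < N.-1%:R :> R by rewrite ltr0n; lia.
  by move=> p; field; rewrite !gt_eqF//; lra.
split => //.
have h2 : N%:R^-1 * u N N @[N --> \oo] --> (0 : R).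
  apply/norm_cvg0P; apply: (@squeeze_cvgr _ _ _ _ (fun=> 0) (fun N : nat => M / N%:R)).
  - near=> N; rewrite normr_ge0 normrM ger0_norm ?invr_ge0//= [leRHS]mulrC.
    rewrite ler_wpM2l ?invr_ge0//; apply: uM; rewrite leqnn andbT.
    by near: N; exact: nbhs_infty_ge.
  - exact: cvg_cst.
  - exact: cvg_harmonicZ.
have h3 : N%:R^-1 * (\sum_(1 <= k < N) u N k) + N%:R^-1 * u N N @[N --> \oo] --> l + 0.
  exact: cvgD h1 h2.
rewrite addr0 in h3; apply: cvg_trans h3; apply: near_eq_cvg.
near=> N; rewrite /= -mulrDr -big_nat_recr//.
by near: N; exact: nbhs_infty_ge.
Unshelve. all: by end_near. Qed.

(** * Profiles whose neighbouring entries merge in the limit *)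

Section pair_limit.
Context (R : realType) (sigma : nat -> nat -> R) (M : R) (mu_T : probability R R).
Hypothesis M1 : 1 <= M.
Hypothesis sM : forall N k, (1 <= k <= N)%N -> `|sigma N k| <= M.
Hypothesis hT : weak_cvg2
  (fun N => empirical_measure R [seq (sigma N k, sigma N k.+1) | k <- iota 1 N.-1])
  (pushforward mu_T (fun t => (t, t))).

Let M0 : 0 <= M. Proof. exact: le_trans M1. Qed.

Let pair_test (F : R * R -> R) (L : R) : continuous F -> measurable_fun setT F ->
  (forall x, `|F x| <= L) ->
  (N.-1)%:R^-1 * (\sum_(1 <= k < N) F (sigma N k, sigma N k.+1)) @[N --> \oo] -->
  \int[mu_T]_t F (t, t).
Proof.
move=> cF mF FL.
have md : measurable_fun setT (fun t : R => (t, t)) by exact: measurable_fun_pair.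
have := hT cF (ex_intro _ L FL).
have bFd : bounded_mfun (fun t => F (t, t)).
  by split; [exact: (measurableT_comp mF md)|exists L].
have -> : (\int[pushforward mu_T (fun t => (t, t))]_x (F x)%:E)%E = (\int[mu_T]_t F (t, t))%:E.
  rewrite (integral_pushforward md)//=.
  - by rewrite preimage_setT; exact: (bounded_mfun_integralE mu_T bFd).
  - exact/measurable_EFinP.
  - by rewrite preimage_setT; exact: (bounded_mfun_integrable mu_T bFd).
have E N : (\int[empirical_measure R [seq (sigma N k, sigma N k.+1) | k <- iota 1 N.-1]]_x
    (F x)%:E)%E = ((N.-1)%:R^-1 * (\sum_(1 <= k < N) F (sigma N k, sigma N k.+1)))%:E.
  rewrite empirical_integral// /avg size_map size_iota big_map.
  by rewrite /index_iota subn1.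
under eq_fun do rewrite E.
by move/fine_cvgP => [_ h]; exact: h.
Qed.

Let pair_test1 (f : R -> R) (L : R) : continuous f -> (forall x, `|f x| <= L) ->
  (N.-1)%:R^-1 * (\sum_(1 <= k < N) f (sigma N k)) @[N --> \oo] --> \int[mu_T]_t f t.
Proof.
move=> cf fL; apply: (@pair_test (fun z => f z.1) L) => //.
- by move=> z; apply: continuous_comp; [exact: cvg_fst|exact: cf].
- by apply: measurableT_comp => //; exact: continuous_measurable_fun.
Qed.

(** The bounded continuous function [g] vanishes exactly on [[- M, M]], where all entries lie; so
    its integral against the limit is 0. *)
Lemma pair_limit_supported : supported_in mu_T M.
Proof.
pose g (t : R) := Num.min 1 (Num.max 0 (`|t| - M)).
have cg : continuous g.
  move=> t; apply: (@continuous_min R R (fun=> 1) (fun t => Num.max 0 (`|t| - M))).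
    exact: cst_continuous.
  apply: (@continuous_max R R (fun=> 0) (fun t => `|t| - M)); first exact: cst_continuous.
  by apply: continuousB; [exact: norm_continuous|exact: cst_continuous].
have g0 t : 0 <= g t by rewrite /g le_min ler01 le_max lexx.
have g1 t : `|g t| <= 1 by rewrite ger0_norm// /g ge_min lexx.
have bg : bounded_mfun g by apply: bounded_mfun_continuous => //; exists 1.
have : \int[mu_T]_t g t = 0.
  have h := pair_test1 cg g1.
  apply/esym/(cvg_unique _ _ h) => //; apply: cvg_near_cst; apply: nearW => N.
  rewrite big_nat big1 ?mulr0// => k hk; rewrite /g (max_idPl _) ?(min_idPr _)//.
  by rewrite subr_le0; apply: sM; lia.
move=> Ig; have : (\int[mu_T]_t `|(g t)%:E|)%E = 0%E.
  under eq_integral do rewrite gee0_abs ?lee_fin//.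
  by rewrite bounded_mfun_integralE// Ig.
have mg : measurable_fun setT (EFin \o g) by apply/measurable_EFinP; case: bg.
move/(ae_eq_integral_abs mu_T measurableT mg) => -[A [mA A0 hA]].
apply/eqP; rewrite -measure_le0 -A0; apply: le_measure; rewrite ?inE//; first exact: measurableC.
move=> t /= ht; apply: hA => /= /(_ I) [] /eqP.
apply/negP; rewrite gt_eqF// /g lt_min ltr01 /= lt_max; apply/orP; right.
by rewrite subr_gt0 ltNge; apply/negP => h; apply: ht; rewrite in_itv /= -ler_norml.
Qed.

Lemma pair_limit_window (l : int -> nat) (r : seq int) : uniq r ->
  (forall i, l i <> 0%N -> i \in r) -> (0 < \sum_(i <- r) l i)%N ->
  window_avg sigma l N @[N --> \oo] --> \int[mu_T]_t (clamp M t ^+ (\sum_(i <- r) l i)%N).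
Proof.
apply: (slow_window_cvg M1 sM (m := fun n => \int[mu_T]_t (clamp M t ^+ n))).
  (* A bounded continuous function that vanishes on the diagonal, which carries the limit, and that
     is the jump of the profile on the actual pairs. *)
  pose F (z : R * R) := `|clamp M z.1 - clamp M z.2|.
  have cF : continuous F.
    move=> z; apply: (@continuous_comp _ _ _ (fun z : R * R => clamp M z.1 - clamp M z.2));
      last exact: norm_continuous.
    by apply: continuousB; (apply: continuous_comp; last exact: clamp_continuous);
      [exact: cvg_fst|exact: cvg_snd].
  have mc : measurable_fun setT (clamp M) by apply: continuous_measurable_fun; exact: clamp_continuous.
  have mF : measurable_fun setT F.
    by apply: measurableT_comp => //; apply: measurable_funB; exact: measurableT_comp.
  have FL z : `|F z| <= 2 * M.
    rewrite normr_id (le_trans (ler_normB _ _))//.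
    have := clamp_bound z.1 M0; have := clamp_bound z.2 M0; lra.
  have h := pair_test cF mF FL.
  have E0 : \int[mu_T]_t F (t, t) = 0.
    by rewrite /F /=; under eq_Rintegral do rewrite subrr normr0; rewrite mean_cst.
  rewrite E0 in h.
  have E N : \sum_(1 <= k < N) `|sigma N k - sigma N k.+1| =
      \sum_(1 <= k < N) F (sigma N k, sigma N k.+1).
    by rewrite big_nat [RHS]big_nat; apply: eq_bigr => k hk; rewrite /F /= !clamp_id//; apply: sM; lia.
  under eq_fun do rewrite E.
  by case: (cvg_avg_pred (u := fun N k => F (sigma N k, sigma N k.+1)) (M := 2 * M) _ h).
move=> n _.
have [cX [L hL]] : continuous (fun t => clamp M t ^+ n) /\ exists L, forall t, `|clamp M t ^+ n| <= L.
  split; last exact: (bounded_mfun_clampX n M0).2.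
  by move=> t; apply: (@clamp_comp_continuous R (fun x => x ^+ n)); exact: exprn_continuous.
have h := pair_test1 cX hL.
have E N : \sum_(1 <= k < N.+1) sigma N k ^+ n = \sum_(1 <= k < N.+1) clamp M (sigma N k) ^+ n.
  by rewrite big_nat [RHS]big_nat; apply: eq_bigr => k hk; rewrite clamp_id//; apply: sM; lia.
under eq_fun do rewrite E.
by case: (cvg_avg_pred (u := fun N k => clamp M (sigma N k) ^+ n) (M := L) _ h).
Qed.

End pair_limit.

(** The constant profile has no variation and all its moments are 1; this is the case of the simple
    tridiagonal model. *)
Lemma window_cvg_one (R : realType) (l : int -> nat) :
  finite_set [set i | l i <> 0%N] -> (exists i, l i <> 0%N) ->
  window_avg (fun _ _ => 1 : R) l N @[N --> \oo] --> (1 : R).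
Proof.
move=> fl [i0 li0]; have [r ur hr] := finite_support_seq fl.
apply: (slow_window_cvg (m := fun=> 1) (lexx 1) _ _ _ ur) => //.
- by move=> N k _; rewrite normr1.
- have E N : \sum_(1 <= k < N) `|1 - 1 : R| = 0 by rewrite big1// => k _; rewrite subrr normr0.
  by under eq_fun do rewrite E mulr0; exact: cvg_cst.
- move=> n _; rewrite -(cvg_shiftS (fun N : nat => _ : R)) /=; apply: cvg_near_cst; apply: nearW => N.
  under eq_bigr do rewrite expr1n.
  by rewrite sumr_const_nat subn1 mulVf// pnatr_eq0.
- by move=> i /hr.
- rewrite (bigD1_seq i0) //=; last exact/hr.
  by rewrite addn_gt0 lt0n; apply/orP; left; apply/eqP.
Qed.

Lemma crossings_irange q (g : q.+1.-tuple int) : closed_path q g ->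
  (forall i, crossings g i <> 0%N -> i \in irange q) /\
  (\sum_(i <- irange q) crossings g i)%N = q.
Proof.
rewrite closed_path_walks /= => gw; split.
  by move=> i /(crossings_range gw); rewrite -mem_irange; lia.
by apply: (sum_crossings (irange_uniq q) _ gw) => i; rewrite -mem_irange; lia.
Qed.

(** For q > 0 the crossings sum to q, so they are not all zero and the window limit is a genuine
    limit. For q = 0 the convention gives 1. *)
Lemma window_limit_crossings (R : realType) (sigma : nat -> nat -> R) (m : nat -> R) q
    (g : q.+1.-tuple int) : closed_path q g -> m 0%N = 1 ->
  ((0 < q)%N -> window_avg sigma (crossings g) N @[N --> \oo] --> m q) ->
  window_limit sigma (crossings g) = m q.
Proof.
case: q g => [|q] g cg m0 H; rewrite /window_limit.
  by rewrite asboolT ?m0.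
case: asboolP => [g0|_]; last by apply/cvg_lim => //; exact: H.
by have [_] := crossings_irange cg; rewrite big1.
Qed.

Lemma supported_inW (R : realType) (mu : probability R R) (K K' : R) : K <= K' ->
  supported_in mu K -> supported_in mu K'.
Proof.
move=> KK' smu; apply/eqP; rewrite -measure_le0 -[X in (_ <= X)%E]smu.
apply: le_measure; rewrite ?inE; [exact: measurableC|exact: measurableC|].
by move=> x /= nx hx; apply: nx; move: hx; rewrite !in_itv /=; lra.
Qed.

Lemma supported_clamp_moment (R : realType) (mu : probability R R) (K K' : R) q :
  0 <= K -> K <= K' -> supported_in mu K ->
  \int[mu]_x (clamp K' x ^+ q) = \int[mu]_x (clamp K x ^+ q).
Proof.
move=> K0 KK' smu; have cX : continuous (fun x : R => x ^+ q) by exact: exprn_continuous.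
apply: EFin_inj; rewrite -(supported_integralE K0 smu cX).
by rewrite -(supported_integralE (le_trans K0 KK') (supported_inW KK' smu) cX).
Qed.

(** Both measures live on the compact interval of radius K, and moments of a product factor under
    the product measure, so equality of moments decides. The truncations at [K1], [K2] and [K] are
    compatible almost everywhere because K1 K2 <= K. *)
Lemma product_law (R : realType) (mu nu1 nu2 : probability R R) (K K1 K2 : R) :
  0 < K -> 0 <= K1 -> 0 <= K2 -> K1 * K2 <= K ->
  supported_in mu K -> supported_in nu1 K1 -> supported_in nu2 K2 ->
  (forall q, \int[mu]_x (clamp K x ^+ q) =
     \int[nu1]_x (clamp K1 x ^+ q) * \int[nu2]_x (clamp K2 x ^+ q)) ->
  forall A, measurable A -> mu A = pushforward (nu1 \x nu2)%E (fun p => p.1 * p.2) A.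
Proof.
move=> K0 K10 K20 K12 smu s1 s2 hm.
have mm : measurable_fun setT (fun p : R * R => p.1 * p.2) by exact: measurable_funM.
pose P12 : probability _ R := (nu1 \x nu2)%E.
have ae12 : {ae P12, forall p : R * R, `|p.1| <= K1 /\ `|p.2| <= K2}.
  exists ((~` `[- K1, K1]%classic `*` setT) `|` (setT `*` ~` `[- K2, K2]%classic)); split.
  - by apply: measurableU; apply: measurableX => //; exact: measurableC.
  - apply/eqP; rewrite -measure_le0; apply: le_trans (measureU2 _ _ _) _.
    + by apply: measurableX => //; exact: measurableC.
    + by apply: measurableX => //; exact: measurableC.
    have e1 : (nu1 \x nu2)%E (~` `[- K1, K1]%classic `*` setT) = 0%E.
      rewrite product_measure1E//; last exact: measurableC.
      by transitivity (0 * nu2 setT)%E; [congr (_ * _)%E; exact: s1|rewrite mul0e].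
    have e2 : (nu1 \x nu2)%E (setT `*` ~` `[- K2, K2]%classic) = 0%E.
      rewrite product_measure1E//; last exact: measurableC.
      by transitivity (nu1 setT * 0)%E; [congr (_ * _)%E; exact: s2|rewrite mule0].
    rewrite (_ : (_ + _)%E = 0%E)// -[RHS](adde0 0%E).
    by congr (_ + _)%E; [exact: e1 | exact: e2].
  - move=> p /= np; apply: contrapT => /not_orP[h1 h2]; apply: np.
    rewrite /= in h1 h2; split; rewrite ler_norml.
      by apply: contrapT => h; apply: h1; split => //; rewrite in_itv /=.
    by apply: contrapT => h; apply: h2; split => //; rewrite in_itv /=.
pose nu : probability R R := distribution P12 (mfun_of mm).
have snu : supported_in nu K.
  rewrite /supported_in /nu /distribution /pushforward /=.
  have [A [mA A0 hA]] := ae12; apply/eqP; rewrite -measure_le0 -A0; apply: le_measure.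
  - rewrite inE -[X in measurable X]setTI.
    by have := mm measurableT (~` `[- K, K]%classic); apply; exact: measurableC.
  - by rewrite inE.
  move=> p /= hp; apply: hA => -[h1 h2]; apply: hp; rewrite in_itv /= -ler_norml normrM.
  by apply: le_trans K12; exact: ler_pM.
suff : forall q, \int[mu]_x (clamp K x ^+ q) = \int[nu]_x (clamp K x ^+ q).
  by move=> h A mA; rewrite (probability_eq_moments K0 smu snu h mA).
move=> q; rewrite hm -mean_prod; [|exact: bounded_mfun_clampX..].
rewrite mean_distribution; last exact/bounded_mfun_clampX/ltW.
have mcl (L : R) : measurable_fun setT (clamp L).
  by apply: continuous_measurable_fun; exact: clamp_continuous.
apply: mean_ae_eq.
- by apply: measurable_funM; apply: measurable_funX; exact: measurableT_comp.
- by apply: measurable_funX; exact: measurableT_comp.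
- apply: filterS ae12 => p [h1 h2] /=; rewrite !clamp_id ?exprMn// normrM.
  by apply: le_trans K12; exact: ler_pM.
Qed.

Lemma jacobi_eq (R : realType) (sigma : nat -> nat -> R) (b b' : nat -> R) N :
  (forall k, (1 <= k)%N -> b k = b' k) -> jacobi_mx sigma b N = jacobi_mx sigma b' N.
Proof.
move=> bb; suff E : weight_mx b N = weight_mx b' N by rewrite /jacobi_mx E.
by congr diag_mx; apply/rowP => k; rewrite !mxE bb.
Qed.

Lemma ess_bounded (R : realType) (d : measure_display) (Om : measurableType d)
    (P : probability Om R) (X : Om -> R) : ('N[P]_+oo[EFin \o X] < +oo)%E ->
  exists2 C : R, 0 < C & {ae P, forall w, `|X w| <= C}.
Proof.
rewrite unlock /= ifT; last by rewrite [P setT]probability_setT.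
set s := ess_sup _ _ => soo; exists (Num.max 1 (fine s)); first by rewrite lt_max ltr01.
have := ess_sup_ge P (abse \o (EFin \o X)); apply: filterS => w /= h.
rewrite le_max; apply/orP; right; rewrite -lee_fin fineK//.
by rewrite fin_numElt soo andbT (lt_le_trans _ h)// ltNyr.
Qed.

Theorem theorem4p9 (R : realType) (d : measure_display)
    (Om : measurableType d) (P : probability Om R)
    (sigma : nat -> nat -> R) (b : nat -> {RV P >-> R})
    (b_indep : independent_RVs b) (b_ident : identically_distributed b)
    (sigma_bounded :
      (ereal_sup [set opnorm (profile_mx sigma N) | N in [set N | (1 <= N)%N]]
         < +oo)%E)
    (b_bounded : ('N[P]_+oo[EFin \o b 1%N] < +oo)%E)
    (moments_cvg : star_moments_cvg sigma) :
  let J (N : nat) (w : Om) := jacobi_mx sigma (fun k => b k w) N in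
  exists mu : probability R R,
    [/\ compactly_supported mu,
        {ae P, forall w, weak_cvg (fun N => esd (J N w)) mu} &
        weak_cvg (fun N => expected_esd P (J N)) mu] /\
    [/\ forall l : int -> nat, finite_set [set i | l i <> 0%N] ->
          (exists i, l i <> 0%N) -> cvgn (window_avg sigma l),
        forall q : nat,
          (\int[mu]_x (x ^+ q)%:E)%E =
          (\sum_(g \in closed_path q)
             window_limit sigma (crossings g) *
             \big[*%R/1]_(i \in [set: int])
               fine 'E_P[fun w => b 1%N w ^+ crossings g i])%:E &
        exists mu_b : probability R R,
          {ae P, forall w,
             weak_cvg (fun N => esd (tridiag_mx (fun k => b k w) N)) mu_b} /\
          forall mu_T : probability R R,
            weak_cvg2
              (fun N => empirical_measure R
                 [seq (sigma N k, sigma N k.+1) | k <- iota 1 N.-1])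
              (pushforward mu_T (fun t => (t, t))) ->
            (forall (q : nat) (g : q.+1.-tuple int), closed_path q g ->
               (window_limit sigma (crossings g))%:E =
               (\int[mu_T]_t (t ^+ q)%:E)%E) /\
            (forall A : set R, measurable A ->
               mu A = pushforward (mu_T \x mu_b)%E (fun p => p.1 * p.2) A)].
Proof.
move=> J.
have [M M1 sM] := profile_bound sigma_bounded.
have M0 : 0 < M by exact: lt_le_trans M1.
have wcvg := window_avg_cvg moments_cvg.
have [C C0 bC1] := ess_bounded b_bounded.
have mb k : measurable_fun setT (b k : Om -> R) by exact: measurable_funP.
have mcl : measurable_fun setT (clamp C : R -> R).
  by apply: continuous_measurable_fun; exact: clamp_continuous.
(* The bound is assumed for [b 1] only; equality of laws carries the null set over to every positive
   index. *)
have bCk (k : nat) : {ae P, forall w, (1 <= k)%N -> `|b k w| <= C}.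
  have [->|k1] := posnP k; first exact: aeW.
  exists (b k @^-1` ~` `[- C, C]%classic); split.
  - by rewrite -[X in measurable X]setTI; apply: mb => //; exact: measurableC.
  - have := b_ident k k1 (~` `[- C, C]%classic); rewrite /distribution /pushforward => ->.
      have [A [mA A0 hA]] := bC1; apply/eqP; rewrite -measure_le0 -A0; apply: le_measure.
      + by rewrite inE -[X in measurable X]setTI; apply: mb => //; exact: measurableC.
      + by rewrite inE.
      by move=> w /= hw; apply: hA => h; apply: hw; rewrite in_itv /= -ler_norml.
    exact: measurableC.
  - by move=> w /= hw h; apply: hw => _; move: h; rewrite in_itv /= -ler_norml.
have bC : {ae P, forall w, forall k, (1 <= k)%N -> `|b k w| <= C} by exact: ae_foralln.
(* Truncation preserves independence and equality of laws, since preimages under [clamp C] of Borel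
   sets are Borel. *)
pose b' k w := clamp C (b k w).
have mb' k : measurable_fun setT (b' k) by exact: measurableT_comp.
have b'C k w : `|b' k w| <= C by apply: clamp_bound; exact: ltW.
have indep' (I : seq nat) (A : nat -> set R) : uniq I -> all (leq 1) I ->
    (forall k, measurable (A k)) ->
    P (\bigcap_(k in [set` I]) (b' k @^-1` A k)) = (\prod_(k <- I) P (b' k @^-1` A k))%E.
  move=> uI aI mA; apply: (b_indep I (fun k => clamp C @^-1` A k)) => // k.
  by rewrite -[X in measurable X]setTI; exact: mcl.
have ident' k : (1 <= k)%N -> forall A : set R, measurable A ->
    P (b' k @^-1` A) = P (b' 1%N @^-1` A).
  move=> k1 A mA; apply: (b_ident k k1 (clamp C @^-1` A)).
  by rewrite -[X in measurable X]setTI; exact: mcl.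
have b'E : {ae P, forall w, forall k, (1 <= k)%N -> b k w = b' k w}.
  by apply: filterS bC => w hw k k1; rewrite /b' clamp_id// hw.
have betaE n : fine 'E_P[fun w => b 1%N w ^+ n] = \int[P]_w (b' 1%N w ^+ n).
  rewrite unlock; apply: mean_ae_eq; [exact: measurable_funX|exact: measurable_funX|].
  by apply: filterS b'E => w /(_ 1%N isT) ->.
have M0C0 : 0 < 2 * (M * C) + 1 by rewrite addr_gt0// !mulr_gt0.
have [mu [smu mmu wmu]] := model_limit mb' indep' ident' b'C M0 C0 sM wcvg.
have wcvg1 (l : int -> nat) : finite_set [set i | l i <> 0%N] -> (exists i, l i <> 0%N) ->
    cvgn (window_avg (fun _ _ => 1 : R) l).
  by move=> fl el; apply/cvg_ex; exists 1; exact: window_cvg_one.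
(* The simple model is the profile constantly 1; as M is at least 1, the same bound applies and both
   limit laws share one interval. *)
have s1 N k : (1 <= k <= N)%N -> `|1 : R| <= M by rewrite normr1.
have [nu [snu mnu wnu]] := model_limit mb' indep' ident' b'C M0 C0 s1 wcvg1.
have aeJ : {ae P, forall w, weak_cvg (fun N => esd (J N w)) mu}.
  apply: filterS2 wmu b'E => w hw bw.
  move=> f cf bf; have := hw f cf bf; apply: cvg_trans; apply: near_eq_cvg.
  by apply: nearW => N; rewrite /J (jacobi_eq _ _ bw).
exists mu; split.
  split => //; first exact: compact_support smu.
  exact: (expected_weak_cvg (b := fun k => b k : Om -> R)).
split => //.
- move=> q; rewrite (supported_integralE (ltW M0C0) smu); last exact: exprn_continuous.
  rewrite mmu /limit_moment closed_path_walks -fsbig_seq ?walks_uniq//.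
  congr EFin; rewrite big_seq [RHS]big_seq; apply: eq_bigr => g gw; congr (_ * _).
  have cg : closed_path q g by rewrite closed_path_walks.
  have [hg _] := crossings_irange cg.
  rewrite (fsbig_prod_fun (F := fun n => fine 'E_P[fun w => b 1%N w ^+ n]) (irange_uniq q) _ hg).
    by apply: eq_bigr => i _; rewrite betaE.
  by rewrite betaE; under eq_Rintegral do rewrite expr0; rewrite mean_cst.
exists nu; split.
  apply: filterS2 wnu b'E => w hw bw.
  move=> f cf bf; have := hw f cf bf; apply: cvg_trans; apply: near_eq_cvg.
  by apply: nearW => N; rewrite tridiag_jacobi (jacobi_eq _ _ bw).
move=> mu_T hT.
have sT := pair_limit_supported M1 sM hT.
have mT0 : \int[mu_T]_t (clamp M t ^+ 0) = 1.
  by under eq_Rintegral do rewrite expr0; rewrite mean_cst.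
have win q (g : q.+1.-tuple int) : closed_path q g ->
    window_limit sigma (crossings g) = \int[mu_T]_t (clamp M t ^+ q).
  move=> cg; apply: (window_limit_crossings (m := fun q => \int[mu_T]_t (clamp M t ^+ q)) cg mT0) => q0.
  have [hg sg] := crossings_irange cg.
  have := pair_limit_window M1 sM hT (irange_uniq q) hg.
  by rewrite sg => /(_ q0).
have win1 q (g : q.+1.-tuple int) : closed_path q g ->
    window_limit (fun _ _ => 1 : R) (crossings g) = 1.
  move=> cg; apply: (window_limit_crossings (m := fun=> 1) cg) => // q0.
  have [hg sg] := crossings_irange cg.
  apply: window_cvg_one.
    by apply: (@sub_finite_set _ _ [set` irange q]) => // i /= /hg.
  apply: contrapT => /forallNP h; move: q0; rewrite -sg big1// => i _.
  by apply: contrapT; exact: h.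
split.
  move=> q g cg; rewrite (supported_integralE (ltW M0) sT); last exact: exprn_continuous.
  by rewrite win.
set K := 2 * (M * C) + 1 in M0C0 smu mmu snu mnu.
(* The interval must contain the support of [mu] as well as the products of points of [[- M, M]] and
   [[- K, K]]. *)
pose K' := Num.max K (M * K).
have KK' : K <= K' by rewrite le_max lexx.
apply: (product_law (lt_le_trans M0C0 KK') (ltW M0) (ltW M0C0) _ (supported_inW KK' smu) sT snu).
  by rewrite le_max lexx orbT.
(* Every path of length [q] carries the same factor, the q-th moment of [mu_T]; what remains of the
   path sum is the moment of [nu], whose window limits are all 1. *)
move=> q; rewrite (supported_clamp_moment q (ltW M0C0) KK' smu) mmu mnu /limit_moment mulr_sumr.
rewrite big_seq [RHS]big_seq; apply: eq_bigr => g gw.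
have cg : closed_path q g by rewrite closed_path_walks.
by rewrite win// win1// mul1r.
Qed.
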